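(* Let the ARDD method (described in the context) be applied, with $N\ge 1$ iterations and batch size $m\ge 1$, to the problem $\min_{x\in\mathbb{R}^n} f(x)$, $f(x)=\mathbb{E}_\xi[F(x,\xi)]$, under the assumptions listed in the context. Then its output $y_N$ satisfies $$\mathbb{E}[f(y_N)] - f(x^* ) \le \frac{384\,\Theta_p n^2\rho_n L_2}{N^2} + \frac{4N}{nL_2}\cdot\frac{\sigma^2}{m} + \frac{61N}{24L_2}\Delta_\zeta + \frac{122N}{3L_2}\Delta_\eta^2 + \frac{12\sqrt{2n\Theta_p}}{N^2}\left(\frac{\sqrt{\Delta_\zeta}}{2}+2\Delta_\eta\right) + \frac{N^2}{12n\rho_nL_2}\left(\frac{\sqrt{\Delta_\zeta}}{2}+2\Delta_\eta\right)^2,$$ where $\Theta_p = V[z_0](x^* )$ and $\mathbb{E}$ is the expectation over all the randomness $e_1,\dots,e_N,\xi_{1,1},\dots,\xi_{N,m}$ of the method.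
   Context: Problem. $n\ge 8$; $\xi$ is a random vector with distribution $P$ on $\mathcal{X}$; for $P$-almost every $\xi$ the function $F(\cdot,\xi):\mathbb{R}^n\to\mathbb{R}$ is closed and convex and has gradient $g(x,\xi)$ that is $L(\xi)$-Lipschitz in the Euclidean norm, with $\sqrt{\mathbb{E}_\xi L(\xi)^2}\le L_2<+\infty$, $L_2>0$. Then $\mathbb{E}_\xi g(x,\xi)=\nabla f(x)$ and $\nabla f$ is $L_2$-Lipschitz in the Euclidean norm. Also $\mathbb{E}_\xi\|g(x,\xi)-\nabla f(x)\|_2^2\le\sigma^2$ for all $x$. A minimizer $x^*$ of $f$ exists (fixed). Oracle. Let $S_2(1)$ be the unit Euclidean sphere centered at $0$ in $\mathbb{R}^n$, and write $e\in RS_2(1)$ for $e$ uniformly distributed on $S_2(1)$. For $x\in\mathbb{R}^n$, $e\in S_2(1)$ and $\xi$ drawn independently from $P$, the oracle returns $\tilde f'(x,\xi,e)=\langle g(x,\xi),e\rangle+\zeta(x,\xi,e)+\eta(x,\xi,e)$, where $\mathbb{E}_\xi(\zeta(x,\xi,e))^2\le\Delta_\zeta$ for all $x,e$, and $|\eta(x,\xi,e)|\le\Delta_\eta$ for all $x,e$ and almost surely in $\xi$. Proximal setup. $p\in[1,2]$, $\frac1p+\frac1q=1$ (so $q\in[2,\infty]$), $\|\cdot\|_p$ is the usual $p$-norm. The prox-function $d$ is continuous, convex and 1-strongly convex on $\mathbb{R}^n$ w.r.t. $\|\cdot\|_p$, i.e. $d(y)-d(x)-\langle\nabla d(x),y-x\rangle\ge\frac12\|y-x\|_p^2$,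 with $\min d=0$. For $p=1$ the choice is $d(x)=\frac{\mathrm{e}\,n^{(\kappa-1)(2-\kappa)/\kappa}\ln n}{2}\|x\|_\kappa^2$ with $\kappa=1+\frac1{\ln n}$; for $p=2$ it is $d(x)=\frac12\|x\|_2^2$. Bregman divergence: $V[z](x)=d(x)-d(z)-\langle\nabla d(z),x-z\rangle$. Put $\rho_n=\min\{q-1,\,16\ln n-8\}\,n^{\frac2q-1}$ (for $q=\infty$: $q-1=\infty$, $2/q=0$). ARDD method (input: starting point $x_0$, $N$, $m$). Set $y_0=z_0=x_0$. For $k=0,\dots,N-1$: put $\alpha_{k+1}=\frac{k+2}{96n^2\rho_nL_2}$, $\tau_k=\frac1{48\alpha_{k+1}n^2\rho_nL_2}=\frac2{k+2}$; set $x_{k+1}=\tau_kz_k+(1-\tau_k)y_k$; draw $e_{k+1}\in RS_2(1)$ and independent realizations $\xi_{k+1,1},\dots,\xi_{k+1,m}$ of $\xi$, independently of the past; compute $\widetilde\nabla^mf(x_{k+1})=\frac1m\sum_{i=1}^m\tilde f'(x_{k+1},\xi_{k+1,i},e_{k+1})\,e_{k+1}$; set $y_{k+1}=x_{k+1}-\frac1{2L_2}\widetilde\nabla^mf(x_{k+1})$ and $z_{k+1}=\arg\min_{z\in\mathbb{R}^n}\{\alpha_{k+1}n\langle\widetilde\nabla^mf(x_{k+1}),z-z_k\rangle+V[z_k](z)\}$. Output $y_N$. *)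

(* Defs.v *)
From HB Require Import structures.
From mathcomp Require Import all_boot all_order all_algebra.
From mathcomp Require Import all_classical all_reals all_analysis.

Set Implicit Arguments.
Unset Strict Implicit.
Unset Printing Implicit Defensive.

Import Order.TTheory GRing.Theory Num.Theory.
Import numFieldNormedType.Exports.

Local Open Scope classical_set_scope.
Local Open Scope ring_scope.

(* Row vectors carry the sigma-algebra generated by the coordinate maps, as
   [n.-tuple T] does in the library; on ['rV[R]_n] it is the Borel one. *)
Definition measure_rV_display : measure_display -> measure_display.
Proof. exact. Qed.

Section measurable_rV.
Context {d : measure_display} {T : measurableType d} {n : nat}.

Let coors : 'I_n -> 'rV[T]_n -> T := fun i x => x ord0 i.

Let rV_set0 : g_sigma_preimage coors set0.
Proof. exact: sigma_algebra0. Qed.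

Let rV_setC A : g_sigma_preimage coors A -> g_sigma_preimage coors (~` A).
Proof. exact: sigma_algebraC. Qed.

Let rV_bigcup (A : (set 'rV[T]_n)^nat) :
  (forall i, g_sigma_preimage coors (A i)) ->
  g_sigma_preimage coors (\bigcup_i (A i)).
Proof. exact: sigma_algebra_bigcup. Qed.

HB.instance Definition _ := @isMeasurable.Build (measure_rV_display d)
  'rV[T]_n (g_sigma_preimage coors) rV_set0 rV_setC rV_bigcup.

End measurable_rV.

Definition kappa (R : realType) (n : nat) : R := 1 + (ln n%:R)^-1.

Section euclidean_space.
Context {R : realType} {n : nat}.
Implicit Types x y z : 'rV[R]_n.

Definition dot x y : R := \sum_i x ord0 i * y ord0 i.

Definition norm2 x : R := Num.sqrt (dot x x).

Definition normp (p : R) x : R := (\sum_i `|x ord0 i| `^ p) `^ p^-1.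

Definition grad (h : 'rV[R]_n -> R) x : 'rV[R]_n :=
  \row_i 'd h x (delta_mx ord0 i).

Definition has_gradient (h : 'rV[R]_n -> R) (G : 'rV[R]_n -> 'rV[R]_n) :=
  forall x, differentiable h x /\ G x = grad h x.

Definition lipschitz2 (G : 'rV[R]_n -> 'rV[R]_n) (l : R) :=
  forall x y, norm2 (G x - G y) <= l * norm2 (x - y).

Definition closed_function (h : 'rV[R]_n -> R) :=
  closed [set u : 'rV[R]_n * R | h u.1 <= u.2].

Definition minimizer (h : 'rV[R]_n -> R) x := forall y, h x <= h y.

Definition argmin (h : 'rV[R]_n -> R) : 'rV[R]_n :=
  get [set x | minimizer h x].

Definition sphere2 : set 'rV[R]_n := [set x | norm2 x = 1].

(* The uniform distribution on the sphere is the only rotation-invariant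
   probability on it. *)
Definition uniform_on_sphere (mu : set 'rV[R]_n -> \bar R) :=
  mu sphere2 = 1%E /\
  forall Q : 'M[R]_n, Q *m Q^T = 1%:M ->
  forall A : set 'rV[R]_n, measurable A ->
    mu ((fun x => x *m Q) @^-1` A) = mu A.

Definition bregman (d : 'rV[R]_n -> R) z x : R :=
  d x - d z - dot (grad d z) (x - z).

Definition prox_function (p : R) (d : 'rV[R]_n -> R) :=
  [/\ continuous d,
      convex_function [set: 'rV[R]_n] d,
      forall x, differentiable d x,
      forall x y, 2^-1 * normp p (y - x) ^+ 2
                  <= d y - d x - dot (grad d x) (y - x)
    & (forall x, 0 <= d x) /\ exists x, d x = 0].

Definition prox_l1 x : R :=
  let k := kappa R n in
  expR 1 * n%:R `^ ((k - 1) * (2 - k) / k) * ln n%:R / 2 * normp k x ^+ 2.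

Definition prox_l2 x : R := 2^-1 * norm2 x ^+ 2.

End euclidean_space.

Definition rho {R : realType} (n : nat) (q : \bar R) : R :=
  match q with
  | r%:E => Num.min (r - 1) (16 * ln n%:R - 8) * n%:R `^ (2 / r - 1)
  | _ => (16 * ln n%:R - 8) * n%:R `^ (- 1)
  end.

Definition objective {R : realType} {n : nat} {dX : measure_display}
    {X : measurableType dX} (P : probability X R)
    (F : 'rV[R]_n -> X -> R) (x : 'rV[R]_n) : R :=
  fine ('E_P[F x])%E.

Definition oracle {R : realType} {n : nat} {X : Type}
    (g : 'rV[R]_n -> X -> 'rV[R]_n)
    (zeta eta : 'rV[R]_n -> X -> 'rV[R]_n -> R)
    (x : 'rV[R]_n) (xi : X) (e : 'rV[R]_n) : R :=
  dot (g x xi) e + zeta x xi e + eta x xi e.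

Section ardd.
Context {R : realType} {n m : nat} {X : Type}.
Variables (L2 rho_n : R) (d : 'rV[R]_n -> R).
Variable orc : 'rV[R]_n -> X -> 'rV[R]_n -> R.

Definition batch_gradient (x : 'rV[R]_n) (xi : 'I_m -> X) (e : 'rV[R]_n) :
    'rV[R]_n :=
  m%:R^-1 *: \sum_(i < m) orc x (xi i) e *: e.

Definition ardd_alpha (k : nat) : R :=
  k.+1%:R / (96 * n%:R ^+ 2 * rho_n * L2).

Definition ardd_tau (k : nat) : R :=
  (48 * ardd_alpha k.+1 * n%:R ^+ 2 * rho_n * L2)^-1.

(* [ardd x0 e xi k] is the pair (y_k, z_k) along the noise realization [e k],
   [xi k i], where k >= 1; [e 0] and [xi 0] are not used. *)
Fixpoint ardd (x0 : 'rV[R]_n) (e : nat -> 'rV[R]_n) (xi : nat -> 'I_m -> X)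
    (k : nat) : 'rV[R]_n * 'rV[R]_n :=
  if k is k'.+1 then
    let: (y, z) := ardd x0 e xi k' in
    let x := ardd_tau k' *: z + (1 - ardd_tau k') *: y in
    let G := batch_gradient x (xi k) (e k) in
    (x - (2 * L2)^-1 *: G,
     argmin (fun u => ardd_alpha k * n%:R * dot G (u - z) + bregman d z u))
  else (x0, x0).

Definition ardd_output (x0 : 'rV[R]_n) (e : nat -> 'rV[R]_n)
    (xi : nat -> 'I_m -> X) (N : nat) : 'rV[R]_n :=
  (ardd x0 e xi N).1.

End ardd.

Section independence.
Context {R : realType} {dO : measure_display} {Omega : measurableType dO}.
Variable Pr : probability Omega R.

Definition mutually_independent (I : finType) (S : I -> set_system Omega) :=
  forall (J : {set I}) (A : I -> set Omega), (forall i, i \in J -> S i (A i)) ->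
    Pr (\bigcap_(i in [set` J]) A i) = (\prod_(i in J) Pr (A i))%E.

Definition generated_by {dT : measure_display} {T : measurableType dT}
    (Y : Omega -> T) : set_system Omega :=
  preimage_set_system [set: Omega] Y measurable.

(* The family e_1, ..., e_N, xi_(1,1), ..., xi_(N,m); an index k : 'I_N stands
   for the iteration k + 1. *)
Definition samples_independent {n : nat} {dX : measure_display}
    {X : measurableType dX} (N m : nat) (e : nat -> Omega -> 'rV[R]_n)
    (xi : nat -> 'I_m -> Omega -> X) :=
  @mutually_independent ('I_N + 'I_N * 'I_m)%type (fun j =>
    match j with
    | inl k => generated_by (e k.+1)
    | inr (k, i) => generated_by (xi k.+1 i)
    end).

End independence.

(* Main.v *)
(** One step of the method is analysed pathwise.  The estimator is (u + s + th) e
    with u = <grad f(x), e>, s the batch error of the gradient and th the mean of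
    the oracle noise.  The mirror step costs the squared dual norm of this vector,
    which is dominated by (u + s + th)^2 w(e), where w(e) is a multiple of the
    squared 2k-norm of e; with k close to q / 2 (or to ln n when q is large) the
    mean of w over the sphere is at most 6 rho_n.  Since w is invariant under sign
    changes and permutations of the coordinates, E <a, e> <b, e> w(e) is
    <a, b> E w / n.  This makes n <grad f(x), e> e an unbiased estimator, and lets
    the gain -u^2 / 4 of the gradient step pay for the cost of the mirror step.
    The noise terms contribute sigma^2 / (n m) and the level
    Delta_zeta + 2 sqrt(Delta_zeta) Delta_eta + 2 Delta_eta^2, and the product of
    th with <e, z - xs> is split by Young's inequality with a free parameter,
    because E <e, z - xs>^2 <= 2 V[z](xs) / n.  Telescoping with the weights
    (k + 1)^2 and choosing the parameter at each step gives the bound. *)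

Require Import Defs.
From HB Require Import structures.
From mathcomp Require Import all_boot all_order all_algebra.
From mathcomp Require Import all_classical all_reals all_analysis.
From mathcomp Require Import perm measurable_realfun zify ring lra.

Set Implicit Arguments.
Unset Strict Implicit.
Unset Printing Implicit Defensive.

Import Order.TTheory GRing.Theory Num.Theory.
Import numFieldNormedType.Exports.

Local Open Scope classical_set_scope.
Local Open Scope ring_scope.

(** Integrability of the iterates has to be proved along the way: each step yields the inequality in
    expectation together with finiteness of [E |y_k - xs|^2] and [E V[z_k](xs)]. Independence is
    given as a product formula for events. It is used in the form that a fresh sample has a known
    law and is independent of a tuple of earlier quantities, and which sample is integrated last
    depends on the term: the direction for the squares of the gradient errors, where the symmetry of
    the weight gains the factor 1/n; a realization of [xi] for their cross terms and for the oracle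
    noise, whose bounds hold at a fixed direction. The constants fit because the quadratic upper
    bound for [f] has constant [L2], for which the step [1/(2 L2)] contributes
    [((s + th)^2 - u^2) / (4 L2)], while [E w / (48 rho_n) <= 1/8] is half of the available 1/4. The
    parameter of Young's inequality stays free because its choice involves a bound for [E
    V[z_k](xs)], which only the induction over the iterations supplies. *)

Section euclid.
Context {R : realType} {n : nat}.
Implicit Types x y z : 'rV[R]_n.

(** * Inner product and Euclidean norm *)

Lemma dotC x y : dot x y = dot y x.
Proof. by apply: eq_bigr => i _; rewrite mulrC. Qed.

Lemma dotDl x y z : dot (x + y) z = dot x z + dot y z.
Proof. by rewrite -big_split; apply: eq_bigr => i _; rewrite mxE mulrDl. Qed.

Lemma dotDr x y z : dot z (x + y) = dot z x + dot z y.
Proof. by rewrite dotC dotDl !(dotC _ z). Qed.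

Lemma dotZl (a : R) x y : dot (a *: x) y = a * dot x y.
Proof. by rewrite mulr_sumr; apply: eq_bigr => i _; rewrite mxE mulrA. Qed.

Lemma dotZr (a : R) x y : dot x (a *: y) = a * dot x y.
Proof. by rewrite dotC dotZl dotC. Qed.

Lemma dotNl x y : dot (- x) y = - dot x y.
Proof. by rewrite -scaleN1r dotZl mulN1r. Qed.

Lemma dotNr x y : dot x (- y) = - dot x y.
Proof. by rewrite dotC dotNl dotC. Qed.

Lemma dotBl x y z : dot (x - y) z = dot x z - dot y z.
Proof. by rewrite dotDl dotNl. Qed.

Lemma dotBr x y z : dot z (x - y) = dot z x - dot z y.
Proof. by rewrite dotDr dotNr. Qed.

Lemma dot0r x : dot x 0 = 0.
Proof. by rewrite -[0](scale0r 0) dotZr mul0r. Qed.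

Lemma dot0l x : dot 0 x = 0.
Proof. by rewrite dotC dot0r. Qed.

Lemma dot_delta x i : dot x (delta_mx ord0 i) = x ord0 i.
Proof.
rewrite /dot (bigD1 i)//= mxE !eqxx mulr1 big1 ?addr0// => j ji.
by rewrite mxE (negbTE ji) mulr0.
Qed.

Lemma dotxx_ge0 x : 0 <= dot x x.
Proof. by apply: sumr_ge0 => i _; rewrite -expr2 sqr_ge0. Qed.

Lemma dotxxE x : dot x x = \sum_i x ord0 i ^+ 2.
Proof. by apply: eq_bigr => i _; rewrite expr2. Qed.

Lemma norm2_sqr x : norm2 x ^+ 2 = dot x x.
Proof. by rewrite sqr_sqrtr// dotxx_ge0. Qed.

Lemma norm2_ge0 x : 0 <= norm2 x.
Proof. exact: sqrtr_ge0. Qed.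

Lemma dotxx_eq0 x : dot x x = 0 -> x = 0.
Proof.
rewrite dotxxE => /eqP; rewrite psumr_eq0 => [/allP h|i _]; last exact: sqr_ge0.
apply/rowP => i; rewrite mxE; apply/eqP; rewrite -sqrf_eq0.
exact: (h i (mem_index_enum i)).
Qed.

Lemma dot_sqr_le x y : dot x y ^+ 2 <= dot x x * dot y y.
Proof.
have [x0|x0] := eqVneq (dot x x) 0.
  by rewrite (dotxx_eq0 x0) !dot0l expr2 !mul0r.
have xp : 0 < dot x x by rewrite lt_def x0 dotxx_ge0.
(* The square of this vector is [dot x x] times the Cauchy-Schwarz defect. *)
have := dotxx_ge0 (dot x y *: x - dot x x *: y).
rewrite dotBl !dotBr !dotZl !dotZr (dotC y x) => h.
rewrite -(ler_pM2l xp); lra.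
Qed.

Lemma dot_le_norm2 x y : dot x y <= norm2 x * norm2 y.
Proof.
apply: le_trans (ler_norm _) _.
rewrite -(@ler_pXn2r _ 2)// ?nnegrE ?mulr_ge0 ?norm2_ge0//.
by rewrite real_normK ?num_real// exprMn !norm2_sqr dot_sqr_le.
Qed.

Lemma norm2_le x y : dot x x <= dot y y -> norm2 x <= norm2 y.
Proof. by move=> h; rewrite ler_wsqrtr. Qed.

Lemma dot_add_self_le x y : dot (x + y) (x + y) <= 2 * dot x x + 2 * dot y y.
Proof.
have := dotxx_ge0 (x - y); rewrite dotBl !dotBr dotDl !dotDr (dotC y x); lra.
Qed.

End euclid.

(** * Measurability for the coordinate sigma-algebra of row vectors *)

Section measurable_row_vector.
Context {d : measure_display} {T : measurableType d} {R : realType} {n : nat}.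
Implicit Types f g : T -> 'rV[R]_n.

Lemma measurable_coord (i : 'I_n) :
  measurable_fun [set: 'rV[R]_n] (fun x : 'rV[R]_n => x ord0 i).
Proof.
move=> _ Y mY; rewrite setTI; apply: sub_sigma_algebra => /=.
rewrite -bigcup_seq/=; exists i => /=; first by rewrite mem_index_enum.
by exists Y => //; rewrite setTI.
Qed.

Lemma measurable_rowP f : (forall i, measurable_fun setT (fun t => f t ord0 i)) ->
  measurable_fun setT f.
Proof.
move=> mf _ A; rewrite setTI; move: A; apply: smallest_sub.
  split => /=; first by rewrite preimage_set0.
  - by move=> A mA; rewrite setTD preimage_setC; exact: measurableC.
  - by move=> F mF; rewrite preimage_bigcup; exact: bigcupT_measurable.
move=> A; rewrite -bigcup_seq => -[i /= _ [B mB <-]].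
rewrite setTI -comp_preimage -[X in measurable X]setTI; exact: (mf i).
Qed.

Lemma measurable_coord_fun f (i : 'I_n) : measurable_fun setT f ->
  measurable_fun setT (fun t => f t ord0 i).
Proof. by move=> mf; apply: (measurableT_comp (measurable_coord i)). Qed.

Lemma measurable_rowD f g : measurable_fun setT f -> measurable_fun setT g ->
  measurable_fun setT (fun t => f t + g t).
Proof.
move=> mf mg; apply: measurable_rowP => i; under eq_fun do rewrite mxE.
by apply: measurable_funD; exact: measurable_coord_fun.
Qed.

Lemma measurable_rowZ (a : T -> R) f : measurable_fun setT a ->
  measurable_fun setT f -> measurable_fun setT (fun t => a t *: f t).
Proof.
move=> ma mf; apply: measurable_rowP => i; under eq_fun do rewrite mxE.
by apply: measurable_funM => //; exact: measurable_coord_fun.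
Qed.

Lemma measurable_rowB f g : measurable_fun setT f -> measurable_fun setT g ->
  measurable_fun setT (fun t => f t - g t).
Proof.
move=> mf mg; apply: measurable_rowP => i; under eq_fun do rewrite !mxE.
by apply: measurable_funB; exact: measurable_coord_fun.
Qed.

Lemma measurable_row_sum (I : Type) (r : seq I) (G : I -> T -> 'rV[R]_n) :
  (forall i, measurable_fun setT (G i)) ->
  measurable_fun setT (fun t => \sum_(i <- r) G i t).
Proof.
move=> mG; apply: measurable_rowP => i; under eq_fun do rewrite summxE.
by apply: measurable_sum => j; exact: measurable_coord_fun.
Qed.

Lemma measurable_dot f g : measurable_fun setT f -> measurable_fun setT g ->
  measurable_fun setT (fun t => dot (f t) (g t)).
Proof.
move=> mf mg; apply: measurable_sum => i.
by apply: measurable_funM; exact: measurable_coord_fun.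
Qed.

End measurable_row_vector.

Section continuous_measurable.
Context {R : realType} {n : nat}.

Lemma cvg_rowP (u : nat -> 'rV[R]_n) (l : 'rV[R]_n) :
  (forall i, (fun k => u k ord0 i) @ \oo --> l ord0 i) -> u @ \oo --> l.
Proof.
move=> h; apply/cvg_ballP => e e0.
have : \forall k \near \oo, forall i : 'I_n, `|l ord0 i - u k ord0 i| < e.
  apply: filter_forall => i; have /cvgrPdist_lt := h i; exact.
apply: filterS => k hk; split => // i j; rewrite (ord1 i); exact: hk.
Qed.

(** Instead of a countable base of open sets, rounding is used: [h] is the pointwise limit of its
    values at the points rounded down to the grid of mesh [1 / (k + 1)], and each such function is
    constant on countably many measurable boxes. *)
Lemma continuous_measurable_row (h : 'rV[R]_n -> R) :
  continuous h -> measurable_fun setT h.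
Proof.
move=> ch.
pose grid (k : nat) (x : 'rV[R]_n) : 'rV[int]_n :=
  \row_i Num.floor (k.+1%:R * x ord0 i).
pose back (k : nat) (v : 'rV[int]_n) : 'rV[R]_n :=
  \row_i ((v ord0 i)%:~R / k.+1%:R).
apply: (@measurable_fun_cvg _ _ _ _ (fun k x => h (back k (grid k x)))).
  move=> k _ Y mY; rewrite setTI.
  have -> : (fun x => h (back k (grid k x))) @^-1` Y =
    \bigcup_(v in [set v | Y (h (back k v))]) (grid k @^-1` [set v]).
    apply/seteqP; split => [x Yx|x [v Yv /= gv]]; first by exists (grid k x).
    by rewrite /= gv.
  rewrite bigcup_mkcond; apply: countable_bigcupT_measurable => [|v]; first exact: countableP.
  case: ifP => _ //.
  have -> : grid k @^-1` [set v] =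
      \bigcap_(i : 'I_n) [set x | Num.floor (k.+1%:R * x ord0 i) = v ord0 i].
    apply/seteqP; split => [x /= <- i _|x hx]; first by rewrite /grid mxE.
    by apply/rowP => i; rewrite mxE; exact: hx.
  apply: fin_bigcap_measurable => // i _.
  have mr : measurable_fun setT (fun x : 'rV[R]_n => k.+1%:R * x ord0 i).
    by apply: measurable_funM => //; exact: measurable_coord.
  have := mr measurableT _ (measurable_itv `[(v ord0 i)%:~R, (v ord0 i + 1)%:~R[).
  rewrite setTI; congr measurable; apply/seteqP.
  split => x /=; rewrite in_itv/= -floor_eq; first by move=> /eqP.
  by move=> ->.
move=> x _; apply: (@cvg_comp _ _ _ (fun k => back k (grid k x)) h _ (nbhs x)); last exact: ch.
apply: cvg_rowP => i; apply/cvgrPdist_lt => e e0.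
near=> k; rewrite /back /grid !mxE.
have k0 : 0 < (k.+1%:R : R) by [].
have /andP[fl fu] := floor_itv (k.+1%:R * x ord0 i).
set fx := Num.floor _ in fl fu *.
have -> : x ord0 i - fx%:~R / k.+1%:R = (k.+1%:R * x ord0 i - fx%:~R) / k.+1%:R.
  by rewrite mulrBl mulrAC divff ?mul1r// lt0r_neq0.
rewrite normrM (gtr0_norm (_ : 0 < k.+1%:R^-1)) ?invr_gt0//.
rewrite ltr_pdivrMr//.
apply: (@le_lt_trans _ _ 1).
  rewrite ger0_norm ?subr_ge0// lerBlDl; apply/ltW.
  by rewrite intrD in fu.
rewrite -ltr_pdivrMl// mulr1.
near: k; exists (Num.truncn e^-1).+1 => // k /= hk.
apply: lt_le_trans (truncnS_gt _) _.
by rewrite ler_nat ltnW.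
Unshelve. all: by end_near. Qed.

End continuous_measurable.

(** * Integrals of real functions for a finite measure *)

Section integrable_real.
Context {d : measure_display} {T : measurableType d} {R : realType}.
Variable mu : {finite_measure set T -> \bar R}.
Implicit Types h k : T -> R.

Definition intble h := mu.-integrable setT (EFin \o h).

Lemma intble_le h k : measurable_fun setT h -> (forall t, `|h t| <= k t) ->
  intble k -> intble h.
Proof.
move=> mh hk ik; apply: (le_integrable measurableT _ _ ik).
  exact/measurable_EFinP.
by move=> t _ /=; rewrite lee_fin (le_trans (hk t))// ler_norm.
Qed.

Lemma intble_measurable h : intble h -> measurable_fun setT h.
Proof. by move=> /integrableP[/measurable_EFinP]. Qed.

Lemma intbleD h k : intble h -> intble k -> intble (fun t => h t + k t).
Proof. by move=> ih ik; exact: (integrableD measurableT ih ik). Qed.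

Lemma intbleB h k : intble h -> intble k -> intble (fun t => h t - k t).
Proof. by move=> ih ik; exact: (integrableB measurableT ih ik). Qed.

Lemma intbleZ (c : R) h : intble h -> intble (fun t => c * h t).
Proof. by move=> ih; exact: (integrableZl measurableT c ih). Qed.

Lemma intble_cst (c : R) : intble (fun=> c).
Proof. exact: finite_measure_integrable_cst. Qed.

Lemma intble_sum (I : Type) (s : seq I) (h : I -> T -> R) :
  (forall i, intble (h i)) -> intble (fun t => \sum_(i <- s) h i t).
Proof.
move=> ih; elim: s => [|i s IHs].
  by under eq_fun do rewrite big_nil; exact: intble_cst.
by under eq_fun do rewrite big_cons; exact: intbleD.
Qed.

Lemma Rint_sum (I : Type) (s : seq I) (h : I -> T -> R) :
  (forall i, intble (h i)) ->
  \int[mu]_t (\sum_(i <- s) h i t) = \sum_(i <- s) \int[mu]_t h i t.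
Proof.
move=> ih; elim: s => [|i s IHs].
  under eq_Rintegral do rewrite big_nil.
  by rewrite Rintegral_cst// mul0r big_nil.
under eq_Rintegral do rewrite big_cons.
by rewrite RintegralD ?big_cons ?IHs//; [exact: ih|exact: intble_sum].
Qed.

Lemma le_Rint h k : intble h -> intble k -> (forall t, h t <= k t) ->
  \int[mu]_t h t <= \int[mu]_t k t.
Proof. by move=> ih ik hk; apply: le_Rintegral. Qed.

Lemma RintD h k : intble h -> intble k ->
  \int[mu]_t (h t + k t) = \int[mu]_t h t + \int[mu]_t k t.
Proof. by move=> ih ik; exact: RintegralD. Qed.

Lemma RintB h k : intble h -> intble k ->
  \int[mu]_t (h t - k t) = \int[mu]_t h t - \int[mu]_t k t.
Proof. by move=> ih ik; exact: RintegralB. Qed.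

Lemma RintZ (c : R) h : intble h -> \int[mu]_t (c * h t) = c * \int[mu]_t h t.
Proof. by move=> ih; exact: RintegralZl. Qed.

Lemma integral_Rint h : intble h -> (\int[mu]_t (h t)%:E = (\int[mu]_t h t)%R%:E)%E.
Proof. by move=> ih; rewrite /Rintegral fineK// integrable_fin_num. Qed.

Lemma intble_ge0_le h (c : R) : measurable_fun setT h -> (forall t, 0 <= h t) ->
  (\int[mu]_t (h t)%:E <= c%:E)%E -> intble h /\ \int[mu]_t h t <= c.
Proof.
move=> mh h0 hc; have ih : intble h.
  apply/integrableP; split; first exact/measurable_EFinP.
  under eq_integral do rewrite /= ger0_norm//.
  by rewrite (le_lt_trans hc)// ltry.
by split => //; rewrite integral_Rint// lee_fin in hc.
Qed.

Lemma intble_mul h k : measurable_fun setT h -> measurable_fun setT k ->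
  intble (fun t => h t ^+ 2) -> intble (fun t => k t ^+ 2) ->
  intble (fun t => h t * k t).
Proof.
move=> mh mk ih ik; apply: (@intble_le _ (fun t => h t ^+ 2 + k t ^+ 2)).
- exact: measurable_funM.
- move=> t; rewrite normrM -(real_normK (num_real (h t))) -(real_normK (num_real (k t))).
  have := sqr_ge0 (`|h t| - `|k t|); have := sqr_ge0 `|h t|; have := sqr_ge0 `|k t|.
  lra.
- exact: intbleD.
Qed.

Lemma intble_of_sqr h : measurable_fun setT h ->
  intble (fun t => h t ^+ 2) -> intble h.
Proof.
move=> mh ih; apply: (@intble_le _ (fun t => 1 + h t ^+ 2)) => //.
- move=> t; rewrite -(real_normK (num_real (h t))).
  have := sqr_ge0 (`|h t| - 1); have := sqr_ge0 `|h t|; lra.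
- by apply: intbleD => //; exact: intble_cst.
Qed.

End integrable_real.

(** * Independence, from events to sigma-algebras and to iterated integrals *)

Section indep_sigma.
Context {R : realType} {d : measure_display} {O : measurableType d}.
Variable Pr : probability O R.
Context {I : finType}.
Variable S : I -> set_system O.
Hypothesis S_measurable : forall i, S i `<=` measurable.
Hypothesis S_setT : forall i, S i setT.
Hypothesis S_setI : forall i, setI_closed (S i).
Hypothesis S_indep : mutually_independent Pr S.

(** A pi-lambda argument: the finite intersections over [K] of sets of the families form a pi-system
    generating the sigma-algebra, and for fixed [B] the sets that satisfy the product formula form a
    Dynkin system. *)
Lemma indep_generated (K : {set I}) (i : I) (A B : set O) : i \notin K ->
  <<s \bigcup_(j in [set` K]) S j >> A -> S i B ->
  Pr (A `&` B) = (Pr A * Pr B)%E.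
Proof.
move=> iK + SB.
pose G := [set A | exists2 F : I -> set O, (forall j, j \in K -> S j (F j)) &
  A = \bigcap_(j in [set` K]) F j].
have GI : setI_closed G.
  move=> _ _ [F SF ->] [F' SF' ->]; exists (fun j => F j `&` F' j).
    by move=> j jK; apply: S_setI; [exact: SF|exact: SF'].
  by rewrite -bigcapI.
have GA X : G X -> measurable X /\ Pr (X `&` B) = (Pr X * Pr B)%E.
  move=> [F SF ->]; split.
    apply: fin_bigcap_measurable => // j jK; apply: (@S_measurable j); exact: SF.
  (* The family is extended by [B] at the new index, so that the independence hypothesis applies to
     [i |: K]. *)
  pose F' j := if j == i then B else F j.
  have F'K j : j \in K -> F' j = F j.
    by rewrite /F'; case: eqP => // ->; rewrite (negbTE iK).
  have -> : (\bigcap_(j in [set` K]) F j) `&` B = \bigcap_(j in [set` i |: K]) F' j.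
    apply/seteqP; split => [w [hw Bw] j /=|w hw].
      rewrite !inE => /orP[/eqP ->|jK]; first by rewrite /F' eqxx.
      by rewrite F'K//; exact: hw.
    split; last by have := hw i; rewrite /F' eqxx; apply; rewrite /= !inE eqxx.
    by move=> j jK; rewrite -F'K//; apply: hw; rewrite /= !inE; apply/orP; right.
  rewrite S_indep; last first.
    move=> j; rewrite !inE => /orP[/eqP ->|jK]; first by rewrite /F' eqxx.
    by rewrite F'K//; exact: SF.
  rewrite big_setU1//= {1}/F' eqxx muleC S_indep//.
  by congr (_ * _)%E; apply: eq_bigr => j jK; rewrite F'K.
suff : <<s \bigcup_(j in [set` K]) S j >> `<=`
    [set X | measurable X /\ Pr (X `&` B) = (Pr X * Pr B)%E].
  by move=> h /h[].
apply: (@subset_trans _ <<s G >>).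
  apply: smallest_sub; first exact: smallest_sigma_algebra.
  move=> X [j /= jK SX]; apply: sub_sigma_algebra.
  exists (fun j' => if j' == j then X else setT).
    by move=> j' _; case: eqP => [->|].
  apply/seteqP; split => [w Xw j' _|w hw]; first by case: eqP.
  by have := hw _ jK; rewrite eqxx.
rewrite -setI_closed_g_dynkin_g_sigma_algebra//.
have mB : measurable B := S_measurable SB.
apply: smallest_sub => //; split => /=.
- by rewrite setTI probability_setT mul1e.
- move=> X [mX PX]; split; first exact: measurableC.
  rewrite setIC -setDE measureD//; last by rewrite (le_lt_trans (probability_le1 _ _)) ?ltry.
  rewrite setIC in PX; rewrite [X in (_ - X)%E](PX) probability_setC// muleBl ?mul1e ?fin_num_measure//.
- move=> F tF hF; split; first by apply: bigcupT_measurable => k; have [] := hF k.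
  rewrite setI_bigcupl measure_bigcup//; last 2 first.
  + by move=> k _; apply: measurableI => //; have [] := hF k.
  + exact: trivIset_setIr.
  rewrite measure_bigcup//; last by move=> k _; have [] := hF k.
  rewrite muleC -(fineK (fin_num_measure Pr _ mB)) -nneseriesZl//.
  rewrite fineK ?fin_num_measure//.
  by apply: eq_eseriesr => k _; rewrite muleC; have [] := hF k.
Qed.

End indep_sigma.

Section indep_fubini.
Context {R : realType} {d d1 d2 : measure_display} {O : measurableType d}
  {T1 : measurableType d1} {T2 : measurableType d2}.
Variables (Pr : probability O R) (Q : probability T2 R).
Variables (Y : O -> T1) (Z : O -> T2).

(** Independence of [Y] and [Z] and the law of [Z] in one condition: the joint law is the product of
    the law of [Y] with [Q]. Taking [A = setT] recovers that [Z] has law [Q]. *)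
Definition indep_of_law :=
  forall A B, measurable A -> measurable B ->
    Pr (Y @^-1` A `&` Z @^-1` B) = (Pr (Y @^-1` A) * Q B)%E.

Hypothesis mY : measurable_fun setT Y.
Hypothesis mZ : measurable_fun setT Z.
Hypothesis YZ : indep_of_law.

(** The joint law agrees with the product measure on rectangles, hence everywhere, and Tonelli's
    theorem applies to the latter. *)
Lemma indep_tonelli (f : T1 * T2 -> \bar R) : measurable_fun setT f ->
  (forall x, 0 <= f x)%E ->
  (\int[Pr]_w f (Y w, Z w) = \int[Pr]_w \int[Q]_z f (Y w, z))%E.
Proof.
move=> mf f0.
pose mYm : {mfun O >-> T1} := HB.pack Y (isMeasurableFun.Build _ _ _ _ Y mY).
have mYZ : measurable_fun setT (fun w => (Y w, Z w)) by exact: measurable_fun_pair.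
pose YZm : {mfun O >-> (T1 * T2)%type} :=
  HB.pack (fun w => (Y w, Z w)) (isMeasurableFun.Build _ _ _ _ _ mYZ).
transitivity (\int[distribution Pr YZm]_x f x)%E.
  by rewrite ge0_integral_distribution.
transitivity (\int[(distribution Pr mYm \x Q)%E]_x f x)%E.
  apply: eq_measure_integral => X mX _; apply/esym.
  apply: product_measure_unique => //=.
rewrite fubini_tonelli1//=.
by rewrite ge0_integral_distribution// => [|y]; [exact: measurable_fun_fubini_tonelli_F|exact: integral_ge0].
Qed.

Lemma indep_Rint_le (h : T1 * T2 -> R) (k : O -> R) : measurable_fun setT h ->
  (forall x, 0 <= h x) -> intble Pr k ->
  (forall w, (\int[Q]_z (h (Y w, z))%:E <= (k w)%:E)%E) ->
  intble Pr (fun w => h (Y w, Z w)) /\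
  \int[Pr]_w h (Y w, Z w) <= \int[Pr]_w k w.
Proof.
move=> mh h0 ik hk; apply: intble_ge0_le => //.
- by apply: (measurableT_comp mh); exact: measurable_fun_pair.
- rewrite (@indep_tonelli (EFin \o h))//=; last exact/measurable_EFinP.
  rewrite -integral_Rint//; apply: ge0_le_integral => //.
  + by move=> w _; apply: integral_ge0 => z _; rewrite lee_fin.
  + apply: (measurableT_comp (f := fubini_F Q (EFin \o h)) _ mY).
    by apply: measurable_fun_fubini_tonelli_F => //; exact/measurable_EFinP.
  + by apply/measurable_EFinP; exact: intble_measurable ik.
Qed.

(** Tonelli's theorem is applied to the positive and the negative part: given [Y], their inner
    integrals are finite and, the conditional mean being zero, equal. Integrability of the composite
    allows the two outer integrals to be subtracted. *)
Lemma indep_Rint_eq0 (h : T1 * T2 -> R) : measurable_fun setT h ->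
  intble Pr (fun w => h (Y w, Z w)) ->
  (forall w, intble Q (fun z => h (Y w, z)) /\ \int[Q]_z h (Y w, z) = 0) ->
  \int[Pr]_w h (Y w, Z w) = 0.
Proof.
move=> mh ih hQ; rewrite /Rintegral integralE.
pose hE := EFin \o h.
have mhE : measurable_fun setT hE by exact/measurable_EFinP.
have -> : (\int[Pr]_w ((fun w => (h (Y w, Z w))%:E)^\+) w =
    \int[Pr]_w \int[Q]_z (hE^\+ (Y w, z)))%E.
  by rewrite -(@indep_tonelli (hE^\+)%E)//; [apply: eq_integral => w _; rewrite !funeposE|exact: measurable_funepos].
have -> : (\int[Pr]_w ((fun w => (h (Y w, Z w))%:E)^\-) w =
    \int[Pr]_w \int[Q]_z (hE^\- (Y w, z)))%E.
  by rewrite -(@indep_tonelli (hE^\-)%E)//; [apply: eq_integral => w _; rewrite !funenegE|exact: measurable_funeneg].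
have -> : (\int[Pr]_w \int[Q]_z hE^\+ (Y w, z) = \int[Pr]_w \int[Q]_z hE^\- (Y w, z))%E.
  apply: eq_integral => w _; have [iw] := hQ w.
  move/(congr1 (@EFin R)); rewrite -integral_Rint// integralE => ab.
  have aE : (\int[Q]_z hE^\+ (Y w, z) = \int[Q]_z (EFin \o (fun z => h (Y w, z)))^\+ z)%E.
    by apply: eq_integral => z _; rewrite !funeposE.
  have bE : (\int[Q]_z hE^\- (Y w, z) = \int[Q]_z (EFin \o (fun z => h (Y w, z)))^\- z)%E.
    by apply: eq_integral => z _; rewrite !funenegE.
  have bf : (\int[Q]_z (EFin \o (fun z => h (Y w, z)))^\- z)%E \is a fin_num.
    rewrite ge0_fin_numE ?integral_ge0//.
    exact: (integral_funeneg_lt_pinfty measurableT iw).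
  have af : (\int[Q]_z (EFin \o (fun z => h (Y w, z)))^\+ z)%E \is a fin_num.
    rewrite ge0_fin_numE ?integral_ge0//.
    exact: (integral_funepos_lt_pinfty measurableT iw).
  rewrite aE bE; apply/eqP.
  by rewrite -[X in _ == X]add0e -sube_eq ?fin_num_adde_defl//; apply/eqP.
suff : (\int[Pr]_w \int[Q]_z hE^\- (Y w, z) \is a fin_num)%E.
  by move=> ?; rewrite subee.
rewrite -indep_tonelli//; last exact: measurable_funeneg.
rewrite ge0_fin_numE ?integral_ge0//.
rewrite (eq_integral ((EFin \o (fun w => h (Y w, Z w)))^\-)%E) => [|w _].
  exact: (integral_funeneg_lt_pinfty measurableT ih).
by rewrite !funenegE.
Qed.

End indep_fubini.

(** * Reflections, and moments of the uniform distribution on the sphere *)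

Section reflection.
Context {R : realType} {n : nat}.
Implicit Types v x s t : 'rV[R]_n.

(** The Householder reflection. Rotation invariance is used through these maps: sign changes and
    transpositions of coordinates are of this form, and so is a map exchanging two given vectors of
    equal length. *)
Definition reflect_along v x : 'rV[R]_n := x - (2 * dot v x / dot v v) *: v.

Lemma reflect_along_mx v : dot v v != 0 ->
  exists2 Q : 'M[R]_n, Q *m Q^T = 1%:M & forall x, reflect_along v x = x *m Q.
Proof.
move=> v0; set k := 2 / dot v v.
have vvT : v *m v^T = (dot v v)%:M.
  apply/matrixP => i j; rewrite !ord1 !mxE eqxx mulr1n; apply: eq_bigr => l _.
  by rewrite mxE.
exists (1%:M - k *: (v^T *m v)) => [|x].
  have -> : (1%:M - k *: (v^T *m v))^T = 1%:M - k *: (v^T *m v).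
    apply/matrixP => i j; rewrite !mxE [j == i]eq_sym; congr (_ - _ * _).
    by apply: eq_bigr => l _; rewrite !mxE mulrC.
  rewrite mulmxBl !mulmxBr !mul1mx !mulmx1 -!scalemxAl -!scalemxAr.
  rewrite mulmxA -(mulmxA v^T v) vvT mul_mx_scalar -scalemxAl !scalerA.
  rewrite (_ : k * (k * dot v v) = k + k); last by rewrite /k; field.
  by rewrite scalerDl; apply/matrixP => i j; rewrite !mxE; ring.
rewrite mulmxBr mulmx1 /reflect_along -scalemxAr mulmxA.
have -> : x *m v^T = (dot v x)%:M.
  apply/matrixP => i j; rewrite !ord1 !mxE eqxx mulr1n; apply: eq_bigr => l _.
  by rewrite mxE mulrC.
by rewrite mul_scalar_mx scalerA /k mulrAC.
Qed.

(** The reflection is self-adjoint and sends [t] to [s]: equal lengths give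
    [dot (t - s) (t - s) = 2 * dot t (t - s)], so exactly one copy of [t - s] is removed from
    [t]. *)
Lemma dot_reflect_along s t x : dot s s = dot t t -> s != t ->
  dot t (reflect_along (t - s) x) = dot s x.
Proof.
move=> st nst.
have vv : dot (t - s) (t - s) = 2 * dot t (t - s).
  rewrite dotBl !dotBr (dotC s t) st; ring.
have v0 : dot t (t - s) != 0.
  apply: contra_neq nst => h; apply/esym/eqP; rewrite -subr_eq0; apply/eqP.
  by apply: dotxx_eq0; rewrite vv h mulr0.
rewrite /reflect_along vv; move: v0; set a := dot t (t - s) => a0.
rewrite dotBr dotZr -/a dotBl.
field.
by [].
Qed.

Definition flip_coord (i : 'I_n) x : 'rV[R]_n :=
  \row_j (if j == i then - x ord0 j else x ord0 j).

Definition swap_coord (i j : 'I_n) x : 'rV[R]_n := \row_k x ord0 (tperm i j k).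

Lemma dot_deltal (i : 'I_n) x : dot (delta_mx ord0 i) x = x ord0 i.
Proof. by rewrite dotC dot_delta. Qed.

Lemma flip_coordE i x : flip_coord i x = reflect_along (delta_mx ord0 i) x.
Proof.
apply/rowP => j; rewrite !mxE !dot_deltal mxE !eqxx/= invr1 mulr1.
case: eqVneq => [->|_] /=; first by rewrite mulr1; ring.
by rewrite mulr0 subr0.
Qed.

Lemma swap_coordE i j x : i != j ->
  swap_coord i j x = reflect_along (delta_mx ord0 i - delta_mx ord0 j) x.
Proof.
move=> ij; apply/rowP => k; rewrite !mxE !dotBl !dot_deltal !mxE !eqxx/=.
rewrite (negbTE ij) [j == i]eq_sym (negbTE ij) /= subr0 sub0r opprK.
rewrite (_ : 2 * (x ord0 i - x ord0 j) / (1 + 1) = x ord0 i - x ord0 j); last by field.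
case: tpermP => [->|->|/eqP ki /eqP kj].
- by rewrite eqxx (negbTE ij) subr0 mulr1; ring.
- by rewrite eqxx eq_sym (negbTE ij) sub0r mulrN1; ring.
- by rewrite (negbTE ki) (negbTE kj) subr0 mulr0 subr0.
Qed.

End reflection.

Section uniform_sphere.
Context {R : realType} {n : nat}.
Variable mu : probability 'rV[R]_n R.
Hypothesis mu_unif : uniform_on_sphere mu.
Implicit Types h k Psi : 'rV[R]_n -> R.

Lemma measurable_sphere2 : measurable (@sphere2 R n).
Proof.
have mdot : measurable_fun setT (fun x : 'rV[R]_n => dot x x).
  by apply: measurable_dot => //; exact: measurable_id.
have := mdot measurableT _ (measurable_set1 1); rewrite setTI.
congr measurable; apply/seteqP; split => x /=; rewrite /sphere2/= /norm2.
  by move=> ->; rewrite sqrtr1.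
by move=> h; rewrite -norm2_sqr /norm2 h expr1n.
Qed.

Lemma sphere_ae : {ae mu, forall x, sphere2 x}.
Proof.
exists (~` sphere2); split => //; first exact: measurableC measurable_sphere2.
rewrite probability_setC; last exact: measurable_sphere2.
by have [-> _] := mu_unif; rewrite subee.
Qed.

Lemma sphere_dot (x : 'rV[R]_n) : sphere2 x -> dot x x = 1.
Proof. by rewrite /sphere2/= => h; rewrite -norm2_sqr h expr1n. Qed.

Lemma ae_sphere_eq h k : measurable_fun setT h -> measurable_fun setT k ->
  (forall x, sphere2 x -> h x = k x) -> \int[mu]_x h x = \int[mu]_x k x.
Proof.
move=> mh mk hk; rewrite /Rintegral; congr fine; apply: ae_eq_integral => //.
- exact/measurable_EFinP.
- exact/measurable_EFinP.
- by apply: filterS sphere_ae => x sx _ /=; rewrite hk.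
Qed.

Lemma intble_sphere h (c : R) : measurable_fun setT h ->
  (forall x, sphere2 x -> `|h x| <= c) -> intble mu h.
Proof.
move=> mh hc; apply/integrableP; split; first exact/measurable_EFinP.
apply: (@le_lt_trans _ _ (\int[mu]_x (cst `|c|%:E x))%E).
  apply: ae_ge0_le_integral => //=.
  - by apply/measurable_EFinP; apply: measurableT_comp.
  - apply: filterS sphere_ae => x sx _ /=.
    by rewrite lee_fin (le_trans (hc x sx))// ler_norm.
by rewrite integral_cst//= probability_setT mule1 ltry.
Qed.

Lemma Rint_reflect_along v h : dot v v != 0 -> intble mu h ->
  \int[mu]_x h (reflect_along v x) = \int[mu]_x h x.
Proof.
move=> v0 ih; have [Q QQ rE] := reflect_along_mx v0.
have mh := intble_measurable ih.
have mQ : measurable_fun setT (fun x : 'rV[R]_n => x *m Q).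
  rewrite (_ : (fun x => _) = reflect_along v); last by apply/funext => x; rewrite rE.
  apply: measurable_rowB; first exact: measurable_id.
  apply: measurable_rowZ; last exact: measurable_cst.
  apply: measurable_funM; last exact: measurable_cst.
  apply: measurable_funM; first exact: measurable_cst.
  by apply: measurable_dot; [exact: measurable_cst|exact: measurable_id].
have [_ /(_ Q QQ) inv] := mu_unif.
pose mQm : {mfun 'rV[R]_n >-> 'rV[R]_n} :=
  HB.pack (fun x => x *m Q) (isMeasurableFun.Build _ _ _ _ _ mQ).
have muE (k : 'rV[R]_n -> \bar R) : (\int[distribution mu mQm]_x k x = \int[mu]_x k x)%E.
  by apply: eq_measure_integral => A mA _; exact: inv.
have mEh : measurable_fun setT (EFin \o h) by exact/measurable_EFinP.
have i2 : mu.-integrable setT ((EFin \o h) \o mQm).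
  apply/integrableP; split; first exact: (measurableT_comp mEh mQ).
  have /integrableP[mh' fh] := ih.
  rewrite -(muE (fun x => `|(EFin \o h) x|)%E) ge0_integral_distribution in fh => //.
  exact: measurableT_comp.
rewrite /Rintegral; congr fine; rewrite -[RHS]muE integral_distribution//.
by apply: eq_integral => x _; rewrite /= rE.
Qed.

Definition coord_symmetric Psi :=
  (forall i x, Psi (flip_coord i x) = Psi x) /\
  (forall i j x, Psi (swap_coord i j x) = Psi x).

Lemma coord_le1 (x : 'rV[R]_n) i : sphere2 x -> `|x ord0 i| <= 1.
Proof.
move=> /sphere_dot; rewrite dotxxE (bigD1 i)//= => h.
rewrite -(@ler_pXn2r _ 2)// ?nnegrE// real_normK ?num_real// expr1n -h lerDl.
by apply: sumr_ge0 => j _; rewrite sqr_ge0.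
Qed.

Lemma delta_neq0 (i : 'I_n) : dot (delta_mx ord0 i) (delta_mx ord0 i) != 0 :> R.
Proof. by rewrite dot_delta mxE !eqxx oner_eq0. Qed.

Lemma deltaB_neq0 (i j : 'I_n) : i != j ->
  dot (delta_mx ord0 i - delta_mx ord0 j) (delta_mx ord0 i - delta_mx ord0 j) != 0 :> R.
Proof.
move=> ij; rewrite dotBl !dotBr !dot_delta !mxE !eqxx/=.
by rewrite (negbTE ij) [j == i]eq_sym (negbTE ij)/= subr0 sub0r opprK -(natrD _ 1 1) pnatr_eq0.
Qed.

Section symmetric_weight.
Variables (Psi : 'rV[R]_n -> R) (c : R).
Hypothesis mPsi : measurable_fun setT Psi.
Hypothesis Psi_bound : forall x, sphere2 x -> `|Psi x| <= c.
Hypothesis symPsi : coord_symmetric Psi.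

Let intble_coord2 i j : intble mu (fun x => x ord0 i * x ord0 j * Psi x).
Proof.
apply: (@intble_sphere _ c).
  by do !apply: measurable_funM => //; exact: measurable_coord.
move=> x sx; rewrite !normrM -[leRHS]mul1r ler_pM ?mulr_ge0//.
  by rewrite mulr_ile1 ?coord_le1.
exact: Psi_bound.
Qed.

Let offdiag0 i j : i != j -> \int[mu]_x (x ord0 i * x ord0 j * Psi x) = 0.
Proof.
move=> ij; have := Rint_reflect_along (delta_neq0 i) (intble_coord2 i j).
under eq_Rintegral => x _.
  rewrite -flip_coordE (proj1 symPsi) !mxE eqxx [j == i]eq_sym (negbTE ij).
  rewrite !mulNr -mulN1r.
  over.
rewrite RintZ; last exact: intble_coord2.
by move=> /esym; lra.
Qed.

Let diag_eq i j :
  \int[mu]_x (x ord0 i * x ord0 i * Psi x) = \int[mu]_x (x ord0 j * x ord0 j * Psi x).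
Proof.
have [->//|ij] := eqVneq i j.
rewrite -(Rint_reflect_along (deltaB_neq0 ij) (intble_coord2 j j)).
by apply: eq_Rintegral => x _; rewrite -swap_coordE// (proj2 symPsi) !mxE tpermR.
Qed.

Let diagE i : \int[mu]_x (x ord0 i * x ord0 i * Psi x) = (\int[mu]_x Psi x) / n%:R.
Proof.
have n0 : (0 < n)%N by case: n i => [[]|].
apply: (@mulIf _ n%:R); first by rewrite pnatr_eq0 -lt0n.
rewrite divfK ?pnatr_eq0 -?lt0n// mulr_natr.
transitivity (\sum_(j < n) \int[mu]_x (x ord0 j * x ord0 j * Psi x)).
  under eq_bigr do rewrite -(diag_eq i).
  by rewrite sumr_const card_ord.
rewrite -Rint_sum; last by move=> j; exact: intble_coord2.
apply: ae_sphere_eq => // [|x /sphere_dot x1].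
  by apply: intble_measurable; apply: intble_sum => j; exact: intble_coord2.
by rewrite -mulr_suml -/(dot x x) x1 mul1r.
Qed.

(** The matrix of moments [E x_i x_j Psi] is scalar: a sign change kills the off-diagonal entries, a
    transposition equates the diagonal ones, and the trace is [E Psi] since the squared coordinates
    sum to 1 on the sphere. *)
Lemma Rint_dot2_sym (s t : 'rV[R]_n) :
  \int[mu]_x (dot s x * dot t x * Psi x) = dot s t / n%:R * \int[mu]_x Psi x.
Proof.
transitivity (\int[mu]_x (\sum_i \sum_j (s ord0 i * t ord0 j) *
    (x ord0 i * x ord0 j * Psi x))).
  apply: eq_Rintegral => x _; rewrite big_distrlr/= mulr_suml.
  apply: eq_bigr => i _; rewrite mulr_suml; apply: eq_bigr => j _; ring.
have ii i j : intble mu (fun x => s ord0 i * t ord0 j * (x ord0 i * x ord0 j * Psi x)).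
  exact: intbleZ.
rewrite Rint_sum; last by move=> i; exact: intble_sum.
rewrite /dot !mulr_suml; apply: eq_bigr => i _.
rewrite Rint_sum// (bigD1 i)//= [X in _ + X]big1 ?addr0.
  by rewrite RintZ// diagE; ring.
by move=> j ji; rewrite RintZ// offdiag0 ?mulr0// eq_sym.
Qed.

End symmetric_weight.

Section sphere_moments.
Hypothesis n_gt1 : (1 < n)%N.

Let i0 : 'I_n := Ordinal (ltnW n_gt1).
Let i1 : 'I_n := Ordinal n_gt1.

Let moment (k : nat) : R := \int[mu]_x (x ord0 i0 ^+ k.*2).

Let intble_monom (i j : 'I_n) (a b : nat) :
  intble mu (fun x => x ord0 i ^+ a * x ord0 j ^+ b).
Proof.
apply: (@intble_sphere _ 1).
  by apply: measurable_funM; apply: measurable_funX; exact: measurable_coord.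
move=> x sx; rewrite normrM !normrX mulr_ile1 ?exprn_ge0//.
  by rewrite exprn_ile1 ?coord_le1.
by rewrite exprn_ile1 ?coord_le1.
Qed.

Let intble_dotX s (k : nat) : intble mu (fun x => dot s x ^+ k).
Proof.
apply: (@intble_sphere _ (norm2 s ^+ k)).
  apply: measurable_funX; apply: measurable_dot; [exact: measurable_cst|exact: measurable_id].
move=> x sx; rewrite normrX lerXn2r ?nnegrE ?norm2_ge0//.
have x1 : norm2 x = 1 by [].
rewrite ler_norml; apply/andP; split.
  rewrite lerNl -dotNl (le_trans (dot_le_norm2 _ _))// x1 mulr1.
  by apply: norm2_le; rewrite dotNl dotNr opprK.
by rewrite (le_trans (dot_le_norm2 _ _))// x1 mulr1.
Qed.

Let Rint_dotX s t (k : nat) : dot s s = dot t t ->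
  \int[mu]_x (dot s x ^+ k) = \int[mu]_x (dot t x ^+ k).
Proof.
move=> st; have [->//|nst] := eqVneq s t.
rewrite -(@Rint_reflect_along (t - s) (fun x => dot t x ^+ k)).
- by apply: eq_Rintegral => x _; rewrite dot_reflect_along.
- apply: contra_neq nst => h; apply/esym/eqP; rewrite -subr_eq0.
  by apply/eqP/dotxx_eq0.
- exact: intble_dotX.
Qed.

Let moment_coord i (k : nat) : \int[mu]_x (x ord0 i ^+ k.*2) = moment k.
Proof.
transitivity (\int[mu]_x (dot (delta_mx ord0 i) x ^+ k.*2)).
  by apply: eq_Rintegral => x _; rewrite dot_deltal.
transitivity (\int[mu]_x (dot (delta_mx ord0 i0) x ^+ k.*2)).
  by apply: Rint_dotX; rewrite !dot_deltal !mxE !eqxx.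
by apply: eq_Rintegral => x _; rewrite dot_deltal.
Qed.

(** The vector on which the moment is taken has squared length [1 + t ^+ 2], so it may be replaced
    by a multiple of the first basis vector; the left-hand side is the binomial expansion. *)
Let binom_identity (j : 'I_n) K (t : R) : j != i0 ->
  \sum_(l < K.*2.+1) 'C(K.*2, l)%:R *
     \int[mu]_x (x ord0 i0 ^+ (K.*2 - l) * x ord0 j ^+ l) * t ^+ l =
  (1 + t ^+ 2) ^+ K * moment K.
Proof.
move=> ji.
have -> : (1 + t ^+ 2) ^+ K * moment K =
    \int[mu]_x (dot (delta_mx ord0 i0 + t *: delta_mx ord0 j) x ^+ K.*2).
  rewrite (Rint_dotX (t := Num.sqrt (1 + t ^+ 2) *: delta_mx ord0 i0)).
    under eq_Rintegral do rewrite dotZl dot_deltal exprMn.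
    rewrite RintZ; last by under eq_fun do rewrite -dot_deltal; exact: intble_dotX.
    rewrite (_ : Num.sqrt (1 + t ^+ 2) ^+ K.*2 = (1 + t ^+ 2) ^+ K)//.
    by rewrite -mul2n exprM sqr_sqrtr// addr_ge0 ?sqr_ge0.
  rewrite dotDl !dotDr !dotZl !dotZr !dot_deltal !mxE !eqxx/= [i0 == j]eq_sym (negbTE ji).
  by rewrite !mulr1 !mulr0 addr0 add0r -!expr2 sqr_sqrtr// addr_ge0// sqr_ge0.
transitivity (\int[mu]_x (\sum_(l < K.*2.+1) ('C(K.*2, l)%:R * t ^+ l *
    (x ord0 i0 ^+ (K.*2 - l) * x ord0 j ^+ l)))).
  rewrite Rint_sum; last by move=> l; apply: intbleZ; exact: intble_monom.
  by apply: eq_bigr => l _; rewrite RintZ; [ring|exact: intble_monom].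
apply: eq_Rintegral => x _; rewrite dotDl dotZl !dot_deltal exprDn.
by apply: eq_bigr => l _; rewrite -mulr_natl exprMn; ring.
Qed.

(* By rotation invariance, [E (x_0 + t x_j) ^+ 2K = (1 + t ^+ 2) ^+ K * E x_0 ^+ 2K]; compare the coefficients of [t ^+ 2]. *)
Let moment_mixed (j : 'I_n) (k : nat) : j != i0 ->
  (k.*2.+1)%:R * \int[mu]_x (x ord0 i0 ^+ k.*2 * x ord0 j ^+ 2) = moment k.+1.
Proof.
move=> ji; pose K := k.+1.
pose a l := 'C(K.*2, l)%:R * \int[mu]_x (x ord0 i0 ^+ (K.*2 - l) * x ord0 j ^+ l).
pose p : {poly R} := \poly_(l < K.*2.+1) a l.
pose q : {poly R} := (1 + 'X^2) ^+ K * (moment K)%:P.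
have pq : p = q.
  apply/eqP; rewrite -subr_eq0; apply/eqP.
  (* The identity holds for every real [t], in particular at as many integers as the size of the
     difference, which exceeds its degree. *)
  pose rs := [seq i%:R : R | i <- iota 0 (size (p - q))].
  apply: (@roots_geq_poly_eq0 _ _ rs).
  - apply/allP => _ /mapP[i _ ->]; apply/rootP.
    rewrite hornerD hornerN horner_poly binom_identity// /q hornerM hornerC.
    by rewrite horner_exp hornerD horner_exp hornerX hornerC subrr.
  - rewrite map_inj_uniq ?iota_uniq//.
    by move=> x y /eqP; rewrite eqr_nat => /eqP.
  - by rewrite size_map size_iota.
have := congr1 (fun r : {poly R} => r`_2) pq.
rewrite coef_poly (_ : (2 < K.*2.+1)%N = true) // /q coefMC.
have -> : ((1 + 'X^2 : {poly R}) ^+ K)`_2 = K%:R.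
  rewrite addrC exprD1n coef_sum (bigD1 (Ordinal (_ : 1 < K.+1)%N))//= big1 => [|l l1].
    by rewrite addr0 coefMn expr1 coefXn eqxx bin1.
  rewrite coefMn -exprM coefXn (_ : (2 == (2 * l))%N = false) ?mul0rn//.
  by apply/negbTE; apply: contraNN l1 => /eqP h; apply/eqP/val_inj => /=; lia.
rewrite /a (_ : (K.*2 - 2 = k.*2)%N); last by rewrite /K; lia.
(* [2K - 1 = 2k + 1], and the factor [K] cancels against the coefficient on the other side. *)
have -> : ('C(K.*2, 2) = K * k.*2.+1)%N.
  by rewrite bin2 /K doubleS/=; nia.
rewrite natrM -mulrA => /(mulfI _); apply.
by rewrite pnatr_eq0.
Qed.

(** Inserting the sum of the squared coordinates splits the moment into one term equal to the next
    moment and [n - 1] mixed terms, each [1 / (2k + 1)] of it. *)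
Let moment_rec (k : nat) : (n + k.*2)%:R * moment k.+1 = (k.*2.+1)%:R * moment k.
Proof.
have mom_split : moment k = \sum_j \int[mu]_x (x ord0 i0 ^+ k.*2 * x ord0 j ^+ 2).
  rewrite -Rint_sum; last by move=> j; exact: intble_monom.
  apply: ae_sphere_eq => [||x /sphere_dot].
  - by apply: measurable_funX; exact: measurable_coord.
  - by apply: intble_measurable; apply: intble_sum => j; exact: intble_monom.
  - by rewrite dotxxE -mulr_sumr => ->; rewrite mulr1.
rewrite mom_split (bigD1 i0)//= mulrDr mulr_sumr.
rewrite (eq_bigr (fun=> moment k.+1)); last by move=> j ji; rewrite moment_mixed.
under eq_Rintegral do rewrite -exprD addn2 -doubleS.
rewrite -/(moment k.+1) sumr_const cardC1 card_ord -[_ *+ n.-1]mulr_natl -mulrDl -natrD.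
by congr (_%:R * _); have := n_gt1; lia.
Qed.

(** The recursion multiplies the moment by [(2k + 1) / (n + 2k) <= 2 (k + 1) / n], and the [k]
    factors collected up to order [k] are all at most [2k / n]. *)
Lemma sphere_even_moment_le i (k : nat) :
  \int[mu]_x (x ord0 i ^+ k.*2) <= ((2 * k)%:R / n%:R) ^+ k.
Proof.
have nR : 0 < n%:R :> R by rewrite ltr0n (ltnW n_gt1).
rewrite moment_coord; elim: k => [|k IHk].
  rewrite /moment; under eq_Rintegral do rewrite double0 expr0.
  by rewrite Rintegral_cst//= expr0 mul1r probability_setT.
have m0 : 0 <= moment k.+1.
  by apply: Rintegral_ge0 => x _; rewrite -mul2n exprM exprn_ge0 ?sqr_ge0.
have m1 : 0 <= moment k.
  by apply: Rintegral_ge0 => x _; rewrite -mul2n exprM exprn_ge0 ?sqr_ge0.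
have h : n%:R * moment k.+1 <= (2 * k.+1)%:R * moment k.
  apply: (@le_trans _ _ ((n + k.*2)%:R * moment k.+1)).
    by rewrite ler_wpM2r// ler_nat leq_addr.
  by rewrite moment_rec ler_wpM2r// ler_nat; lia.
rewrite -ler_pdivlMl// in h; apply: le_trans h _.
rewrite mulrA [_^-1 * _]mulrC exprS ler_wpM2l ?divr_ge0//.
apply: le_trans IHk _; rewrite lerXn2r ?nnegrE ?divr_ge0//.
by rewrite ler_wpM2r ?invr_ge0 ?ler_nat//; lia.
Qed.

End sphere_moments.

End uniform_sphere.

(** * Inequalities between p-norms *)

Section finite_norms.
Context {R : realType} {n : nat}.
Implicit Types x y : 'rV[R]_n.

Lemma normp_ge0 (p : R) x : 0 <= normp p x.
Proof. exact: powR_ge0. Qed.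

Lemma normp_eq0 (p : R) x : normp p x = 0 -> p != 0 -> x = 0.
Proof.
move=> /powR_eq0_eq0/eqP + p0; rewrite psumr_eq0 => [/allP h|i _]; last exact: powR_ge0.
apply/rowP => i; rewrite mxE; have /eqP := h i (mem_index_enum i).
by move/powR_eq0_eq0/eqP; rewrite normr_eq0 => /eqP.
Qed.

Lemma normp0 (p : R) : 0 < p -> normp p (0 : 'rV[R]_n) = 0.
Proof.
move=> p0; rewrite /normp big1 ?powR0 ?invr_eq0 ?gt_eqF// => i _.
by rewrite mxE normr0 powR0// gt_eqF.
Qed.

Lemma normpN (p : R) x : normp p (- x) = normp p x.
Proof. by rewrite /normp; under eq_bigr do rewrite mxE normrN. Qed.

Lemma normp_unit (p : R) x : 0 < p -> normp p x != 0 ->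
  \sum_i (`|x ord0 i| / normp p x) `^ p = 1.
Proof.
move=> p0 x0; have xp : 0 < normp p x by rewrite lt_def x0 normp_ge0.
have S0 : 0 <= \sum_i `|x ord0 i| `^ p by apply: sumr_ge0 => i _; exact: powR_ge0.
have e : normp p x `^ p = \sum_i `|x ord0 i| `^ p.
  by rewrite /normp -powRrM mulVf ?gt_eqF// powRr1.
under eq_bigr do rewrite powRM ?invr_ge0 ?normp_ge0//.
rewrite -mulr_suml -e -powRM ?invr_ge0 ?normp_ge0// divff//.
by rewrite powR1.
Qed.

Lemma normp_le_scale (p c A : R) x : 0 < p -> 0 < A -> 0 <= c ->
  \sum_i (`|x ord0 i| / A) `^ p <= c -> normp p x <= c `^ p^-1 * A.
Proof.
move=> p0 A0 c0 h.
have -> : c `^ p^-1 * A = (c * A `^ p) `^ p^-1.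
  by rewrite powRM ?powR_ge0// -powRrM divff ?gt_eqF// powRr1// ltW.
apply: ge0_ler_powR; rewrite ?nnegrE ?invr_ge0 ?(ltW p0) ?mulr_ge0 ?powR_ge0//.
  by apply: sumr_ge0 => i _; exact: powR_ge0.
rewrite -ler_pdivrMr ?powR_gt0// mulr_suml; apply: le_trans h; apply: ler_sum => i _.
by rewrite powRM ?invr_ge0 ?(ltW A0)// -powRN -mulN1r powRrM powR_inv1 ?(ltW A0).
Qed.

(** Young's inequality for the entries divided by the two norms; a vanishing norm forces a zero
    vector and is treated apart. *)
Lemma normp_hoelder (p q : R) x y : 0 < p -> 0 < q -> p^-1 + q^-1 = 1 ->
  dot x y <= normp p x * normp q y.
Proof.
move=> p0 q0 pq.
have [x0|x0] := eqVneq (normp p x) 0.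
  by rewrite (normp_eq0 x0 (lt0r_neq0 p0)) dot0l mulr_ge0 ?normp_ge0.
have [y0|y0] := eqVneq (normp q y) 0.
  by rewrite (normp_eq0 y0 (lt0r_neq0 q0)) dot0r mulr_ge0 ?normp_ge0.
have xp : 0 < normp p x by rewrite lt_def x0 normp_ge0.
have yp : 0 < normp q y by rewrite lt_def y0 normp_ge0.
have xy : 0 < normp p x * normp q y := mulr_gt0 xp yp.
rewrite -[leRHS]mul1r -(ler_pdivrMr _ _ xy) mulr_suml.
apply: (@le_trans _ _ (\sum_i ((`|x ord0 i| / normp p x) `^ p / p +
    (`|y ord0 i| / normp q y) `^ q / q))); last first.
  rewrite big_split/=.
  have -> : \sum_i (`|x ord0 i| / normp p x) `^ p / p = p^-1.
    by rewrite -mulr_suml (normp_unit p0 x0) mul1r.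
  have -> : \sum_i (`|y ord0 i| / normp q y) `^ q / q = q^-1.
    by rewrite -mulr_suml (normp_unit q0 y0) mul1r.
  by rewrite pq.
apply: ler_sum => i _.
have ux : 0 <= `|x ord0 i| / normp p x := divr_ge0 (normr_ge0 _) (ltW xp).
have uy : 0 <= `|y ord0 i| / normp q y := divr_ge0 (normr_ge0 _) (ltW yp).
apply: (@le_trans _ _ ((`|x ord0 i| / normp p x) * (`|y ord0 i| / normp q y))); last first.
  exact: (conjugate_powR ux uy p0 q0 pq).
apply: le_trans (ler_norm _) _.
rewrite normrM (normrM (x ord0 i)) normfV (gtr0_norm xy) invfM mulrACA.
exact: lexx.
Qed.

(** Divided by the [p]-norm, every entry is at most 1 in absolute value, so a larger exponent only
    lowers its power. *)
Lemma normp_anti (p r : R) x : 0 < p -> p <= r -> normp r x <= normp p x.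
Proof.
move=> p0 pr; have r0 := lt_le_trans p0 pr.
have [x0|x0] := eqVneq (normp p x) 0.
  by rewrite (normp_eq0 x0 (lt0r_neq0 p0)) (normp0 r0) (normp0 p0).
have xp : 0 < normp p x by rewrite lt_def x0 normp_ge0.
rewrite (_ : normp p x = 1 `^ r^-1 * normp p x); last by rewrite powR1 mul1r.
apply: normp_le_scale => //.
rewrite -(normp_unit p0 x0); apply: ler_sum => i _.
have [-> |xi0] := eqVneq (x ord0 i) 0.
  by rewrite normr0 mul0r !powR0// gt_eqF.
apply: ger_powR => //; rewrite divr_gt0 ?normr_gt0//= ler_pdivrMr// mul1r.
rewrite -[leLHS](powRr1 (normr_ge0 _)) -(divff (lt0r_neq0 p0)) powRrM.
apply: ge0_ler_powR; rewrite ?nnegrE ?invr_ge0 ?(ltW p0) ?powR_ge0//.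
  by apply: sumr_ge0 => j _; exact: powR_ge0.
by rewrite (bigD1 i)//= lerDl; apply: sumr_ge0 => j _; exact: powR_ge0.
Qed.

(** Scaling by the power mean [A] of order [s] makes the [s]-th powers sum to [n]; then the tangent
    bound [u^q <= (q/s) u^s + 1 - q/s] does the work of Jensen's inequality. *)
Lemma normp_power_mean (q s : R) x : 0 < q -> q <= s ->
  normp q x <= n%:R `^ (q^-1 - s^-1) * normp s x.
Proof.
move=> q0 qs; have s0 := lt_le_trans q0 qs.
have [x0|x0] := eqVneq (normp s x) 0.
  by rewrite (normp_eq0 x0 (lt0r_neq0 s0)) (normp0 q0) (normp0 s0) mulr0.
have sp : 0 < normp s x by rewrite lt_def x0 normp_ge0.
have n0 : (0 < n)%N.
  rewrite lt0n; apply: contra_neq x0 => n0.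
  rewrite (_ : x = 0) ?normp0//; apply/rowP => i.
  by have := ltn_ord i; rewrite {2}n0.
have nR : 0 < n%:R :> R by rewrite ltr0n.
set A := n%:R `^ (- s^-1) * normp s x.
have A0 : 0 < A := mulr_gt0 (powR_gt0 _ nR) sp.
have -> : n%:R `^ (q^-1 - s^-1) * normp s x = n%:R `^ q^-1 * A.
  by rewrite /A mulrA -powRD// (gt_eqF nR) implybT.
apply: normp_le_scale => //.
have young (u : R) : 0 <= u -> u `^ q <= q / s * u `^ s + (1 - q / s).
  move=> u0; have [->|qNs] := eqVneq q s.
    by rewrite divff ?gt_eqF// mul1r subrr addr0.
  have qs' : q < s by rewrite lt_neqAle qNs.
  have t1 : 0 < s / q by rewrite divr_gt0.
  have t2 : 0 < (1 - q / s)^-1 by rewrite invr_gt0 subr_gt0 ltr_pdivrMr// mul1r.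
  have := conjugate_powR (powR_ge0 u q) ler01 t1 t2.
  rewrite invf_div invrK addrC subrK powR1 !mulr1 mul1r -powRrM => /(_ erefl).
  rewrite (_ : q * (s / q) = s); last by field; rewrite gt_eqF.
  by rewrite [_ `^ _ * _]mulrC.
apply: (@le_trans _ _ (\sum_i (q / s * (`|x ord0 i| / A) `^ s + (1 - q / s)))).
  by apply: ler_sum => i _; apply: young; rewrite divr_ge0// ltW.
rewrite big_split/= sumr_const card_ord -mulr_sumr.
have -> : \sum_i (`|x ord0 i| / A) `^ s = n%:R.
  transitivity (n%:R * \sum_i (`|x ord0 i| / normp s x) `^ s); last first.
    by rewrite (normp_unit s0 x0) mulr1.
  rewrite mulr_sumr; apply: eq_bigr => i _.
  rewrite /A invfM mulrCA powRM ?divr_ge0 ?invr_ge0 ?powR_ge0 ?normp_ge0//.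
  by rewrite -powRN opprK -powRrM mulVf ?(gt_eqF s0)// (powRr1 (ltW nR)).
by rewrite -[(1 - _) *+ n]mulr_natr -mulrDl addrC subrK mul1r.
Qed.

Lemma norm2_normp (p : R) x : 0 < p -> p <= 2 -> norm2 x <= normp p x.
Proof.
move=> p0 p2; apply: le_trans (normp_anti x p0 p2).
rewrite /norm2 /normp powR12_sqrt; last by apply: sumr_ge0 => i _; exact: powR_ge0.
rewrite ler_wsqrtr// dotxxE; apply: ler_sum => i _.
by rewrite powR_mulrn// real_normK ?num_real.
Qed.

End finite_norms.

(** * The weight dominating the squared dual norm, and its mean over the sphere *)

Section weight.
Context {R : realType} {n : nat}.
Implicit Types x y : 'rV[R]_n.

(* The squared dual norm of the mirror step, replaced by an even-exponent norm: for a suitable [k] this loses only a factor accounted for by [n `^ a], and the moments of the sphere bound its mean. *)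
Definition dual_weight (a : R) (k : nat) x : R :=
  n%:R `^ a * normp k.*2%:R x ^+ 2.

Lemma dual_weight_ge0 a k x : 0 <= dual_weight a k x.
Proof. by rewrite mulr_ge0 ?powR_ge0 ?sqr_ge0. Qed.

Lemma measurable_normp (p : R) : measurable_fun setT (@normp R n p).
Proof.
apply: (measurableT_comp (measurable_powR p^-1)); apply: measurable_sum => i.
apply: (measurableT_comp (measurable_powR p)).
by apply: measurableT_comp; [exact: normr_measurable|exact: measurable_coord].
Qed.

Lemma measurable_dual_weight a k : measurable_fun setT (dual_weight a k).
Proof.
apply: measurable_funM; first exact: measurable_cst.
by apply: measurable_funX; exact: measurable_normp.
Qed.

Lemma coord_symmetric_dual_weight a k : coord_symmetric (dual_weight a k).
Proof.
split => [i x|i j x]; rewrite /dual_weight /normp; congr (_ * (_ `^ _) ^+ 2).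
  by apply: eq_bigr => l _; rewrite mxE; case: ifP => //; rewrite normrN.
rewrite [RHS](reindex_inj (@perm_inj _ (tperm i j))).
by apply: eq_bigr => l _; rewrite mxE.
Qed.

Lemma normp_evenX k x : (0 < k)%N ->
  (normp k.*2%:R x ^+ 2) ^+ k = \sum_i x ord0 i ^+ k.*2.
Proof.
move=> k0; have k2 : (0 : R) < k.*2%:R by rewrite ltr0n double_gt0.
rewrite -exprM mul2n -powR_mulrn ?normp_ge0// /normp -powRrM mulVf ?gt_eqF//.
rewrite powRr1; last by apply: sumr_ge0 => i _; exact: powR_ge0.
apply: eq_bigr => i _; rewrite powR_mulrn//.
by rewrite -mul2n !exprM real_normK ?num_real.
Qed.

Lemma dual_weight_sphere a k x : (0 < k)%N -> sphere2 x ->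
  `|dual_weight a k x| <= n%:R `^ a.
Proof.
move=> k0 sx; rewrite ger0_norm ?dual_weight_ge0// -[leRHS]mulr1.
rewrite ler_wpM2l ?powR_ge0// -(@ler_pXn2r _ k) ?nnegrE ?sqr_ge0// expr1n.
rewrite normp_evenX// -(sphere_dot sx) dotxxE; apply: ler_sum => i _.
rewrite -(real_normK (num_real _)) -mul2n exprM -[X in _ <= X]expr1.
rewrite -(real_normK (num_real _)) ler_wiXn2l ?sqr_ge0 ?exprn_ile1 ?coord_le1//.
Qed.

(* Bernoulli's inequality [y ^+ k >= 1 + k * (y - 1)] replaces Jensen's inequality for the concave map [t `^ k^-1]. *)
Lemma bernoulli k (y : R) : 0 <= y -> 1 + k%:R * (y - 1) <= y ^+ k.
Proof.
move=> y0; elim: k => [|k IHk]; first by rewrite mul0r addr0 expr0.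
rewrite exprS; apply: le_trans (ler_wpM2l y0 IHk).
have : 0 <= k%:R * (y - 1) ^+ 2 by rewrite mulr_ge0 ?sqr_ge0.
by rewrite -natr1; lra.
Qed.

(** The [k]-th power of the squared [2k]-norm is a sum of even powers of coordinates, of mean at
    most [n (2k/n)^k]; concavity of the [k]-th root brings this back to the first power. *)
Lemma Rint_dual_weight_le (mu : probability 'rV[R]_n R) a k : (1 < n)%N -> (0 < k)%N ->
  uniform_on_sphere mu ->
  \int[mu]_x dual_weight a k x <=
    n%:R `^ a * n%:R `^ (k%:R^-1) * (2 * k%:R) / n%:R.
Proof.
move=> n1 k0 mu_unif; have nR : 0 < n%:R :> R by rewrite ltr0n (ltnW n1).
have kR : 0 < k%:R :> R by rewrite ltr0n.
(* [y0] is the [k]-th root of [n (2k/n)^k]. The tangent is taken there, so that its mean is at most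
   [y0 / k + y0 (1 - 1/k) = y0]. *)
set y0 : R := n%:R `^ (k%:R^-1) * (2 * k%:R) / n%:R.
have y0p : 0 < y0 by rewrite !(mulr_gt0, invr_gt0) ?powR_gt0.
have y0k : y0 ^+ k = n%:R * ((2 * k)%:R / n%:R) ^+ k.
  by rewrite /y0 -mulrA exprMn -powR_mulrn ?powR_ge0// -powRrM mulVf ?gt_eqF// powRr1 ?ltW// natrM.
pose tangent x := y0 / k%:R * ((\sum_i x ord0 i ^+ k.*2) / y0 ^+ k) + y0 * (1 - k%:R^-1).
have mw := measurable_dual_weight 0 k.
have tangent_le x : normp k.*2%:R x ^+ 2 <= tangent x.
  have := bernoulli k (divr_ge0 (sqr_ge0 (normp k.*2%:R x)) (ltW y0p)).
  rewrite expr_div_n normp_evenX// /tangent; set S := _ / y0 ^+ k; set u := _ / y0 => h.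
  have -> : normp k.*2%:R x ^+ 2 = y0 * u by rewrite /u mulrCA divff ?mulr1 ?gt_eqF.
  have -> : y0 / k%:R * S + y0 * (1 - k%:R^-1) =
      y0 * u + y0 / k%:R * (S - (1 + k%:R * (u - 1))) by field; rewrite gt_eqF.
  by rewrite lerDl mulr_ge0 ?divr_ge0 ?(ltW y0p) ?(ltW kR)// subr_ge0.
have ipow i : intble mu (fun x : 'rV[R]_n => x ord0 i ^+ k.*2).
  apply: (intble_sphere mu_unif (c := 1)).
    by apply: measurable_funX; exact: measurable_coord.
  by move=> x sx; rewrite normrX exprn_ile1 ?coord_le1.
have iw : intble mu (dual_weight a k).
  apply: (intble_sphere mu_unif (measurable_dual_weight a k)).
  by move=> x; exact: dual_weight_sphere.
have isum : intble mu (fun x : 'rV[R]_n => \sum_i x ord0 i ^+ k.*2) by exact: intble_sum.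
have it : intble mu (fun x => n%:R `^ a * tangent x).
  apply: intbleZ; apply: intbleD; last exact: intble_cst.
  under eq_fun do rewrite [_ / y0 ^+ k]mulrC mulrA.
  exact: intbleZ.
apply: (@le_trans _ _ (\int[mu]_x (n%:R `^ a * tangent x))).
  apply: le_Rint => // x; rewrite ler_wpM2l ?powR_ge0//; exact: tangent_le.
have it' : intble mu tangent.
  apply: intbleD; last exact: intble_cst.
  under eq_fun do rewrite [_ / y0 ^+ k]mulrC mulrA.
  exact: intbleZ.
rewrite RintZ// -!mulrA ler_wpM2l ?powR_ge0//.
under eq_Rintegral do rewrite /tangent [_ / y0 ^+ k]mulrC mulrA.
rewrite RintD; [|exact: intbleZ|exact: intble_cst].
rewrite RintZ// Rint_sum// Rintegral_cst//= probability_setT mulr1.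
have : \sum_i \int[mu]_x (x ord0 i ^+ k.*2) <= y0 ^+ k.
  rewrite y0k; apply: (@le_trans _ _ (\sum_(i < n) ((2 * k)%:R / n%:R) ^+ k)).
    by apply: ler_sum => i _; exact: sphere_even_moment_le.
  by rewrite sumr_const card_ord -[_ *+ n]mulr_natl lexx.
set S := \sum_i _ => hS.
have y0k0 : 0 < y0 ^+ k by rewrite exprn_gt0.
have : y0 / k%:R / y0 ^+ k * S <= y0 / k%:R.
  have h1 : (y0 ^+ k)^-1 * S <= 1 by rewrite ler_pdivrMl// mulr1.
  by rewrite -mulrA -[leRHS]mulr1 ler_wpM2l// divr_ge0// ltW.
have -> : n%:R `^ k%:R^-1 * (2 * (k%:R / n%:R)) = y0 by rewrite /y0; ring.
lra.
Qed.

(** For [q <= 2k] the dual norm passes to the [2k]-norm by the power mean inequality, at the price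
    of [n ^ (1/q - 1/(2k))], whose square is the factor in the weight. *)
Lemma dual_weight_mean (p q : R) (k : nat) x v : 0 < p -> 0 < q -> p^-1 + q^-1 = 1 ->
  q <= k.*2%:R ->
  dot x v ^+ 2 <= dual_weight (2 / q - k%:R^-1) k x * normp p v ^+ 2.
Proof.
move=> p0 q0 pq qk; have k2 := lt_le_trans q0 qk.
have kR : k%:R != 0 :> R by move: k2; rewrite -muln2 natrM; case: eqVneq => // ->; rewrite mul0r ltxx.
have h y : dot y v <= n%:R `^ (q^-1 - k.*2%:R^-1) * normp k.*2%:R y * normp p v.
  rewrite addrC in pq.
  by rewrite (le_trans (normp_hoelder _ _ q0 p0 pq))// ler_wpM2r ?normp_ge0 ?normp_power_mean.
have -> : dual_weight (2 / q - k%:R^-1) k x * normp p v ^+ 2 =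
    (n%:R `^ (q^-1 - k.*2%:R^-1) * normp k.*2%:R x * normp p v) ^+ 2.
  rewrite !exprMn /dual_weight -[in RHS]powR_mulrn ?powR_ge0// -powRrM.
  by congr (_ `^ _ * _ * _); rewrite -muln2 natrM; field; rewrite kR gt_eqF.
rewrite -(real_normK (num_real (dot x v))) lerXn2r ?nnegrE ?mulr_ge0 ?powR_ge0 ?normp_ge0//.
rewrite ler_norml; apply/andP; split; last exact: h.
rewrite lerNl -dotNl -(normpN _ x); exact: h.
Qed.

(** Hoelder's inequality is used at the exponent [2k]. The hypothesis says that [p] is at most the
    conjugate [2k / (2k - 1)], so the conjugate norm of [v] is below its [p]-norm and no power of
    [n] is lost. *)
Lemma dual_weight_anti (p : R) (k : nat) x v : 0 < p -> (0 < k)%N ->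
  p * (k.*2%:R - 1) <= k.*2%:R ->
  dot x v ^+ 2 <= dual_weight 0 k x * normp p v ^+ 2.
Proof.
move=> p0 k0 pk; have k2 : 1 < k.*2%:R :> R by rewrite ltr1n; case: k k0 {pk}.
have k20 : 0 < k.*2%:R :> R by rewrite (lt_trans ltr01).
set r := k.*2%:R / (k.*2%:R - 1) : R.
have r0 : 0 < r by rewrite divr_gt0// subr_gt0.
have h y : dot y v <= normp k.*2%:R y * normp p v.
  apply: (@le_trans _ _ (normp k.*2%:R y * normp r v)).
    apply: normp_hoelder => //; rewrite /r invf_div; field.
    by rewrite gt_eqF.
  apply: ler_wpM2l; first exact: normp_ge0.
  apply: normp_anti => //; rewrite /r ler_pdivlMr ?subr_gt0//.
rewrite /dual_weight powRr0 mul1r -exprMn.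
rewrite -(real_normK (num_real (dot x v))) lerXn2r ?nnegrE ?mulr_ge0 ?normp_ge0//.
rewrite ler_norml; apply/andP; split; last exact: h.
rewrite lerNl -dotNl -(normpN _ x); exact: h.
Qed.

End weight.

Section weight_choice.
Context {R : realType}.

Lemma expR1_le4 : expR 1 <= 4 :> R.
Proof.
have h : (2^-1 : R) <= expR (- 2^-1) by have := expR_ge1Dx (- 2^-1 : R); lra.
have h2 : expR 2^-1 <= 2 :> R.
  by rewrite -[leLHS]invrK -expRN -[leRHS]invrK lef_pV2// ?posrE ?expR_gt0.
rewrite (_ : (1 : R) = 2^-1 + 2^-1); last by field.
have := expR_ge0 (2^-1 : R); rewrite expRD; nra.
Qed.

Lemma ln_ge1 (n : nat) : (8 <= n)%N -> 1 <= ln (n%:R : R).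
Proof.
move=> n8; have nR : 0 < n%:R :> R by rewrite ltr0n; lia.
rewrite -[leLHS]expRK ler_ln ?posrE ?expR_gt0//.
by apply: le_trans expR1_le4 _; rewrite ler_nat; lia.
Qed.

Lemma hoelder_conjugate_EFin (p : R) : 1 < p ->
  hoelder_conjugate p%:E = (p / (p - 1))%:E.
Proof.
move=> p1; rewrite /hoelder_conjugate /= eqe gt_eqF ?(lt_trans ltr01)//.
by rewrite -EFinB inver gt_eqF ?subr_gt0// -EFinM.
Qed.

Lemma rho_large_gt0 (n : nat) : (8 <= n)%N -> 0 < 16 * ln (n%:R : R) - 8.
Proof. by move=> /ln_ge1; lra. Qed.

(** With [k] the least integer exceeding [q / 2], [2k <= q + 2 <= 6 (q - 1)] for [q >= 2], and the
    powers of [n] combine to [n ^ (2/q - 1)]. *)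
Lemma weight_small_exponent (n : nat) (p q : R) : (8 <= n)%N -> 0 < p -> 2 <= q ->
  p^-1 + q^-1 = 1 -> q - 1 <= 16 * ln n%:R - 8 ->
  exists a k, [/\ (0 < k)%N,
    forall x v : 'rV[R]_n, dot x v ^+ 2 <= dual_weight a k x * normp p v ^+ 2 &
    n%:R `^ a * n%:R `^ (k%:R^-1) * (2 * k%:R) / n%:R <= 6 * rho n q%:E].
Proof.
move=> n8 p0 q2 pq qln; set k := (Num.truncn (q / 2)).+1.
have nR : 0 < n%:R :> R by rewrite ltr0n; lia.
have k1 : q / 2 < k%:R by exact: truncnS_gt.
have k2 : k%:R <= q / 2 + 1.
  by rewrite /k -natr1 lerD2r truncn_le// divr_ge0//; lra.
exists (2 / q - k%:R^-1), k; split => // [x v|].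
  apply: dual_weight_mean => //; first lra.
  by rewrite -muln2 natrM; lra.
rewrite -powRD ?(gt_eqF nR) ?implybT// subrK /= min_l// powRB ?(gt_eqF nR) ?implybT//.
rewrite (powRr1 (ltW nR)).
have : 0 <= n%:R `^ (2 / q) / n%:R :> R by rewrite divr_ge0 ?powR_ge0 ?ltW.
set c := n%:R `^ (2 / q) / n%:R => c0; have -> : n%:R `^ (2 / q) * (2 * k%:R) / n%:R = 2 * k%:R * c :> R.
  by rewrite /c; ring.
by rewrite [leRHS]mulrA ler_wpM2r//; lra.
Qed.

(** With [k] just above [ln n], [2k] stays below the conjugate exponent of [p]. Then
    [n ^ (1/k) <= e <= 4], and [8k <= 8 ln n + 8] is at most [6 (16 ln n - 8)] because
    [ln n >= 1]. *)
Lemma weight_large_exponent (n : nat) (p : R) : (8 <= n)%N -> 1 <= p ->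
  (p - 1) * (16 * ln n%:R - 7) <= p ->
  exists k, [/\ (0 < k)%N,
    forall x v : 'rV[R]_n, dot x v ^+ 2 <= dual_weight 0 k x * normp p v ^+ 2 &
    n%:R `^ 0 * n%:R `^ (k%:R^-1) * (2 * k%:R) / n%:R <=
      6 * ((16 * ln n%:R - 8) * n%:R `^ (-1)) :> R].
Proof.
move=> n8 p1 pln; set k := (Num.truncn (ln (n%:R : R))).+1.
have nR : 0 < n%:R :> R by rewrite ltr0n; lia.
have ln1 := ln_ge1 n8.
have k1 : ln n%:R < k%:R :> R by exact: truncnS_gt.
have k2 : k%:R <= ln n%:R + 1 :> R.
  by rewrite /k -natr1 lerD2r truncn_le// (le_trans ler01).
exists k; split => // [x v|].
  apply: dual_weight_anti => //; first lra.
  rewrite -muln2 natrM; nra.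
have h : n%:R `^ (k%:R^-1) <= 4 :> R.
  rewrite -{1}(lnK (_ : n%:R \is Num.pos)) ?posrE// -expRM.
  apply: le_trans expR1_le4; by rewrite ler_expR ler_pdivrMr ?mul1r ?(ltW k1)// (lt_trans _ k1)//; lra.
rewrite powRr0 mul1r powR_inv1 ?(ltW nR)// [leRHS]mulrA ler_wpM2r ?invr_ge0 ?(ltW nR)//.
apply: (@le_trans _ _ (4 * (2 * k%:R))); last lra.
by rewrite ler_wpM2r// mulr_ge0.
Qed.

(** The cases follow the minimum in [rho]; [p = 1] is separate because the conjugate exponent is
    then infinite. When the logarithm attains the minimum, [n ^ (-1)] is enlarged to
    [n ^ (2/q - 1)]. *)
Lemma exists_dual_weight (n : nat) (p : R) : (8 <= n)%N -> 1 <= p -> p <= 2 ->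
  0 < rho n (hoelder_conjugate p%:E) /\
  exists a k, [/\ (0 < k)%N,
    forall x v : 'rV[R]_n, dot x v ^+ 2 <= dual_weight a k x * normp p v ^+ 2 &
    n%:R `^ a * n%:R `^ (k%:R^-1) * (2 * k%:R) / n%:R <=
      6 * rho n (hoelder_conjugate p%:E)].
Proof.
move=> n8 p1 p2; have nR : 0 < n%:R :> R by rewrite ltr0n; lia.
have ln1 := ln_ge1 n8; have c0 := rho_large_gt0 n8.
have [pE|pN1] := eqVneq p 1.
  rewrite pE hoelder_conjugate1 /=; split; first by rewrite mulr_gt0 ?powR_gt0.
  have [||k hk] := @weight_large_exponent n 1 n8 => //; first lra.
  by exists 0, k.
have p1' : 1 < p by rewrite lt_neqAle eq_sym pN1.
rewrite hoelder_conjugate_EFin//; set q := p / (p - 1).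
have pm1 : 0 < p - 1 by rewrite subr_gt0.
have q2 : 2 <= q by rewrite /q ler_pdivlMr//; lra.
have pq : p^-1 + q^-1 = 1 by rewrite /q invf_div; field; rewrite gt_eqF//; lra.
split; first by rewrite /= mulr_gt0 ?powR_gt0// lt_min c0 andbT; lra.
have [qln|qln] := leP (q - 1) (16 * ln n%:R - 8).
  by apply: weight_small_exponent => //; lra.
have qln' : 16 * ln n%:R - 7 <= q by lra.
have [||k [k0 hk wk]] := @weight_large_exponent n p n8 => //.
  by rewrite mulrC -ler_pdivlMr.
exists 0, k; split => //; apply: le_trans wk _.
rewrite /= min_r ?(ltW qln)// !mulrA ler_wpM2l ?mulr_ge0 ?(ltW c0)//.
apply: ler_powR; first by rewrite ler1n; lia.
by rewrite lerDr divr_ge0//; lra.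
Qed.

End weight_choice.

(** * Gradients of smooth convex functions *)

Section gradient.
Context {R : realType} {n : nat}.
Implicit Types (x y v w G : 'rV[R]_n) (h : 'rV[R]_n -> R).

Lemma dot_grad h x v : differentiable h x -> 'd h x v = dot (grad h x) v.
Proof.
move=> dh; rewrite [in LHS](row_sum_delta v) linear_sum /dot.
by apply: eq_bigr => i _; rewrite linearZ /= mxE mulrC.
Qed.

(** A sequence of step lengths replaces the limit over a punctured neighbourhood: limits of
    sequences preserve measurability, which makes gradients measurable. *)
Lemma difference_quotient_cvg h x v : differentiable h x ->
  (fun k => (harmonic k)^-1 * (h (x + harmonic k *: v) - h x)) @ \oo --> dot (grad h x) v.
Proof.
move=> dh; rewrite -dot_grad// -deriveE//.
have dv : derivable h x v by exact: diff_derivable.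
have /cvgr_dnbhsP/(_ harmonic) := dv.
rewrite (_ : (fun k => (harmonic k)^-1 * (h (x + harmonic k *: v) - h x)) =
  (fun k => (harmonic k)^-1 *: ((h \o shift x) (harmonic k *: v) - h x))); last first.
  by apply/funext => k /=; rewrite [x + _]addrC.
apply; split; last exact: cvg_harmonic.
by move=> k; rewrite gt_eqF// harmonic_gt0.
Qed.

Lemma coord_le_norm x i : `|x ord0 i| <= `|x|.
Proof.
rewrite [leRHS]/Num.norm /= mx_normrE.
exact: (le_bigmax _ (fun ij : 'I_1 * 'I_n => `|x ij.1 ij.2|) (ord0, i)).
Qed.

Lemma dotxx_le_norm x : dot x x <= n%:R * `|x| ^+ 2.
Proof.
rewrite dotxxE (@le_trans _ _ (\sum_(i < n) `|x| ^+ 2))//.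
  apply: ler_sum => i _; rewrite -real_normK ?num_real//.
  by rewrite lerXn2r ?nnegrE ?coord_le_norm.
by rewrite sumr_const card_ord -[_ *+ n]mulr_natl.
Qed.

Lemma norm_le_norm2 x : `|x| <= norm2 x.
Proof.
rewrite [leLHS]/Num.norm /= mx_normrE; apply: bigmax_le => [|[i j] _ /=]; first exact: norm2_ge0.
rewrite -(@ler_pXn2r _ 2) ?nnegrE ?norm2_ge0// norm2_sqr real_normK ?num_real// (ord1 i).
by rewrite dotxxE (bigD1 j)//= lerDl; apply: sumr_ge0 => l _; rewrite sqr_ge0.
Qed.

Lemma norm2_le_norm x : norm2 x <= n%:R * `|x|.
Proof.
rewrite -(@ler_pXn2r _ 2) ?nnegrE ?norm2_ge0 ?mulr_ge0// norm2_sqr.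
apply: le_trans (dotxx_le_norm x) _; rewrite exprMn ler_wpM2r ?sqr_ge0//.
by rewrite -natrX ler_nat; nia.
Qed.

Lemma lipschitz_continuous (f : 'rV[R]_n -> R) (c : R) : 0 <= c ->
  (forall x y, `|f x - f y| <= c * norm2 (x - y)) -> continuous f.
Proof.
move=> c0 lf x; apply: (iffRL (@cvgrPdist_le R R^o _ (nbhs x) (nbhs_filter x) f (f x))).
move=> e e0; set C := c * n%:R + 1.
have C0 : 0 < C by rewrite /C ltr_wpDl// mulr_ge0.
near=> y; apply: le_trans (lf x y) _; apply: (@le_trans _ _ (C * `|x - y|)).
  apply: le_trans (ler_wpM2l c0 (norm2_le_norm _)) _.
  by rewrite mulrA ler_wpM2r// lerDl.
rewrite -ler_pdivlMl// ltW// mulrC.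
near: y; apply/nbhs_ballP; exists (e / C) => /=; first by rewrite divr_gt0.
by move=> y; rewrite -ball_normE.
Unshelve. all: by end_near. Qed.

Lemma continuous_dot G : continuous (dot G).
Proof.
apply: (@lipschitz_continuous _ (norm2 G)) => [|x y]; first exact: norm2_ge0.
rewrite -dotBr ler_norml dot_le_norm2 andbT lerNl -dotNl.
by apply: le_trans (dot_le_norm2 _ _) _; rewrite /norm2 dotNl dotNr opprK.
Qed.

(** A quadratic remainder is a little-o of the increment. This identifies the mean of [g] as the
    gradient of [f] without differentiating under the integral sign. *)
Lemma grad_of_quadratic h x G (c : R) :
  (forall v, `|h (x + v) - h x - dot G v| <= c * dot v v) ->
  differentiable h x /\ grad h x = G.
Proof.
move=> hq.
have linG : linear (dot G : 'rV[R]_n -> R).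
  by move=> a u v; rewrite dotDr dotZr.
pose dG : {linear 'rV[R]_n -> R} := HB.pack (dot G) (GRing.isLinear.Build _ _ _ _ _ linG).
have cG : continuous dG by exact: continuous_dot.
have lo : h \o shift x = cst (h x) + dG +o_ (0 : 'rV[R]_n) id.
  apply/eqaddoP => e e0; set C := `|c| * n%:R + 1.
  have C0 : 0 < C by rewrite /C ltr_wpDl// mulr_ge0.
  near=> v; rewrite [X in `|X|](_ : _ = h (x + v) - h x - dot G v); last first.
    by rewrite [x + v]addrC -addrA -opprD.
  apply: le_trans (hq v) _; apply: (@le_trans _ _ (`|c| * (n%:R * `|v| ^+ 2))).
    apply: (@le_trans _ _ (`|c| * dot v v)).
      by rewrite ler_wpM2r ?dotxx_ge0 ?ler_norm.
    by rewrite ler_wpM2l ?dotxx_le_norm.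
  rewrite expr2 !mulrA ler_wpM2r//; apply: (@le_trans _ _ (C * `|v|)).
    by rewrite ler_wpM2r// /C lerDl.
  rewrite -ler_pdivlMl// ltW// mulrC.
  near: v; apply/nbhs_ballP; exists (e / C) => /=; first by rewrite divr_gt0.
  by move=> v; rewrite -ball_normE /= sub0r normrN.
have dE := diff_unique cG lo.
have dh : differentiable h x.
  by apply/diff_locallyP; split; [rewrite dE|rewrite dE].
split => //; apply/rowP => i; rewrite mxE dE /=.
exact: dot_delta.
Unshelve. all: by end_near. Qed.

Lemma convex_grad_le h x y : convex_function setT h -> differentiable h x ->
  dot (grad h x) (y - x) <= h y - h x.
Proof.
move=> ch dh; apply: (cvgr_to_le (@difference_quotient_cvg h x (y - x) dh)).
near=> k; set t : R := harmonic k.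
have t0 : 0 < t := harmonic_gt0 k.
have t1 : t <= 1 by rewrite /t /harmonic/= invf_le1// ler1n.
have hc : h (t *: y + (1 - t) *: x) <= t * h y + (1 - t) * h x :=
  ch (Itv01 (ltW t0) t1) y x (mem_set I) (mem_set I).
rewrite ler_pdivrMl// lerBlDr.
rewrite (_ : x + t *: (y - x) = t *: y + (1 - t) *: x); last first.
  by rewrite scalerBr scalerBl scale1r addrCA.
by apply: le_trans hc _; lra.
Unshelve. all: by end_near. Qed.

(* A differentiable convex function with [l]-Lipschitz gradient grows at most quadratically along its tangent planes; the constant [l] (rather than [l / 2]) needs only convexity at both ends. *)
Lemma convex_smooth_le h g (l : R) x y : convex_function setT h -> has_gradient h g ->
  lipschitz2 g l ->
  0 <= h y - h x - dot (g x) (y - x) <= l * dot (y - x) (y - x).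
Proof.
move=> ch hg lg; have [dx gx] := hg x; have [dy gy] := hg y.
have h1 := convex_grad_le y ch dx; have h2 := convex_grad_le x ch dy.
rewrite -gx in h1; rewrite -gy -opprB dotNr in h2.
apply/andP; split; first lra.
apply: (@le_trans _ _ (dot (g y - g x) (y - x))); first by rewrite dotBl; lra.
apply: le_trans (dot_le_norm2 _ _) _; rewrite -norm2_sqr expr2 mulrA.
by rewrite ler_wpM2r ?norm2_ge0.
Qed.

Lemma measurable_grad h : continuous h -> (forall x, differentiable h x) ->
  measurable_fun setT (grad h).
Proof.
move=> ch dh; have mh := continuous_measurable_row ch.
apply: measurable_rowP => i.
apply: (@measurable_fun_cvg _ _ _ _
  (fun k x => (harmonic k)^-1 * (h (x + harmonic k *: delta_mx ord0 i) - h x))).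
  move=> k; apply: measurable_funM; first exact: measurable_cst.
  apply: measurable_funB => //; apply: (measurableT_comp mh).
  by apply: measurable_rowD; [exact: measurable_id|exact: measurable_cst].
by move=> x _; rewrite -dot_delta; exact: difference_quotient_cvg.
Qed.

End gradient.

(** * The mirror map and the inequality for one mirror step *)

Section mirror_map.
Context {R : realType} {n : nat}.
Variables (p : R) (d : 'rV[R]_n -> R).
Hypotheses (p_ge1 : 1 <= p) (p_le2 : p <= 2) (d_prox : prox_function p d).
Implicit Types (u w z G : 'rV[R]_n).

Let cd : continuous d. Proof. by case: d_prox. Qed.

Let dd x : differentiable d x. Proof. by case: d_prox. Qed.

Lemma prox_strongly_convex x y : 2^-1 * normp p (y - x) ^+ 2 <= bregman d x y.
Proof. by case: d_prox => _ _ _ h _; exact: h. Qed.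

Lemma bregman_ge_dot x y : 2^-1 * dot (y - x) (y - x) <= bregman d x y.
Proof.
apply: le_trans (prox_strongly_convex x y); rewrite ler_wpM2l// -norm2_sqr.
rewrite lerXn2r ?nnegrE ?norm2_ge0 ?normp_ge0// norm2_normp//.
exact: lt_le_trans p_ge1.
Qed.

Lemma bregman_ge0 x y : 0 <= bregman d x y.
Proof. by apply: le_trans (bregman_ge_dot x y); rewrite mulr_ge0// dotxx_ge0. Qed.

(** Strong convexity bounds the points of the sublevel set of 0 by twice the norm of [w - grad d 0],
    so this closed set is compact. *)
Lemma mirror_minimizer_exists w : exists u, minimizer (fun u => d u - dot w u) u.
Proof.
pose psi u := d u - dot w u; pose A := [set u | psi u <= psi 0].
have cpsi : continuous psi.
  move=> u; apply: (@cvgB R R^o _ (nbhs u) (nbhs_filter u) d (dot w) (d u) (dot w u)).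
      exact: cd.
    exact: continuous_dot.
have Abound u : A u -> norm2 u <= 2 * norm2 (w - grad d 0).
  rewrite /A /psi/= dot0r subr0 => Au.
  have := bregman_ge_dot 0 u; rewrite /bregman subr0 => h.
  have h2 : dot u u <= 2 * norm2 (w - grad d 0) * norm2 u.
    have := dot_le_norm2 (w - grad d 0) u; rewrite dotBl; lra.
  have [->|u0] := eqVneq (norm2 u) 0; first by rewrite mulr_ge0 ?norm2_ge0.
  have up : 0 < norm2 u by rewrite lt_def u0 norm2_ge0.
  by rewrite -norm2_sqr expr2 ler_pM2r in h2.
have cA : compact A.
  apply: bounded_closed_compact.
    exists (2 * norm2 (w - grad d 0)); split; first exact: num_real.
    move=> M hM u Au; apply: le_trans (norm_le_norm2 u) _.
    by apply: le_trans (Abound u Au) _; exact: ltW.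
  rewrite (_ : A = psi @^-1` [set x | x <= psi 0])//.
  by apply: closed_comp => // u _; exact: cpsi.
have A0 : A !=set0 by exists 0; rewrite /A /=.
have wc : {within A, continuous psi} by apply: continuous_subspaceT.
have [c cA' cmin] := compact_EVT_min A0 cA wc.
exists c => u; have [uA|uA] := leP (psi u) (psi 0).
  by apply: cmin; rewrite inE.
by rewrite inE in cA'; apply: le_trans (ltW uA).
Qed.

(** The gradient of the convex conjugate of [d], with a dual vector as argument. The prox step is
    this map at [grad d z - c *: G], so its measurability follows from a Lipschitz bound. *)
Definition mirror w := argmin (fun u => d u - dot w u).

Lemma mirror_minimizer w : minimizer (fun u => d u - dot w u) (mirror w).
Proof. exact: (getPex (mirror_minimizer_exists w)). Qed.

(** Minimality gives [dot w v <= dot (grad d u) v] in every direction [v]; the direction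
    [w - grad d u] forces equality. *)
Lemma grad_mirror w : grad d (mirror w) = w.
Proof.
set u := mirror w.
have le_grad v : dot w v <= dot (grad d u) v.
  apply: (cvgr_to_ge (@difference_quotient_cvg _ _ d u v (dd u))).
  near=> k; have t0 : 0 < harmonic k :> R := harmonic_gt0 k.
  have := mirror_minimizer w (u + harmonic k *: v); rewrite -/u dotDr dotZr => h.
  by rewrite ler_pdivlMl//; lra.
apply/eqP; rewrite -subr_eq0; apply/eqP/dotxx_eq0/eqP.
rewrite eq_le dotxx_ge0 andbT dotBl.
have := le_grad (- (grad d u - w)); rewrite !dotNr; lra.
Unshelve. all: by end_near. Qed.

(** Adding the strong convexity inequalities at the two points gives
    [|u - u'|^2 <= <w - w', u - u'>]. *)
Lemma mirror_lipschitz w w' : norm2 (mirror w - mirror w') <= norm2 (w - w').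
Proof.
set u := mirror w; set u' := mirror w'.
have h1 := bregman_ge_dot u u'; have h2 := bregman_ge_dot u' u.
rewrite /bregman /u /u' !grad_mirror -/u -/u' in h1 h2.
have : dot (u - u') (u - u') <= dot (w - w') (u - u').
  have e1 : dot (u' - u) (u' - u) = dot (u - u') (u - u').
    by rewrite -(opprB u u') dotNl dotNr opprK.
  have e2 : dot w (u' - u) = - dot w (u - u') by rewrite -(opprB u u') dotNr.
  have e3 := dotBl w w' (u - u').
  rewrite e1 e2 in h1; lra.
move/le_trans => /(_ _ (dot_le_norm2 _ _)).
have [->|u0] := eqVneq (norm2 (u - u')) 0; first by rewrite norm2_ge0.
have up : 0 < norm2 (u - u') by rewrite lt_def u0 norm2_ge0.
by rewrite -norm2_sqr expr2 ler_pM2r.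
Qed.

Lemma measurable_mirror : measurable_fun setT mirror.
Proof.
apply: measurable_rowP => i; apply: continuous_measurable_row.
apply: (@lipschitz_continuous _ _ _ 1) => // w w'; rewrite mul1r.
apply: le_trans (mirror_lipschitz w w'); apply: le_trans (norm_le_norm2 _).
by have := coord_le_norm (mirror w - mirror w') i; rewrite !mxE.
Qed.

(** The two objectives differ by a constant in [u], so their sets of minimizers coincide and the
    choice operator picks the same point. *)
Lemma argmin_mirror (c : R) G z :
  argmin (fun u => c * dot G (u - z) + bregman d z u) = mirror (grad d z - c *: G).
Proof.
rewrite /mirror /argmin; congr get; apply/seteqP; rewrite /minimizer /bregman.
split => u /= hu v; have := hu v; rewrite !dotBl !dotBr !dotZl; lra.
Qed.

(** The three-point identity for Bregman divergences leaves [c * dot G (z - z')], which strong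
    convexity pays for. The dual norm of [G] enters through an upper bound [W] of its square, so
    that a dominating weight can be substituted. *)
Lemma mirror_step (c W : R) G z x : 0 <= W ->
  (forall v, dot G v ^+ 2 <= W * normp p v ^+ 2) ->
  let z' := mirror (grad d z - c *: G) in
  c * dot G (z - x) <= c ^+ 2 / 2 * W + bregman d z x - bregman d z' x.
Proof.
move=> W0 GW /=; set z' := mirror _.
have gz' : grad d z' = grad d z - c *: G := grad_mirror _.
have three : c * dot G (z' - x) = bregman d z x - bregman d z' x - bregman d z z'.
  rewrite /bregman gz' !dotBl !dotBr !dotZl; ring.
have -> : dot G (z - x) = dot G (z - z') + dot G (z' - x) by rewrite -dotDr addrA subrK.
rewrite mulrDr three.
have sc := prox_strongly_convex z z'.
(* The arithmetic-geometric mean inequality, compared on squares since the hypothesis bounds the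
   square of the pairing. *)
have : c * dot G (z - z') <= (c ^+ 2 * W + normp p (z' - z) ^+ 2) / 2.
  set N := normp p (z' - z).
  have h : (c * dot G (z - z')) ^+ 2 <= (c ^+ 2 * W) * N ^+ 2.
    rewrite exprMn -mulrA; apply: ler_wpM2l; first exact: sqr_ge0.
    by have := GW (z - z'); rewrite /N -(normpN p (z' - z)) opprB; apply.
  have b0 : 0 <= c ^+ 2 * W by rewrite mulr_ge0// sqr_ge0.
  have N0 := sqr_ge0 N.
  rewrite leNgt; apply/negP => lt.
  have : ((c ^+ 2 * W + N ^+ 2) / 2) ^+ 2 < (c * dot G (z - z')) ^+ 2.
    by rewrite ltrXn2r// ?nnegrE ?divr_ge0 ?addr_ge0//; apply: le_trans (ltW lt); rewrite divr_ge0 ?addr_ge0.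
  have := sqr_ge0 (c ^+ 2 * W - N ^+ 2); nra.
by move: sc; lra.
Qed.

Lemma measurable_prox : measurable_fun setT d.
Proof. exact: continuous_measurable_row. Qed.

Lemma measurable_grad_prox : measurable_fun setT (grad d).
Proof. exact: measurable_grad. Qed.

End mirror_map.

(** * Almost everywhere comparison of integrals *)

Section almost_everywhere_integral.
Context {d : measure_display} {T : measurableType d} {R : realType}.
Variable mu : {finite_measure set T -> \bar R}.
Implicit Types h k : T -> R.

Lemma intble_norm h : intble mu h -> intble mu (fun t => `|h t|).
Proof. by move=> ih; apply: integrable_norm. Qed.

Lemma intble_ae_le h k : measurable_fun setT h -> {ae mu, forall t, `|h t| <= k t} ->
  intble mu k -> intble mu h.
Proof.
move=> mh hk ik; apply/integrableP; split; first exact/measurable_EFinP.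
have /integrableP[mk] := intble_norm ik; apply: le_lt_trans.
apply: ae_ge0_le_integral => //=.
- by apply/measurable_EFinP; exact: measurableT_comp.
- by apply/measurable_EFinP; apply: measurableT_comp => //; exact: intble_measurable (intble_norm ik).
- apply: filterS hk => t hkt _ /=.
  by rewrite lee_fin normr_id (le_trans hkt)// ler_norm.
Qed.

(** [h] is replaced by [min h k], which equals it almost everywhere and lies below [k] at every
    point. *)
Lemma le_Rint_ae h k : intble mu h -> intble mu k ->
  {ae mu, forall t, h t <= k t} -> \int[mu]_t h t <= \int[mu]_t k t.
Proof.
move=> ih ik hk; pose h' t := Num.min (h t) (k t).
have mh := intble_measurable ih; have mk := intble_measurable ik.
have mh' : measurable_fun setT h' by exact: measurable_minr.
have -> : \int[mu]_t h t = \int[mu]_t h' t.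
  rewrite /Rintegral; congr fine; apply: ae_eq_integral => //; try exact/measurable_EFinP.
  by apply: filterS hk => t hkt _ /=; rewrite /h' min_l.
apply: le_Rint => // [|x]; last by rewrite /h' ge_min lexx orbT.
apply: (@intble_le _ _ _ _ _ (fun x => `|h x| + `|k x|)) => // [x|].
  by rewrite /h' /Num.min; case: ifP => _; rewrite ?lerDl ?lerDr.
by apply: intbleD; exact: intble_norm.
Qed.

End almost_everywhere_integral.

Lemma Rint_cst {d : measure_display} {T : measurableType d} {R : realType}
  (P : probability T R) (c : R) : \int[P]_t c = c.
Proof. by rewrite Rintegral_cst//= probability_setT mulr1. Qed.

(** * Gradient and smoothness of the objective *)

Section objective.
Context {R : realType} {n : nat} {dX : measure_display} {X : measurableType dX}.
Variables (P : probability X R) (F : 'rV[R]_n -> X -> R)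
  (g : 'rV[R]_n -> X -> 'rV[R]_n) (L : X -> R) (L2 : R).
Hypothesis L2_gt0 : 0 < L2.
Hypothesis F_integrable : forall x, P.-integrable setT (EFin \o F x).
Hypothesis g_measurable : measurable_fun setT (fun u : 'rV[R]_n * X => g u.1 u.2).
Hypothesis L_measurable : measurable_fun setT L.
Hypothesis F_convex_smooth : {ae P, forall xi,
     [/\ closed_function (F ^~ xi),
         convex_function [set: 'rV[R]_n] (F ^~ xi),
         has_gradient (F ^~ xi) (g ^~ xi)
       & lipschitz2 (g ^~ xi) (L xi)]}.
Hypothesis L_moment : ('E_P[fun xi => (L xi ^+ 2)%R] `^ 2^-1 <= L2%:E)%E.

(** The root in the hypothesis is an extended real: an infinite second moment would have an infinite
    root, and a finite one can be squared. *)
Lemma second_moment_L : (\int[P]_xi (L xi ^+ 2)%:E <= (L2 ^+ 2)%:E)%E.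
Proof.
move: L_moment; rewrite unlock.
have : (0 <= \int[P]_xi (L xi ^+ 2)%:E)%E.
  by apply: integral_ge0 => xi _; rewrite lee_fin sqr_ge0.
case: (\int[P]_xi _)%E => [r| |]//.
- rewrite poweR_EFin !lee_fin => r0 h.
  rewrite -(powRr1 r0) (_ : 1 = 2^-1 * 2%:R); last by field.
  by rewrite powRrM powR_mulrn ?powR_ge0// lerXn2r ?nnegrE ?powR_ge0 ?(ltW L2_gt0).
- by move=> _; rewrite poweRyr ?invr_eq0// leye_eq.
Qed.

(** The pointwise bound [|L| <= L^2 / (2 L2) + L2 / 2] integrates to at most [L2]. *)
Lemma intble_normL : intble P (fun xi => `|L xi|) /\ \int[P]_xi `|L xi| <= L2.
Proof.
have mL2 : measurable_fun setT (fun xi => L xi ^+ 2) by exact: measurable_funX.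
have [iL2 hL2] := intble_ge0_le mL2 (fun xi => sqr_ge0 (L xi)) second_moment_L.
have iL : intble P (fun xi => `|L xi|) by apply: intble_norm; exact: intble_of_sqr.
split => //; apply: (@le_trans _ _ (\int[P]_xi ((2 * L2)^-1 * L xi ^+ 2 + L2 / 2))).
  apply: le_Rint => //; first by apply: intbleD; [exact: intbleZ|exact: intble_cst].
  move=> xi; rewrite -(ler_pM2l (_ : 0 < 2 * L2)) ?mulr_gt0//.
  rewrite mulrDr mulrA divff ?mul1r ?mulf_neq0 ?pnatr_eq0 ?gt_eqF//.
  by rewrite -(real_normK (num_real (L xi))); have := sqr_ge0 (`|L xi| - L2); lra.
rewrite RintD; [|exact: intbleZ|exact: intble_cst].
rewrite Rint_cst RintZ//.
have : (2 * L2)^-1 * \int[P]_xi (L xi ^+ 2) <= (2 * L2)^-1 * L2 ^+ 2.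
  by rewrite ler_wpM2l// invr_ge0 mulr_ge0// ltW.
have -> : (2 * L2)^-1 * L2 ^+ 2 = L2 / 2 by field; rewrite gt_eqF.
lra.
Qed.

Lemma measurable_g x : measurable_fun setT (g x).
Proof.
have : measurable_fun setT (fun xi : X => (x, xi)).
  by apply: measurable_fun_pair; [exact: measurable_cst|exact: measurable_id].
exact: (measurableT_comp g_measurable).
Qed.

Let measurable_dotg x v : measurable_fun setT (fun xi => dot (g x xi) v).
Proof. by apply: measurable_dot; [exact: measurable_g|exact: measurable_cst]. Qed.

Lemma F_smooth_ae x y : {ae P, forall xi,
  0 <= F y xi - F x xi - dot (g x xi) (y - x) <= `|L xi| * dot (y - x) (y - x)}.
Proof.
apply: filterS F_convex_smooth => xi [_ cF gF lF].
have /andP[h1 h2] := convex_smooth_le x y cF gF lF.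
rewrite h1/=; apply: le_trans h2 _.
by rewrite ler_wpM2r ?dotxx_ge0 ?ler_norm.
Qed.

Lemma intble_dotg x v : intble P (fun xi => dot (g x xi) v).
Proof.
have [iL _] := intble_normL.
apply: (@intble_ae_le _ _ _ _ _ (fun xi => `|F (x + v) xi| + `|F x xi| + `|L xi| * dot v v)) => //.
  have := F_smooth_ae x (x + v); rewrite addrAC subrr add0r.
  apply: filterS => xi /andP[h1 h2].
  have := ler_norm (F (x + v) xi); have := ler_norm (- F (x + v) xi).
  have := ler_norm (F x xi); have := ler_norm (- F x xi); rewrite !normrN.
  have : 0 <= `|L xi| * dot v v by rewrite mulr_ge0// dotxx_ge0.
  by rewrite ler_norml => *; apply/andP; split; lra.
apply: intbleD; first by apply: intbleD; apply: intble_norm; exact: F_integrable.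
by under eq_fun do rewrite mulrC; exact: intbleZ.
Qed.

Local Notation f := (objective P F).

Lemma objectiveE x : f x = \int[P]_xi F x xi.
Proof. by rewrite /objective unlock. Qed.

Let meang x : 'rV[R]_n := \row_i \int[P]_xi (dot (g x xi) (delta_mx ord0 i)).

Let Rint_dotg x v : \int[P]_xi dot (g x xi) v = dot (meang x) v.
Proof.
rewrite /dot -/(dot _ _).
transitivity (\int[P]_xi (\sum_i v ord0 i * dot (g x xi) (delta_mx ord0 i))).
  by apply: eq_Rintegral => xi _; apply: eq_bigr => i _; rewrite dot_delta mulrC.
rewrite Rint_sum; last by move=> i; apply: intbleZ; exact: intble_dotg.
by apply: eq_bigr => i _; rewrite RintZ ?mxE 1?mulrC//; exact: intble_dotg.
Qed.

(** The quadratic bounds of almost every [F (., xi)] are integrated, with [E |L| <= L2]. Holding for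
    all [v], they single out the mean of [g] as the gradient of [f]. *)
Let objective_taylor x v :
  0 <= f (x + v) - f x - dot (meang x) v <= L2 * dot v v.
Proof.
have [iL hL] := intble_normL.
have iF y : intble P (F y) by exact: F_integrable.
have id1 : intble P (fun xi => F (x + v) xi - F x xi) by exact: intbleB.
have id2 : intble P (fun xi => F (x + v) xi - F x xi - dot (g x xi) v).
  by apply: intbleB => //; exact: intble_dotg.
rewrite !objectiveE -Rint_dotg -RintB// -RintB//; last exact: intble_dotg.
have := F_smooth_ae x (x + v); rewrite addrAC subrr add0r => hae.
apply/andP; split.
  rewrite -(Rint_cst P 0).
  apply: le_Rint_ae => //; first exact: intble_cst.
  by apply: filterS hae => xi /andP[].
apply: (@le_trans _ _ (\int[P]_xi (dot v v * `|L xi|))).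
  apply: le_Rint_ae => //; first exact: intbleZ.
  by apply: filterS hae => xi /andP[_ h]; rewrite mulrC.
by rewrite RintZ// mulrC ler_wpM2r ?dotxx_ge0.
Qed.

Let objective_grad x : differentiable f x /\ grad f x = meang x.
Proof.
apply: (@grad_of_quadratic _ _ _ _ _ L2) => v.
by have /andP[h1 h2] := objective_taylor x v; rewrite ger0_norm.
Qed.

Lemma differentiable_objective x : differentiable f x.
Proof. by have [] := objective_grad x. Qed.

Lemma Rint_dot_gradient x v : \int[P]_xi dot (g x xi) v = dot (grad f x) v.
Proof. by have [_ ->] := objective_grad x; exact: Rint_dotg. Qed.

Lemma objective_smooth x y :
  0 <= f y - f x - dot (grad f x) (y - x) <= L2 * dot (y - x) (y - x).
Proof.
have [_ ->] := objective_grad x; have := objective_taylor x (y - x).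
by rewrite [x + _]addrC subrK.
Qed.

(** The difference [s] of the gradients is paired with itself: [|s|^2] is the mean of
    [<g x - g y, s>], at most [E |L|] times [|x - y| |s|]. *)
Lemma lipschitz_grad_objective : lipschitz2 (grad f) L2.
Proof.
move=> x y; set s := grad f x - grad f y.
have [iL hL] := intble_normL.
have h : dot s s <= L2 * norm2 (x - y) * norm2 s.
  have -> : dot s s = \int[P]_xi dot (g x xi) s - \int[P]_xi dot (g y xi) s.
    by rewrite (Rint_dot_gradient x s) (Rint_dot_gradient y s); exact: dotBl.
  rewrite -RintB; [|exact: intble_dotg|exact: intble_dotg].
  apply: (@le_trans _ _ (\int[P]_xi (norm2 (x - y) * norm2 s * `|L xi|))).
    apply: le_Rint_ae; [by apply: intbleB; exact: intble_dotg|exact: intbleZ|].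
    apply: filterS F_convex_smooth => xi [_ _ _ lF]; rewrite -dotBl.
    apply: le_trans (dot_le_norm2 _ _) _; rewrite mulrAC ler_wpM2r ?norm2_ge0//.
    apply: le_trans (lF x y) _; rewrite mulrC ler_wpM2l ?norm2_ge0 ?ler_norm//.
  rewrite RintZ// mulrC -mulrA ler_wpM2r// mulr_ge0 ?norm2_ge0//.
have [->|s0] := eqVneq (norm2 s) 0; first by rewrite mulr_ge0 ?norm2_ge0 ?ltW.
have sp : 0 < norm2 s by rewrite lt_def s0 norm2_ge0.
by rewrite -norm2_sqr expr2 ler_pM2r in h.
Qed.

Lemma continuous_objective : continuous f.
Proof. by move=> x; exact: differentiable_continuous (differentiable_objective x). Qed.

Lemma measurable_objective : measurable_fun setT f.
Proof. exact: continuous_measurable_row continuous_objective. Qed.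

Lemma measurable_grad_objective : measurable_fun setT (grad f).
Proof. exact: measurable_grad continuous_objective differentiable_objective. Qed.

Lemma grad_minimizer xs : minimizer f xs -> grad f xs = 0.
Proof.
move=> xmin; apply/dotxx_eq0/eqP; rewrite eq_le dotxx_ge0 andbT.
have ge0 v : 0 <= dot (grad f xs) v.
  apply: (cvgr_to_ge (@difference_quotient_cvg _ _ f xs v (differentiable_objective xs))).
  near=> k; rewrite mulr_ge0 ?invr_ge0 ?(ltW (harmonic_gt0 _))// subr_ge0; exact: xmin.
by have := ge0 (- grad f xs); rewrite dotNr oppr_ge0.
Unshelve. all: by end_near. Qed.

End objective.

(** * Expectations over a direction independent of the state *)

Section sphere_independence.
Context {R : realType} {n : nat} {dO dT : measure_display} {O : measurableType dO}
  {T : measurableType dT}.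
Variables (Pr : probability O R) (mu : probability 'rV[R]_n R).
Hypothesis mu_unif : uniform_on_sphere mu.
Variables (Y : O -> T) (e : O -> 'rV[R]_n).
Hypotheses (mY : measurable_fun setT Y) (me : measurable_fun setT e).
Hypothesis e_sphere : forall w, sphere2 (e w).
Hypothesis Ye : indep_of_law Pr mu Y e.

(** The law of [e] is known through [indep_of_law], so the lemma on conditional means is applied to
    the centred function [h - E h]. *)
Lemma Rint_sphere_law (h : 'rV[R]_n -> R) (c : R) : measurable_fun setT h ->
  (forall x, sphere2 x -> `|h x| <= c) ->
  intble Pr (fun w => h (e w)) /\ \int[Pr]_w h (e w) = \int[mu]_x h x.
Proof.
move=> mh hc; have ih := intble_sphere mu_unif mh hc.
have ie : intble Pr (fun w => h (e w)).
  apply: (@intble_le _ _ _ _ _ (cst c)); last exact: intble_cst.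
    exact: (measurableT_comp mh).
  by move=> w; exact: hc.
split => //; apply/eqP; rewrite -subr_eq0 -(Rint_cst Pr (\int[mu]_x h x)) -RintB//; last exact: intble_cst.
apply/eqP; apply: (@indep_Rint_eq0 _ _ _ _ _ _ _ Pr mu Y e mY me Ye
  (fun yx => h yx.2 - \int[mu]_x h x)).
- by apply: measurable_funB; [exact: (measurableT_comp mh)|exact: measurable_cst].
- by apply: intbleB => //; exact: intble_cst.
- move=> w; split; first by apply: intbleB => //; exact: intble_cst.
  by rewrite RintB ?Rint_cst ?subrr//; exact: intble_cst.
Qed.

Lemma dot_sphere_sqr_le (G x : 'rV[R]_n) : sphere2 x -> dot G x ^+ 2 <= dot G G.
Proof. by move=> sx; have := dot_sqr_le G x; rewrite (sphere_dot sx) mulr1. Qed.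

Variables (G H : T -> 'rV[R]_n).
Hypotheses (mG : measurable_fun setT G) (mH : measurable_fun setT H).
Hypothesis iG : intble Pr (fun w => dot (G (Y w)) (G (Y w))).
Hypothesis iH : intble Pr (fun w => dot (H (Y w)) (H (Y w))).
Variables (Psi : 'rV[R]_n -> R) (c : R).
Hypotheses (mPsi : measurable_fun setT Psi) (symPsi : coord_symmetric Psi).
Hypothesis Psi_bound : forall x, sphere2 x -> `|Psi x| <= c.

Lemma intble_dot2 :
  intble Pr (fun w => dot (G (Y w)) (e w) * dot (H (Y w)) (e w) * Psi (e w)).
Proof.
have mGY : measurable_fun setT (fun w => G (Y w)) by exact: (measurableT_comp mG).
have mHY : measurable_fun setT (fun w => H (Y w)) by exact: (measurableT_comp mH).
apply: (@intble_le _ _ _ _ _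
   (fun w => c * (dot (G (Y w)) (G (Y w)) + dot (H (Y w)) (H (Y w))))); last first.
  by apply: intbleZ; exact: intbleD.
- move=> w; rewrite normrM mulrC; apply: ler_pM => //; first exact: Psi_bound.
  have := dot_sphere_sqr_le (G (Y w)) (e_sphere w).
  have := dot_sphere_sqr_le (H (Y w)) (e_sphere w).
  rewrite -(real_normK (num_real (dot (G _) _))) -(real_normK (num_real (dot (H _) _))) normrM.
  have := sqr_ge0 (`|dot (G (Y w)) (e w)| - `|dot (H (Y w)) (e w)|).
  have := sqr_ge0 `|dot (G (Y w)) (e w)|; have := sqr_ge0 `|dot (H (Y w)) (e w)|.
  lra.
- apply: measurable_funM; last exact: (measurableT_comp mPsi).
  by apply: measurable_funM; exact: measurable_dot.
Qed.

Lemma intble_dotGH : intble Pr (fun w => dot (G (Y w)) (H (Y w))).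
Proof.
have mGY : measurable_fun setT (fun w => G (Y w)) by exact: (measurableT_comp mG).
have mHY : measurable_fun setT (fun w => H (Y w)) by exact: (measurableT_comp mH).
apply: (@intble_le _ _ _ _ _
   (fun w => dot (G (Y w)) (G (Y w)) + dot (H (Y w)) (H (Y w)))); last exact: intbleD.
- exact: measurable_dot.
- move=> w; rewrite ler_norml; apply/andP; split.
    have := dotxx_ge0 (G (Y w) + H (Y w)); rewrite dotDl !dotDr (dotC (H _) (G _)).
    have := dotxx_ge0 (G (Y w)); have := dotxx_ge0 (H (Y w)); lra.
  have := dotxx_ge0 (G (Y w) - H (Y w)); rewrite dotBl !dotBr (dotC (H _) (G _)).
  have := dotxx_ge0 (G (Y w)); have := dotxx_ge0 (H (Y w)); lra.
Qed.

(** Given [Y], the moment identity of the sphere applies to the fixed vectors [G (Y w)] and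
    [H (Y w)]; subtracting its right-hand side leaves a function of conditional mean zero. *)
Lemma Rint_dot2_indep :
  \int[Pr]_w (dot (G (Y w)) (e w) * dot (H (Y w)) (e w) * Psi (e w)) =
  (\int[mu]_x Psi x) / n%:R * \int[Pr]_w dot (G (Y w)) (H (Y w)).
Proof.
apply/eqP; rewrite -subr_eq0 -RintZ; last exact: intble_dotGH.
rewrite -RintB; [|exact: intble_dot2|by apply: intbleZ; exact: intble_dotGH].
have mPe := intble_sphere mu_unif mPsi Psi_bound.
apply/eqP; apply: (@indep_Rint_eq0 _ _ _ _ _ _ _ Pr mu Y e mY me Ye
  (fun yx => dot (G yx.1) yx.2 * dot (H yx.1) yx.2 * Psi yx.2 -
    (\int[mu]_x Psi x) / n%:R * dot (G yx.1) (H yx.1))).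
- have m1 : measurable_fun setT (fun yx : T * 'rV[R]_n => G yx.1).
    exact: (measurableT_comp mG).
  have m2 : measurable_fun setT (fun yx : T * 'rV[R]_n => H yx.1).
    exact: (measurableT_comp mH).
  apply: measurable_funB.
    apply: measurable_funM; last exact: (measurableT_comp mPsi).
    by apply: measurable_funM; exact: measurable_dot.
  by apply: measurable_funM; [exact: measurable_cst|exact: measurable_dot].
- by apply: intbleB; [exact: intble_dot2|apply: intbleZ; exact: intble_dotGH].
- move=> w /=.
  have i1 : intble mu (fun x => dot (G (Y w)) x * dot (H (Y w)) x * Psi x).
    apply: (@intble_sphere _ _ _ mu_unif _ ((dot (G (Y w)) (G (Y w)) + dot (H (Y w)) (H (Y w))) * c)).
      apply: measurable_funM => //.
      by apply: measurable_funM; apply: measurable_dot => //; exact: measurable_cst || exact: measurable_id.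
    move=> x sx; rewrite normrM; apply: ler_pM => //; last exact: Psi_bound.
    have := dot_sphere_sqr_le (G (Y w)) sx; have := dot_sphere_sqr_le (H (Y w)) sx.
    rewrite -(real_normK (num_real (dot (G _) _))) -(real_normK (num_real (dot (H _) _))) normrM.
    have := sqr_ge0 (`|dot (G (Y w)) x| - `|dot (H (Y w)) x|).
    have := sqr_ge0 `|dot (G (Y w)) x|; have := sqr_ge0 `|dot (H (Y w)) x|.
    lra.
  split; first by apply: intbleB => //; exact: intble_cst.
  rewrite RintB//; last exact: intble_cst.
  rewrite Rint_cst /= (Rint_dot2_sym mu_unif mPsi Psi_bound symPsi); ring.
Qed.

End sphere_independence.

(** * One step along a fixed realization *)

Section pathwise_step.
Context {R : realType} {n : nat}.
Implicit Types (x y z e xs : 'rV[R]_n).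

(** [C] weighs the new function value and [al] is the mirror step size; the relation for [C *: x]
    couples the two sequences. On the right, the difference in the first term and the product
    [s * q] will have mean zero, and what remains are squares with constant or symmetric weights. *)
Lemma step_pathwise (f : 'rV[R]_n -> R) (gf : 'rV[R]_n -> 'rV[R]_n)
    (L2 al C N rho w V V' s th lam : R) x y z e xs :
  (forall x y, 0 <= f y - f x - dot (gf x) (y - x) <= L2 * dot (y - x) (y - x)) ->
  0 < L2 -> 0 < rho -> 0 < lam -> 0 <= N -> 0 <= al -> al <= C -> 0 <= w -> dot e e = 1 ->
  C *: x = al *: z + (C - al) *: y ->
  let u := dot (gf x) e in
  let q := dot e (z - xs) in
  let gam := u + s + th in
  al * N * (gam * q) <= C / L2 * (gam ^+ 2 * w / (96 * rho)) + V - V' ->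
  C * f (x - (2 * L2)^-1 *: (gam *: e)) + V' - (C - al) * f y - al * f xs - V <=
  al * (dot (gf x) (z - xs) - N * (u * q)) - al * N * (s * q)
  + al * N * (lam / 2 * th ^+ 2 + q ^+ 2 / (2 * lam))
  + C / L2 * (u ^+ 2 * (w / (48 * rho) - 4^-1)
    + 2 * (s ^+ 2 * (w / (48 * rho) + 4^-1)) + 2 * (th ^+ 2 * (w / (48 * rho) + 4^-1))).
Proof.
move=> fsm L20 rho0 lam0 N0 al0 alC w0 e1 Cx u q gam mirror_ineq.
have C0 : 0 <= C := le_trans al0 alC.
have K0 : 0 <= C / L2 by rewrite divr_ge0 // ltW.
have wr0 : 0 <= w / (48 * rho) by rewrite divr_ge0 // mulr_ge0 // ltW.
(* The gradient step: as [dot e e = 1], the quadratic bound gives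
   [L2 (gam / (2 L2))^2 - gam u / (2 L2)]. *)
have D1 : C * f (x - (2 * L2)^-1 *: (gam *: e)) <=
    C * f x + C / L2 * (gam ^+ 2 / 4 - gam * u / 2).
  have /andP[_ h] := fsm x (x - (2 * L2)^-1 *: (gam *: e)).
  have e0 : x - (2 * L2)^-1 *: (gam *: e) - x = - ((2 * L2)^-1 *: (gam *: e)).
    by rewrite addrAC subrr add0r.
  rewrite e0 !dotNr dotNl opprK !dotZr !dotZl e1 -/u mulr1 in h.
  have h' : f (x - (2 * L2)^-1 *: (gam *: e)) <=
      f x + L2^-1 * (gam ^+ 2 / 4 - gam * u / 2).
    rewrite (_ : L2^-1 * _ = L2 * ((2 * L2)^-1 * ((2 * L2)^-1 * (gam * gam))) - (2 * L2)^-1 * (gam * u)).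
      by lra.
    by field; rewrite gt_eqF.
  apply: le_trans (ler_wpM2l C0 h') _; rewrite mulrDr mulrA lexx //.
(* Convexity towards [y] and towards [xs], with weights [C - al] and [al]; the coupling turns the
   weighted sum of [x - y] and [x - xs] into [al *: (z - xs)]. *)
have D2 : C * f x - (C - al) * f y - al * f xs <= al * dot (gf x) (z - xs).
  have /andP[h1 _] := fsm x y; have /andP[h2 _] := fsm x xs.
  have -> : al * dot (gf x) (z - xs) = (C - al) * dot (gf x) (x - y) + al * dot (gf x) (x - xs).
    rewrite -!dotZr -dotDr; congr (dot _ _).
    rewrite !scalerBr addrA; congr (_ - _); rewrite addrAC -scalerDl subrK Cx.
    by rewrite addrK.
  have e2 : dot (gf x) (y - x) = - dot (gf x) (x - y) by rewrite -dotNr opprB.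
  have e3 : dot (gf x) (xs - x) = - dot (gf x) (x - xs) by rewrite -dotNr opprB.
  rewrite e2 in h1; rewrite e3 in h2.
  have := ler_wpM2l (_ : 0 <= C - al) h1; rewrite subr_ge0 => /(_ alC).
  have := ler_wpM2l al0 h2; lra.
have D3 : - (th * q) <= lam / 2 * th ^+ 2 + q ^+ 2 / (2 * lam).
  rewrite -subr_ge0.
  have -> : lam / 2 * th ^+ 2 + q ^+ 2 / (2 * lam) - - (th * q) =
      (lam * th + q) ^+ 2 / (2 * lam) by field; rewrite gt_eqF.
  by rewrite divr_ge0 ?sqr_ge0 // mulr_ge0 // ltW.
have D3' := ler_wpM2l (mulr_ge0 al0 N0) D3.
have om2 : (s + th) ^+ 2 <= 2 * s ^+ 2 + 2 * th ^+ 2 by have := sqr_ge0 (s - th); lra.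
(* The factor 2 spent on separating [u] from [s + th] turns the 96 of the mirror step into 48. *)
have D4 : gam ^+ 2 * w / (96 * rho) <= (u ^+ 2 + (s + th) ^+ 2) * (w / (48 * rho)).
  have -> : gam ^+ 2 * w / (96 * rho) = (gam ^+ 2 / 2) * (w / (48 * rho)).
    by field; rewrite gt_eqF.
  by rewrite ler_wpM2r // /gam; have := sqr_ge0 (u - (s + th)); lra.
have D5 := ler_wpM2r (addr_ge0 wr0 (_ : 0 <= 4^-1)) om2.
have D6 : C / L2 * (gam ^+ 2 / 4 - gam * u / 2 + gam ^+ 2 * w / (96 * rho)) <=
    C / L2 * (u ^+ 2 * (w / (48 * rho) - 4^-1)
    + 2 * (s ^+ 2 * (w / (48 * rho) + 4^-1)) + 2 * (th ^+ 2 * (w / (48 * rho) + 4^-1))).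
  rewrite ler_wpM2l //.
  have -> : gam ^+ 2 / 4 - gam * u / 2 = ((s + th) ^+ 2 - u ^+ 2) / 4.
    by rewrite /gam; field.
  have := D5 _; rewrite invr_ge0 ler0n => /(_ isT); lra.
have gq : al * N * (gam * q) = al * N * (u * q) + al * N * (s * q) + al * N * (th * q).
  by rewrite /gam; ring.
rewrite mulrDr in D6.
lra.
Qed.

End pathwise_step.

(** * Noise of the batch, and one step in expectation *)

Section batch_noise.
Context {R : realType} {n m : nat} {dX dO : measure_display} {X : measurableType dX}
  {O : measurableType dO}.
Variables (P : probability X R) (F : 'rV[R]_n -> X -> R)
  (g : 'rV[R]_n -> X -> 'rV[R]_n) (L : X -> R) (L2 sigma : R).
Hypothesis L2_gt0 : 0 < L2.
Hypothesis F_integrable : forall x, P.-integrable setT (EFin \o F x).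
Hypothesis g_measurable : measurable_fun setT (fun u : 'rV[R]_n * X => g u.1 u.2).
Hypothesis L_measurable : measurable_fun setT L.
Hypothesis F_convex_smooth : {ae P, forall xi,
     [/\ closed_function (F ^~ xi),
         convex_function [set: 'rV[R]_n] (F ^~ xi),
         has_gradient (F ^~ xi) (g ^~ xi)
       & lipschitz2 (g ^~ xi) (L xi)]}.
Hypothesis L_moment : ('E_P[fun xi => (L xi ^+ 2)%R] `^ 2^-1 <= L2%:E)%E.
Hypothesis g_variance : forall x,
     ('E_P[fun xi => (norm2 (g x xi - grad (objective P F) x) ^+ 2)%R]
        <= (sigma ^+ 2)%:E)%E.
Variables (zeta eta : 'rV[R]_n -> X -> 'rV[R]_n -> R) (Delta_zeta Delta_eta : R).
Hypothesis zeta_measurable : measurable_fun setT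
     (fun u : 'rV[R]_n * X * 'rV[R]_n => zeta u.1.1 u.1.2 u.2).
Hypothesis eta_measurable : measurable_fun setT
     (fun u : 'rV[R]_n * X * 'rV[R]_n => eta u.1.1 u.1.2 u.2).
Hypothesis zeta_bound : forall x e, sphere2 e ->
     ('E_P[fun xi => (zeta x xi e ^+ 2)%R] <= Delta_zeta%:E)%E.
Hypothesis eta_bound : forall x e, sphere2 e ->
     {ae P, forall xi, `|eta x xi e| <= Delta_eta}.

Local Notation f := (objective P F).
Local Notation gf := (grad (objective P F)).

(** An upper bound for the second moment of [zeta + eta]. It exceeds
    [(sqrt Delta_zeta + Delta_eta) ^ 2] by one [Delta_eta ^ 2], the price of the scale chosen in
    Young's inequality. *)
Definition noise_level : R :=
  Delta_zeta + 2 * Num.sqrt Delta_zeta * Delta_eta + 2 * Delta_eta ^+ 2.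

Hypothesis n_gt0 : (0 < n)%N.

Lemma sphere2_inhabited : exists e : 'rV[R]_n, sphere2 e.
Proof.
exists (delta_mx ord0 (Ordinal n_gt0)).
by rewrite /sphere2 /= /norm2 dot_delta mxE !eqxx sqrtr1.
Qed.

Lemma Delta_zeta_ge0 : 0 <= Delta_zeta.
Proof.
have [e se] := sphere2_inhabited; have := zeta_bound 0 se; rewrite unlock => h.
rewrite -lee_fin; apply: le_trans h; apply: integral_ge0 => x _.
by rewrite lee_fin sqr_ge0.
Qed.

Lemma Delta_eta_ge0 : 0 <= Delta_eta.
Proof.
have [e se] := sphere2_inhabited; have h := eta_bound 0 se.
rewrite -(Rint_cst P 0) -(Rint_cst P Delta_eta); apply: le_Rint_ae; try exact: intble_cst.
by apply: filterS h => xi; exact: le_trans.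
Qed.

Lemma measurable_noise_fst (h : 'rV[R]_n -> X -> 'rV[R]_n -> R) x e :
  measurable_fun setT (fun u : 'rV[R]_n * X * 'rV[R]_n => h u.1.1 u.1.2 u.2) ->
  measurable_fun setT (fun xi => h x xi e).
Proof.
move=> mh; have : measurable_fun setT (fun xi : X => ((x, xi), e)).
  apply: measurable_fun_pair; last exact: measurable_cst.
  by apply: measurable_fun_pair; [exact: measurable_cst|exact: measurable_id].
exact: (measurableT_comp mh).
Qed.

(* Scaling Young's inequality by [sqrt Delta_zeta + Delta_eta] (with the junk value [0^-1 = 0] when both vanish) avoids the factor 2 of [(a + b)^2 <= 2 a^2 + 2 b^2], which the statement does not leave room for. *)
Lemma noise_second_moment x e : sphere2 e ->
  (\int[P]_xi ((zeta x xi e + eta x xi e) ^+ 2)%:E <= noise_level%:E)%E.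
Proof.
move=> se; have z0 := Delta_zeta_ge0; have e0 := Delta_eta_ge0.
set s := Num.sqrt Delta_zeta; have s0 : 0 <= s := sqrtr_ge0 _.
have s2 : s ^+ 2 = Delta_zeta by rewrite sqr_sqrtr.
pose k := s + Delta_eta.
have mz := measurable_noise_fst x e zeta_measurable.
have mn := measurable_noise_fst x e eta_measurable.
have mz2 : measurable_fun setT (fun xi => zeta x xi e ^+ 2) by exact: measurable_funX.
have hz : (\int[P]_xi (zeta x xi e ^+ 2)%:E <= Delta_zeta%:E)%E.
  by have := zeta_bound x se; rewrite unlock.
have [iz hz2] := intble_ge0_le mz2 (fun xi => sqr_ge0 _) hz.
have ms : measurable_fun setT (fun xi => (zeta x xi e + eta x xi e) ^+ 2).
  by apply: measurable_funX; exact: measurable_funD.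
pose b xi := (1 + Delta_eta / k) * zeta x xi e ^+ 2 + (k * Delta_eta + Delta_eta ^+ 2).
have ib : intble P b by apply: intbleD; [exact: intbleZ|exact: intble_cst].
have hae : {ae P, forall xi, (zeta x xi e + eta x xi e) ^+ 2 <= b xi}.
  apply: filterS (eta_bound x se) => xi he; rewrite /b.
  set a := zeta x xi e; set c := eta x xi e in he *.
  have c2 : c ^+ 2 <= Delta_eta ^+ 2.
    by rewrite -(real_normK (num_real c)) lerXn2r ?nnegrE.
  have ac : a * c <= `|a| * Delta_eta.
    by apply: le_trans (ler_norm _) _; rewrite normrM ler_wpM2l.
  have a2 := real_normK (num_real a).
  have : 2 * `|a| * Delta_eta <= Delta_eta / k * a ^+ 2 + k * Delta_eta.
    have [k0|k0] := eqVneq k 0.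
      have -> : Delta_eta = 0 by move: k0; rewrite /k; lra.
      by rewrite k0 !mulr0 !mul0r addr0.
    have kp : 0 < k by rewrite lt_def k0 addr_ge0.
    have -> : Delta_eta / k * a ^+ 2 + k * Delta_eta =
        2 * `|a| * Delta_eta + Delta_eta / k * (`|a| - k) ^+ 2.
      by rewrite -a2; field.
    by rewrite lerDl mulr_ge0 ?sqr_ge0 ?divr_ge0 ?(ltW kp).
  by rewrite sqrrD -mulr_natl; lra.
have is2 : intble P (fun xi => (zeta x xi e + eta x xi e) ^+ 2).
  apply: intble_ae_le ib => //; apply: filterS hae => xi.
  by rewrite ger0_norm ?sqr_ge0.
rewrite (integral_Rint is2) lee_fin; apply: le_trans (le_Rint_ae is2 ib hae) _.
rewrite RintD; [|exact: intbleZ|exact: intble_cst].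
rewrite Rint_cst RintZ//.
have dk : 0 <= Delta_eta / k by rewrite divr_ge0// addr_ge0.
have : (1 + Delta_eta / k) * \int[P]_xi (zeta x xi e ^+ 2) <= (1 + Delta_eta / k) * s ^+ 2.
  by rewrite ler_wpM2l ?addr_ge0// s2.
have : Delta_eta / k * s ^+ 2 <= Delta_eta * s.
  rewrite -mulrA ler_wpM2l// expr2 mulrA ler_piMl//.
  have [k0|k0] := eqVneq k 0; first by rewrite k0 invr0 mul0r.
  have kp : 0 < k by rewrite lt_def k0 addr_ge0.
  by rewrite ler_pdivrMl// mulr1 lerDl.
rewrite /noise_level -/s -s2 /k; lra.
Qed.

Lemma noise_level_ge0 : 0 <= noise_level.
Proof.
rewrite /noise_level; have := Delta_zeta_ge0; have := Delta_eta_ge0 => e0 z0.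
by rewrite !addr_ge0// !mulr_ge0// sqrtr_ge0.
Qed.

Section one_step.
Variables (Pr : probability O R) (mu : probability 'rV[R]_n R).
Hypothesis mu_unif : uniform_on_sphere mu.
Hypothesis m_gt0 : (0 < m)%N.
Variables (x z e : O -> 'rV[R]_n) (xi : 'I_m -> O -> X) (xs : 'rV[R]_n).
Hypotheses (mx : measurable_fun setT x) (mz : measurable_fun setT z)
  (me : measurable_fun setT e) (mxi : forall i, measurable_fun setT (xi i)).
Hypothesis e_sphere : forall w, sphere2 (e w).
Hypothesis indep_e : indep_of_law Pr mu (fun w => (x w, z w)) e.
Hypothesis indep_xi_e : forall i, indep_of_law Pr mu (fun w => ((x w, z w), xi i w)) e.
Hypothesis indep_xi0 : forall i, indep_of_law Pr P (fun w => (x w, z w)) (xi i).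
Hypothesis indep_xi : forall i, indep_of_law Pr P (fun w => ((x w, z w), e w)) (xi i).
Hypothesis indep_xi_xi : forall i j, i != j ->
  indep_of_law Pr P (fun w => ((x w, z w), e w, xi i w)) (xi j).
Hypothesis xs_min : minimizer f xs.
Hypothesis ix : intble Pr (fun w => dot (x w - xs) (x w - xs)).
Hypothesis iz : intble Pr (fun w => dot (z w - xs) (z w - xs)).

Definition grad_error i w : 'rV[R]_n := g (x w) (xi i w) - gf (x w).

(** Together with [batch_bias], the summands [s] and [th] of the pathwise inequality. *)
Definition batch_error w : R := m%:R^-1 * \sum_i dot (grad_error i w) (e w).

Definition batch_bias w : R :=
  m%:R^-1 * \sum_i (zeta (x w) (xi i w) (e w) + eta (x w) (xi i w) (e w)).

Let mgf : measurable_fun setT gf.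
Proof. exact: (measurable_grad_objective L2_gt0 F_integrable g_measurable L_measurable F_convex_smooth L_moment). Qed.

Let mstate : measurable_fun setT (fun w => (x w, z w)).
Proof. exact: measurable_fun_pair. Qed.

Lemma grad_sqr_le y : dot (gf y) (gf y) <= L2 ^+ 2 * dot (y - xs) (y - xs).
Proof.
have lg := lipschitz_grad_objective L2_gt0 F_integrable g_measurable L_measurable F_convex_smooth L_moment.
have g0 := grad_minimizer L2_gt0 F_integrable g_measurable L_measurable F_convex_smooth L_moment xs_min.
have := lg y xs; rewrite g0 subr0 => h.
rewrite -!norm2_sqr -exprMn lerXn2r ?nnegrE ?norm2_ge0//.
by rewrite mulr_ge0 ?norm2_ge0 ?ltW.
Qed.

Lemma intble_grad_sqr : intble Pr (fun w => dot (gf (x w)) (gf (x w))).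
Proof.
have mgx : measurable_fun setT (fun w => gf (x w)) by exact: (measurableT_comp mgf).
apply: (@intble_le _ _ _ _ _ (fun w => L2 ^+ 2 * dot (x w - xs) (x w - xs))).
- exact: measurable_dot.
- by move=> w; rewrite (ger0_norm (dotxx_ge0 _)); exact: grad_sqr_le.
- exact: intbleZ.
Qed.

Let mgxi i : measurable_fun setT (fun w => g (x w) (xi i w)).
Proof.
have : measurable_fun setT (fun w => (x w, xi i w)) by exact: measurable_fun_pair.
exact: (measurableT_comp g_measurable).
Qed.

Lemma measurable_grad_error i : measurable_fun setT (grad_error i).
Proof.
apply: measurable_rowB; first exact: mgxi.
exact: (measurableT_comp mgf mx).
Qed.

Let mge_pair : measurable_fun setT
  (fun u : ('rV[R]_n * 'rV[R]_n) * X => g u.1.1 u.2 - gf u.1.1).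
Proof.
have m1 : measurable_fun setT (fun u : ('rV[R]_n * 'rV[R]_n) * X => u.1.1).
  exact: (measurableT_comp measurable_fst measurable_fst).
apply: measurable_rowB; last exact: (measurableT_comp mgf m1).
exact: (measurableT_comp g_measurable (measurable_fun_pair m1 measurable_snd)).
Qed.

Lemma grad_error_second_moment i :
  intble Pr (fun w => dot (grad_error i w) (grad_error i w)) /\
  \int[Pr]_w dot (grad_error i w) (grad_error i w) <= sigma ^+ 2.
Proof.
have := @indep_Rint_le _ _ _ _ _ _ _ Pr P (fun w => (x w, z w)) (xi i) mstate (mxi i)
  (indep_xi0 i) (fun u => dot (g u.1.1 u.2 - gf u.1.1) (g u.1.1 u.2 - gf u.1.1)) (cst (sigma ^+ 2)).
rewrite /= (Rint_cst Pr); apply.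
- exact: measurable_dot.
- by move=> u; exact: dotxx_ge0.
- exact: intble_cst.
- move=> w /=; have := g_variance (x w); rewrite unlock.
  by under eq_integral do rewrite norm2_sqr.
Qed.

Section weighted.
Variables (Psi : 'rV[R]_n -> R) (c : R).
Hypotheses (mPsi : measurable_fun setT Psi) (symPsi : coord_symmetric Psi).
Hypothesis Psi_bound : forall x, sphere2 x -> `|Psi x| <= c.
Hypothesis Psi_ge0 : forall x, 0 <= Psi x.

Let mPsie : measurable_fun setT (fun w => Psi (e w)).
Proof. exact: (measurableT_comp mPsi). Qed.

Let intble_prod i j : intble Pr (fun w =>
  dot (grad_error i w) (e w) * dot (grad_error j w) (e w) * Psi (e w)).
Proof.
have [ii _] := grad_error_second_moment i; have [ij _] := grad_error_second_moment j.
apply: (@intble_le _ _ _ _ _ (fun w => c * (dot (grad_error i w) (grad_error i w) +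
   dot (grad_error j w) (grad_error j w)))); last first.
  by apply: intbleZ; exact: intbleD.
- move=> w; rewrite normrM mulrC; apply: ler_pM => //; first exact: Psi_bound.
  have := dot_sphere_sqr_le (grad_error i w) (e_sphere w).
  have := dot_sphere_sqr_le (grad_error j w) (e_sphere w).
  set a := dot (grad_error i w) (e w); set b := dot (grad_error j w) (e w).
  rewrite -(real_normK (num_real a)) -(real_normK (num_real b)) normrM.
  have := sqr_ge0 (`|a| - `|b|); have := sqr_ge0 `|a|; have := sqr_ge0 `|b|.
  lra.
- apply: measurable_funM; last exact: mPsie.
  by apply: measurable_funM; apply: (measurable_dot _ me); exact: measurable_grad_error.
Qed.

(** The direction is the fresh sample here, independent of the state and [xi i] jointly: the error
    is a fixed vector in the moment identity, which yields the factor [1 / n]. *)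
Let Rint_diag i :
  \int[Pr]_w (dot (grad_error i w) (e w) * dot (grad_error i w) (e w) * Psi (e w)) =
  (\int[mu]_x Psi x) / n%:R * \int[Pr]_w dot (grad_error i w) (grad_error i w).
Proof.
have mY : measurable_fun setT (fun w => ((x w, z w), xi i w)) := measurable_fun_pair mstate (mxi i).
have [ii _] := grad_error_second_moment i.
exact: (@Rint_dot2_indep _ _ _ _ _ _ Pr mu mu_unif _ e mY me e_sphere (indep_xi_e i)
  _ _ mge_pair mge_pair ii ii Psi c mPsi symPsi Psi_bound).
Qed.

(** Here [xi j] is the fresh sample: given the state, the direction and [xi i], its gradient error
    has mean zero. *)
Let Rint_offdiag i j : i != j ->
  \int[Pr]_w (dot (grad_error i w) (e w) * dot (grad_error j w) (e w) * Psi (e w)) = 0.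
Proof.
move=> ij; pose T := (('rV[R]_n * 'rV[R]_n) * 'rV[R]_n * X)%type.
have mY : measurable_fun setT (fun w => ((x w, z w), e w, xi i w) : T).
  exact: (measurable_fun_pair (measurable_fun_pair mstate me) (mxi i)).
have p1 : measurable_fun setT (fun u : T * X => u.1.1.1.1).
  exact: (measurableT_comp measurable_fst (measurableT_comp measurable_fst (measurableT_comp measurable_fst measurable_fst))).
have p2 : measurable_fun setT (fun u : T * X => u.1.1.2).
  exact: (measurableT_comp measurable_snd (measurableT_comp measurable_fst measurable_fst)).
have p3 : measurable_fun setT (fun u : T * X => u.1.2).
  exact: (measurableT_comp measurable_snd measurable_fst).
have p4 : measurable_fun setT (fun u : T * X => u.2) := measurable_snd.
have mg1 : measurable_fun setT (fun u : T * X => g u.1.1.1.1 u.1.2 - gf u.1.1.1.1).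
  apply: measurable_rowB; last exact: (measurableT_comp mgf p1).
  exact: (measurableT_comp g_measurable (measurable_fun_pair p1 p3)).
have mg2 : measurable_fun setT (fun u : T * X => g u.1.1.1.1 u.2 - gf u.1.1.1.1).
  apply: measurable_rowB; last exact: (measurableT_comp mgf p1).
  exact: (measurableT_comp g_measurable (measurable_fun_pair p1 p4)).
apply: (@indep_Rint_eq0 _ _ _ _ _ _ _ Pr P _ (xi j) mY (mxi j) (indep_xi_xi ij)
  (fun u => dot (g u.1.1.1.1 u.1.2 - gf u.1.1.1.1) u.1.1.2 *
            dot (g u.1.1.1.1 u.2 - gf u.1.1.1.1) u.1.1.2 * Psi u.1.1.2)).
- apply: measurable_funM; last exact: (measurableT_comp mPsi p2).
  by apply: measurable_funM; [exact: measurable_dot mg1 p2|exact: measurable_dot mg2 p2].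
- exact: intble_prod.
- move=> w /=; set a := dot _ _; pose b := a * Psi (e w).
  have id : intble P (fun v => dot (g (x w) v) (e w)).
    exact: (intble_dotg L2_gt0 F_integrable g_measurable L_measurable F_convex_smooth L_moment).
  have eqb v : a * dot (g (x w) v - gf (x w)) (e w) * Psi (e w) =
      b * (dot (g (x w) v) (e w) - dot (gf (x w)) (e w)).
    by rewrite dotBl /b; ring.
  have idB : intble P (fun v => dot (g (x w) v) (e w) - dot (gf (x w)) (e w)).
    by apply: intbleB => //; exact: intble_cst.
  split; first by under eq_fun do rewrite eqb; exact: intbleZ.
  under eq_Rintegral do rewrite eqb.
  rewrite RintZ// RintB//; last exact: intble_cst.
  rewrite Rint_cst (Rint_dot_gradient L2_gt0 F_integrable g_measurable L_measurable F_convex_smooth L_moment).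
  by rewrite subrr mulr0.
Qed.

Lemma batch_error_second_moment :
  intble Pr (fun w => batch_error w ^+ 2 * Psi (e w)) /\
  \int[Pr]_w (batch_error w ^+ 2 * Psi (e w)) <=
    (\int[mu]_x Psi x) * (sigma ^+ 2 / (n%:R * m%:R)).
Proof.
have mR : m%:R != 0 :> R by rewrite pnatr_eq0 -lt0n.
have nR : n%:R != 0 :> R by rewrite pnatr_eq0 -lt0n.
have e2 w : batch_error w ^+ 2 * Psi (e w) = m%:R^-1 ^+ 2 * \sum_i \sum_j
    (dot (grad_error i w) (e w) * dot (grad_error j w) (e w) * Psi (e w)).
  rewrite /batch_error exprMn -mulrA; congr (_ * _).
  rewrite expr2 big_distrlr /= mulr_suml; apply: eq_bigr => i _.
  by rewrite mulr_suml.
have isum : intble Pr (fun w => \sum_i \sum_j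
    (dot (grad_error i w) (e w) * dot (grad_error j w) (e w) * Psi (e w))).
  by apply: intble_sum => i; apply: intble_sum => j; exact: intble_prod.
split; first by under eq_fun do rewrite e2; exact: intbleZ.
under eq_Rintegral do rewrite e2.
rewrite RintZ// Rint_sum; last by move=> i; apply: intble_sum => j; exact: intble_prod.
have Psi0 : 0 <= \int[mu]_x Psi x by apply: Rintegral_ge0.
apply: (@le_trans _ _ (m%:R^-1 ^+ 2 * \sum_(i < m) ((\int[mu]_x Psi x) / n%:R * sigma ^+ 2))).
  rewrite ler_wpM2l ?sqr_ge0//; apply: ler_sum => i _.
  rewrite Rint_sum; last by move=> j; exact: intble_prod.
  rewrite (bigD1 i)//= big1 ?addr0 => [|j ji]; last by rewrite Rint_offdiag// eq_sym.
  rewrite Rint_diag ler_wpM2l ?divr_ge0//; exact: (grad_error_second_moment i).2.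
rewrite sumr_const card_ord -[_ *+ m]mulr_natl le_eqVlt; apply/orP; left; apply/eqP.
by field; rewrite mR nR.
Qed.

(** The oracle noise need not be centred, so averaging brings no factor [1 / m]: convexity of the
    square reduces to single samples, each bounded given the state and the direction. *)
Lemma batch_bias_second_moment :
  intble Pr (fun w => batch_bias w ^+ 2 * Psi (e w)) /\
  \int[Pr]_w (batch_bias w ^+ 2 * Psi (e w)) <= noise_level * \int[mu]_x Psi x.
Proof.
have mR : 0 < m%:R :> R by rewrite ltr0n.
pose b i w := zeta (x w) (xi i w) (e w) + eta (x w) (xi i w) (e w).
have [iPe PeE] := Rint_sphere_law mu_unif mstate me e_sphere indep_e mPsi Psi_bound.
have mY : measurable_fun setT (fun w => ((x w, z w), e w)) := measurable_fun_pair mstate me.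
have mtriple i : measurable_fun setT (fun w => ((x w, xi i w), e w)).
  exact: (measurable_fun_pair (measurable_fun_pair mx (mxi i)) me).
have mb i : measurable_fun setT (b i).
  by apply: measurable_funD; [exact: (measurableT_comp zeta_measurable (mtriple i))
    |exact: (measurableT_comp eta_measurable (mtriple i))].
have hb i : intble Pr (fun w => b i w ^+ 2 * Psi (e w)) /\
    \int[Pr]_w (b i w ^+ 2 * Psi (e w)) <= noise_level * \int[mu]_x Psi x.
  rewrite -PeE -RintZ//.
  pose T := (('rV[R]_n * 'rV[R]_n) * 'rV[R]_n)%type.
  have mt : measurable_fun setT (fun u : T * X => (u.1.1.1, u.2, u.1.2)).
    apply: measurable_fun_pair; last exact: (measurableT_comp measurable_snd measurable_fst).
    apply: measurable_fun_pair; last exact: measurable_snd.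
    exact: (measurableT_comp measurable_fst (measurableT_comp measurable_fst measurable_fst)).
  apply: (@indep_Rint_le _ _ _ _ _ _ _ Pr P _ (xi i) mY (mxi i) (indep_xi i)
    (fun u => (zeta u.1.1.1 u.2 u.1.2 + eta u.1.1.1 u.2 u.1.2) ^+ 2 * Psi u.1.2)
    (fun w => noise_level * Psi (e w))).
  - apply: measurable_funM; last first.
      exact: (measurableT_comp mPsi (measurableT_comp measurable_snd measurable_fst)).
    apply: measurable_funX; apply: measurable_funD.
      exact: (measurableT_comp zeta_measurable mt).
    exact: (measurableT_comp eta_measurable mt).
  - by move=> u; rewrite mulr_ge0// sqr_ge0.
  - exact: intbleZ.
  - move=> w /=; under eq_integral do rewrite EFinM muleC.
    rewrite ge0_integralZl//; last 3 first.
    + apply/measurable_EFinP; apply: measurable_funX; apply: measurable_funD.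
        exact: (measurable_noise_fst _ _ zeta_measurable).
      exact: (measurable_noise_fst _ _ eta_measurable).
    + by move=> v _; rewrite lee_fin sqr_ge0.
    + by rewrite lee_fin.
    rewrite muleC EFinM lee_wpmul2r ?lee_fin//.
    exact: noise_second_moment.
have mbias : measurable_fun setT batch_bias.
  apply: measurable_funM; first exact: measurable_cst.
  exact: measurable_sum.
have le2 w : batch_bias w ^+ 2 * Psi (e w) <= m%:R^-1 * \sum_i (b i w ^+ 2 * Psi (e w)).
  rewrite -mulr_suml mulrA ler_wpM2r//.
  (* The empirical variance of the [b i w] over the batch is nonnegative. *)
  have : 0 <= \sum_i (b i w - batch_bias w) ^+ 2.
    by apply: sumr_ge0 => i _; exact: sqr_ge0.
  rewrite (eq_bigr (fun i => b i w ^+ 2 + ((- 2 * batch_bias w) * b i w + batch_bias w ^+ 2)));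
    last by move=> i _; ring.
  rewrite big_split big_split/= -mulr_sumr sumr_const card_ord -[_ *+ m]mulr_natl.
  have -> : \sum_(i < m) b i w = m%:R * batch_bias w.
    by rewrite /batch_bias mulrA divff ?mul1r// gt_eqF.
  by rewrite ler_pdivlMl//; lra.
have isum : intble Pr (fun w => \sum_i (b i w ^+ 2 * Psi (e w))).
  by apply: intble_sum => i; exact: (hb i).1.
have ib : intble Pr (fun w => batch_bias w ^+ 2 * Psi (e w)).
  apply: (@intble_le _ _ _ _ _ (fun w => m%:R^-1 * \sum_i (b i w ^+ 2 * Psi (e w)))).
  - by apply: measurable_funM; [exact: measurable_funX|exact: mPsie].
  - move=> w; rewrite ger0_norm; first exact: le2.
    by rewrite mulr_ge0 ?sqr_ge0.
  - exact: intbleZ.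
split => //; apply: (@le_trans _ _ (\int[Pr]_w (m%:R^-1 * \sum_i (b i w ^+ 2 * Psi (e w))))).
  by apply: le_Rint => //; exact: intbleZ.
rewrite RintZ// Rint_sum; last by move=> i; exact: (hb i).1.
rewrite ler_pdivrMl//; apply: (@le_trans _ _ (\sum_(i < m) (noise_level * \int[mu]_x Psi x))).
  by apply: ler_sum => i _; exact: (hb i).2.
by rewrite sumr_const card_ord -[_ *+ m]mulr_natl.
Qed.

End weighted.

Section step_expectation.
Variables (y : O -> 'rV[R]_n) (tau al C rho : R) (p : R) (d : 'rV[R]_n -> R) (a : R) (k : nat).
Hypothesis my : measurable_fun setT y.
Hypothesis iy : intble Pr (fun w => dot (y w - xs) (y w - xs)).
Hypotheses (p_ge1 : 1 <= p) (p_le2 : p <= 2) (d_prox : prox_function p d).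
Hypothesis iV : intble Pr (fun w => bregman d (z w) xs).
Hypotheses (rho_gt0 : 0 < rho) (k_gt0 : (0 < k)%N) (al_gt0 : 0 < al) (alC : al <= C).
Hypothesis weight_dual : forall x v : 'rV[R]_n,
  dot x v ^+ 2 <= dual_weight a k x * normp p v ^+ 2.
Hypothesis weight_mean : \int[mu]_x dual_weight a k x <= 6 * rho.
Hypothesis xE : forall w, x w = tau *: z w + (1 - tau) *: y w.
Hypothesis C_tau : C * tau = al.
Hypothesis al_C : (al * n%:R) ^+ 2 = C / (48 * rho * L2).

Local Notation weight := (@dual_weight R n a k).
Local Notation orc := (oracle g zeta eta).

Definition step_gradient w : 'rV[R]_n := batch_gradient orc (x w) (xi ^~ w) (e w).
Definition step_y w : 'rV[R]_n := x w - (2 * L2)^-1 *: step_gradient w.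
Definition step_z w : 'rV[R]_n :=
  mirror d (grad d (z w) - (al * n%:R) *: step_gradient w).

Let slope w : R := dot (gf (x w)) (e w) + batch_error w + batch_bias w.

Let step_gradientE w : step_gradient w = slope w *: e w.
Proof.
rewrite /step_gradient /batch_gradient -scaler_suml scalerA; congr (_ *: _).
rewrite /slope /batch_error /batch_bias -addrA -mulrDr -big_split /=.
have mR : m%:R != 0 :> R by rewrite pnatr_eq0 -lt0n.
have -> : dot (gf (x w)) (e w) = m%:R^-1 * \sum_(i < m) dot (gf (x w)) (e w).
  by rewrite sumr_const card_ord -(mulr_natl (dot _ (e w))) mulrA mulVf // mul1r.
rewrite -mulrDr -big_split /=; congr (_ * _); apply: eq_bigr => i _.
by rewrite /oracle /grad_error dotBl; ring.
Qed.

Let mtriple i : measurable_fun setT (fun w => ((x w, xi i w), e w)).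
Proof. exact: (measurable_fun_pair (measurable_fun_pair mx (mxi i)) me). Qed.

Let m_error : measurable_fun setT batch_error.
Proof.
apply: measurable_funM; first exact: measurable_cst.
apply: measurable_sum => i; apply: (measurable_dot _ me); exact: measurable_grad_error.
Qed.

Let m_bias : measurable_fun setT batch_bias.
Proof.
apply: measurable_funM; first exact: measurable_cst.
apply: measurable_sum => i.
by apply: measurable_funD; [exact: (measurableT_comp zeta_measurable (mtriple i))
  |exact: (measurableT_comp eta_measurable (mtriple i))].
Qed.

Let m_u : measurable_fun setT (fun w => dot (gf (x w)) (e w)).
Proof. exact: (measurable_dot (measurableT_comp mgf mx) me). Qed.

Let mzs : measurable_fun setT (fun w => z w - xs).
Proof. exact: (measurable_rowB mz (measurable_cst _)). Qed.

Let m_q : measurable_fun setT (fun w => dot (e w) (z w - xs)).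
Proof. exact: (measurable_dot me mzs). Qed.

Let m_slope : measurable_fun setT slope.
Proof. by apply: measurable_funD => //; apply: measurable_funD. Qed.

Let m_step_gradient : measurable_fun setT step_gradient.
Proof.
rewrite (_ : step_gradient = fun w => slope w *: e w); last by apply/funext => w; rewrite step_gradientE.
exact: measurable_rowZ.
Qed.

Lemma measurable_step_y : measurable_fun setT step_y.
Proof.
apply: (measurable_rowB mx); apply: measurable_rowZ; last exact: m_step_gradient.
exact: measurable_cst.
Qed.

Lemma measurable_step_z : measurable_fun setT step_z.
Proof.
apply: (measurableT_comp (measurable_mirror p_ge1 p_le2 d_prox)).
apply: measurable_rowB; first exact: (measurableT_comp (measurable_grad_prox d_prox)).
by apply: measurable_rowZ; [exact: measurable_cst|exact: m_step_gradient].
Qed.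

Let one : 'rV[R]_n -> R := cst 1.

Let one_bound v : sphere2 v -> `|one v| <= 1.
Proof. by rewrite normr1. Qed.

(** The two weights of the pathwise inequality are the cases [b = - 4^-1] and [b = 4^-1]; since
    [6 / 48 = 8^-1], their means are at most [8^-1 + b]. *)
Let weight_shift (b : R) v : R := weight v / (48 * rho) + b.

Let m_shift b : measurable_fun setT (weight_shift b).
Proof.
apply: measurable_funD; last exact: measurable_cst.
by apply: measurable_funM; [exact: measurable_dual_weight|exact: measurable_cst].
Qed.

Let sym_shift b : coord_symmetric (weight_shift b).
Proof.
have [h1 h2] := @coord_symmetric_dual_weight R n a k.
by split => [i v|i j v]; rewrite /weight_shift ?h1 ?h2.
Qed.

Let shift_bound b v : sphere2 v -> `|weight_shift b v| <= n%:R `^ a / (48 * rho) + `|b|.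
Proof.
move=> sv; apply: le_trans (ler_normD _ _) _; rewrite lerD2r normrM normfV.
rewrite (gtr0_norm (_ : 0 < 48 * rho)) ?mulr_gt0 // ler_wpM2r ?invr_ge0 ?mulr_ge0 ?(ltW rho_gt0) //.
exact: dual_weight_sphere.
Qed.

Let Rint_shift b : \int[mu]_v weight_shift b v <= 8^-1 + b.
Proof.
have iw : intble mu weight.
  apply: (intble_sphere mu_unif (measurable_dual_weight a k)) => v.
  exact: dual_weight_sphere.
have -> : \int[mu]_v weight_shift b v = (48 * rho)^-1 * \int[mu]_v weight v + b.
  rewrite -[b in RHS](Rint_cst mu) -RintZ // -RintD //; last 2 first.
  - exact: intbleZ.
  - exact: intble_cst.
  by apply: eq_Rintegral => v _; rewrite /weight_shift mulrC.
rewrite lerD2r ler_pdivrMl ?mulr_gt0 //; apply: le_trans weight_mean _.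
by rewrite le_eqVlt; apply/orP; left; apply/eqP; field.
Qed.

Let iq2 : intble Pr (fun w => dot (e w) (z w - xs) ^+ 2).
Proof.
apply: (@intble_le _ _ _ _ _ (fun w => dot (z w - xs) (z w - xs))) => //.
- exact: measurable_funX.
- move=> w; rewrite ger0_norm ?sqr_ge0 // dotC; exact: dot_sphere_sqr_le.
Qed.

Let igrad := intble_grad_sqr.

Let mfst : measurable_fun setT (fun v : 'rV[R]_n * 'rV[R]_n => gf v.1).
Proof. exact: (measurableT_comp mgf measurable_fst). Qed.

Let msnd : measurable_fun setT (fun v : 'rV[R]_n * 'rV[R]_n => v.2 - xs).
Proof. exact: (measurable_rowB measurable_snd (measurable_cst _)). Qed.

Let sym_one : coord_symmetric one.
Proof. by []. Qed.

Let m_one : measurable_fun setT one.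
Proof. exact: measurable_cst. Qed.

Let Rint_cross : intble Pr (fun w => dot (gf (x w)) (e w) * dot (e w) (z w - xs)) /\
  \int[Pr]_w (dot (gf (x w)) (e w) * dot (e w) (z w - xs)) =
  n%:R^-1 * \int[Pr]_w dot (gf (x w)) (z w - xs).
Proof.
have h w : dot (gf (x w)) (e w) * dot (e w) (z w - xs) =
   dot (gf (x w)) (e w) * dot (z w - xs) (e w) * one (e w).
  by rewrite mulr1 [dot (e w) _]dotC.
under eq_fun do rewrite h.
split.
  exact: (@intble_dot2 _ _ _ _ _ _ Pr _ e mstate me e_sphere _ _ mfst msnd igrad iz one 1 m_one one_bound).
rewrite (@Rint_dot2_indep _ _ _ _ _ _ Pr mu mu_unif _ e mstate me e_sphere indep_e
  _ _ mfst msnd igrad iz one 1 m_one sym_one one_bound).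
by rewrite Rint_cst mul1r.
Qed.

Let Rint_q2 : \int[Pr]_w dot (e w) (z w - xs) ^+ 2 = n%:R^-1 * \int[Pr]_w dot (z w - xs) (z w - xs).
Proof.
transitivity (\int[Pr]_w (dot (z w - xs) (e w) * dot (z w - xs) (e w) * one (e w))).
  by apply: eq_Rintegral => w _; rewrite mulr1 dotC expr2.
rewrite (@Rint_dot2_indep _ _ _ _ _ _ Pr mu mu_unif _ e mstate me e_sphere indep_e
  _ _ msnd msnd iz iz one 1 m_one sym_one one_bound).
by rewrite Rint_cst mul1r.
Qed.

(** Averaging over the direction factors out the mean of the shifted weight, at most
    [1/8 - 1/4 < 0]: the gain of the gradient step covers its share of the mirror step. *)
Let Rint_u2 : intble Pr (fun w => dot (gf (x w)) (e w) ^+ 2 * weight_shift (- 4^-1) (e w)) /\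
  \int[Pr]_w (dot (gf (x w)) (e w) ^+ 2 * weight_shift (- 4^-1) (e w)) <= 0.
Proof.
under eq_fun do rewrite expr2.
split.
  exact: (@intble_dot2 _ _ _ _ _ _ Pr _ e mstate me e_sphere _ _ mfst mfst igrad igrad _ _
    (m_shift (- 4^-1)) (shift_bound (- 4^-1))).
rewrite (@Rint_dot2_indep _ _ _ _ _ _ Pr mu mu_unif _ e mstate me e_sphere indep_e
  _ _ mfst mfst igrad igrad _ _ (m_shift (- 4^-1)) (sym_shift (- 4^-1)) (shift_bound (- 4^-1))).
have : 0 <= \int[Pr]_w dot (gf (x w)) (gf (x w)) by apply: Rintegral_ge0 => w _; exact: dotxx_ge0.
have := Rint_shift (- 4^-1) => h1 h2.
by rewrite mulr_le0_ge0 // mulr_le0_ge0 ?invr_ge0 //; apply: le_trans h1 _; lra.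
Qed.

Let sq_intble (h : O -> R) : measurable_fun setT h ->
  intble Pr (fun w => h w ^+ 2 * one (e w)) -> intble Pr (fun w => h w ^+ 2).
Proof. by move=> mh; under eq_fun do rewrite mulr1. Qed.

Let ierr2 : intble Pr (fun w => batch_error w ^+ 2).
Proof.
apply: sq_intble => //.
exact: (batch_error_second_moment m_one sym_one one_bound (fun=> ler01)).1.
Qed.

Let ibias2 : intble Pr (fun w => batch_bias w ^+ 2).
Proof.
apply: sq_intble => //.
exact: (batch_bias_second_moment m_one one_bound (fun=> ler01)).1.
Qed.

Let Rint_bias2 : \int[Pr]_w batch_bias w ^+ 2 <= noise_level.
Proof.
have := (batch_bias_second_moment m_one one_bound (fun=> ler01)).2.
by rewrite Rint_cst mulr1; under eq_Rintegral do rewrite mulr1.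
Qed.

Let ierr_q : intble Pr (fun w => batch_error w * dot (e w) (z w - xs)).
Proof. exact: intble_mul. Qed.

(** Given the state and the direction, each gradient error is centred while [dot (e w) (z w - xs)]
    is fixed. *)
Let Rint_err_q : \int[Pr]_w (batch_error w * dot (e w) (z w - xs)) = 0.
Proof.
pose T := (('rV[R]_n * 'rV[R]_n) * 'rV[R]_n)%type.
have mY : measurable_fun setT (fun w => ((x w, z w), e w) : T) := measurable_fun_pair mstate me.
have p1 : measurable_fun setT (fun u : T * X => u.1.1.1).
  exact: (measurableT_comp measurable_fst (measurableT_comp measurable_fst measurable_fst)).
have p2 : measurable_fun setT (fun u : T * X => u.1.1.2).
  exact: (measurableT_comp measurable_snd (measurableT_comp measurable_fst measurable_fst)).
have p3 : measurable_fun setT (fun u : T * X => u.1.2).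
  exact: (measurableT_comp measurable_snd measurable_fst).
have p4 : measurable_fun setT (fun u : T * X => u.2) := measurable_snd.
have mg1 : measurable_fun setT (fun u : T * X => g u.1.1.1 u.2 - gf u.1.1.1).
  apply: measurable_rowB; last exact: (measurableT_comp mgf p1).
  exact: (measurableT_comp g_measurable (measurable_fun_pair p1 p4)).
have ii i : intble Pr (fun w => dot (grad_error i w) (e w) * dot (e w) (z w - xs)).
  apply: intble_mul => //; first by apply: (measurable_dot _ me); exact: measurable_grad_error.
  apply: (@intble_le _ _ _ _ _ (fun w => dot (grad_error i w) (grad_error i w))).
  - by apply: measurable_funX; apply: (measurable_dot _ me); exact: measurable_grad_error.
  - by move=> w; rewrite ger0_norm ?sqr_ge0 //; exact: dot_sphere_sqr_le.
  - exact: (grad_error_second_moment i).1.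
have zi i : \int[Pr]_w (dot (grad_error i w) (e w) * dot (e w) (z w - xs)) = 0.
  apply: (@indep_Rint_eq0 _ _ _ _ _ _ _ Pr P _ (xi i) mY (mxi i) (indep_xi i)
    (fun u => dot (g u.1.1.1 u.2 - gf u.1.1.1) u.1.2 * dot u.1.2 (u.1.1.2 - xs))).
  - apply: measurable_funM; first exact: (measurable_dot mg1 p3).
    exact: (measurable_dot p3 (measurable_rowB p2 (measurable_cst _))).
  - exact: ii.
  - move=> w /=; set b := dot (e w) _.
    have id : intble P (fun v => dot (g (x w) v) (e w)).
      exact: (intble_dotg L2_gt0 F_integrable g_measurable L_measurable F_convex_smooth L_moment).
    have idB : intble P (fun v => dot (g (x w) v) (e w) - dot (gf (x w)) (e w)).
      by apply: intbleB => //; exact: intble_cst.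
    have eqb v : dot (g (x w) v - gf (x w)) (e w) * b =
        b * (dot (g (x w) v) (e w) - dot (gf (x w)) (e w)) by rewrite dotBl mulrC.
    split; first by under eq_fun do rewrite eqb; exact: intbleZ.
    under eq_Rintegral do rewrite eqb.
    rewrite RintZ // RintB //; last exact: intble_cst.
    rewrite Rint_cst (Rint_dot_gradient L2_gt0 F_integrable g_measurable L_measurable F_convex_smooth L_moment).
    by rewrite subrr mulr0.
have e2 w : batch_error w * dot (e w) (z w - xs) =
    m%:R^-1 * \sum_i (dot (grad_error i w) (e w) * dot (e w) (z w - xs)).
  by rewrite /batch_error -mulrA mulr_suml.
under eq_Rintegral do rewrite e2.
rewrite RintZ; last exact: intble_sum.
by rewrite Rint_sum // big1 ?mulr0.
Qed.

Let islope2 : intble Pr (fun w => slope w ^+ 2).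
Proof.
have iu2 : intble Pr (fun w => dot (gf (x w)) (e w) ^+ 2).
  apply: (@intble_le _ _ _ _ _ (fun w => dot (gf (x w)) (gf (x w)))) => //.
  - exact: measurable_funX.
  - by move=> w; rewrite ger0_norm ?sqr_ge0 //; exact: dot_sphere_sqr_le.
apply: (@intble_le _ _ _ _ _ (fun w => 3 * (dot (gf (x w)) (e w) ^+ 2 + batch_error w ^+ 2 + batch_bias w ^+ 2))).
- exact: measurable_funX.
- move=> w; rewrite ger0_norm ?sqr_ge0 // /slope.
  set A := dot _ _; set B := batch_error w; set D := batch_bias w.
  by have := sqr_ge0 (A - B); have := sqr_ge0 (A - D); have := sqr_ge0 (B - D); lra.
- by apply: intbleZ; apply: intbleD => //; exact: intbleD.
Qed.

Lemma intble_step_y : intble Pr (fun w => dot (step_y w - xs) (step_y w - xs)).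
Proof.
have mys := measurable_rowB measurable_step_y (measurable_cst xs).
apply: (@intble_le _ _ _ _ _ (fun w => 2 * dot (x w - xs) (x w - xs) +
    2 * (2 * L2)^-1 ^+ 2 * slope w ^+ 2)).
- exact: measurable_dot.
- move=> w; rewrite (ger0_norm (dotxx_ge0 _)) /step_y step_gradientE addrAC.
  apply: le_trans (dot_add_self_le _ _) _; rewrite dotNl dotNr opprK !dotZl !dotZr.
  rewrite (sphere_dot (e_sphere w)) mulr1 le_eqVlt; apply/orP; left; apply/eqP.
  by ring.
- by apply: intbleD; exact: intbleZ.
Qed.

Let m_bregman (v : O -> 'rV[R]_n) : measurable_fun setT v ->
  measurable_fun setT (fun w => bregman d (v w) xs).
Proof.
move=> mv; apply: measurable_funB.
  apply: measurable_funB; first exact: measurable_cst.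
  exact: (measurableT_comp (measurable_prox d_prox) mv).
apply: measurable_dot; first exact: (measurableT_comp (measurable_grad_prox d_prox) mv).
exact: (measurable_rowB (measurable_cst _) mv).
Qed.

Let mirror_step_w w : al * n%:R * (slope w * dot (e w) (z w - xs)) <=
  C / L2 * (slope w ^+ 2 * weight (e w) / (96 * rho)) + bregman d (z w) xs - bregman d (step_z w) xs.
Proof.
have := @mirror_step _ _ p d p_ge1 p_le2 d_prox (al * n%:R) (slope w ^+ 2 * weight (e w))
  (step_gradient w) (z w) xs.
rewrite -/(step_z w) step_gradientE dotZl => h; apply: le_trans (h _ _) _.
- by rewrite mulr_ge0 ?sqr_ge0 ?dual_weight_ge0.
- by move=> v; rewrite dotZl exprMn -mulrA ler_wpM2l ?sqr_ge0.
- rewrite lerD2r lerD2r al_C le_eqVlt; apply/orP; left; apply/eqP.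
  by field; rewrite !gt_eqF.
Qed.

(** The mirror inequality bounds the new divergence by the old one and by squares already known to
    be integrable; nonnegativity gives the other side. *)
Lemma intble_step_z : intble Pr (fun w => bregman d (step_z w) xs).
Proof.
apply: (@intble_le _ _ _ _ _ (fun w => bregman d (z w) xs +
    (C / L2 * (n%:R `^ a / (96 * rho)) + al * n%:R) * slope w ^+ 2 +
    al * n%:R * dot (e w) (z w - xs) ^+ 2)).
- exact: (m_bregman measurable_step_z).
- move=> w; rewrite ger0_norm; last exact: (bregman_ge0 p_ge1 p_le2 d_prox).
  have h1 := mirror_step_w w.
  have aln : 0 <= al * n%:R by rewrite mulr_ge0 // ltW.
  have h2 : - (slope w * dot (e w) (z w - xs)) <= slope w ^+ 2 + dot (e w) (z w - xs) ^+ 2.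
    set A := slope w; set B := dot _ _.
    by have := sqr_ge0 (A + B); have := sqr_ge0 A; have := sqr_ge0 B; lra.
  have h3 := ler_wpM2l aln h2.
  have h4 : C / L2 * (slope w ^+ 2 * weight (e w) / (96 * rho)) <=
      C / L2 * (n%:R `^ a / (96 * rho)) * slope w ^+ 2.
    have -> : C / L2 * (n%:R `^ a / (96 * rho)) * slope w ^+ 2 =
      C / L2 * (slope w ^+ 2 * n%:R `^ a / (96 * rho)) by ring.
    rewrite ler_wpM2l ?divr_ge0 ?(ltW L2_gt0) ?(le_trans (ltW al_gt0) alC) //.
    rewrite ler_wpM2r ?invr_ge0 ?mulr_ge0 ?(ltW rho_gt0) // ler_wpM2l ?sqr_ge0 //.
    by apply: le_trans (ler_norm _) _; exact: dual_weight_sphere.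
  lra.
- by apply: intbleD; [apply: intbleD => //; exact: intbleZ|exact: intbleZ].
Qed.

Let fsm := objective_smooth L2_gt0 F_integrable g_measurable L_measurable F_convex_smooth L_moment.

(** The gradient vanishes at the minimizer, so smoothness bounds [f (v w) - f xs] by [L2] times the
    squared distance. *)
Lemma intble_objective (v : O -> 'rV[R]_n) : measurable_fun setT v ->
  intble Pr (fun w => dot (v w - xs) (v w - xs)) -> intble Pr (fun w => f (v w)).
Proof.
move=> mv iv.
have mf := measurable_objective L2_gt0 F_integrable g_measurable L_measurable F_convex_smooth L_moment.
have g0 := grad_minimizer L2_gt0 F_integrable g_measurable L_measurable F_convex_smooth L_moment xs_min.
apply: (@intble_le _ _ _ _ _ (fun w => `|f xs| + L2 * dot (v w - xs) (v w - xs))).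
- exact: (measurableT_comp mf mv).
- move=> w; have /andP[h1 h2] := fsm xs (v w); rewrite g0 dot0l subr0 in h1 h2.
  rewrite -[f (v w)](subrK (f xs)) addrC; apply: le_trans (ler_normD _ _) _.
  by rewrite lerD2l ger0_norm.
- by apply: intbleD; [exact: intble_cst|exact: intbleZ].
Qed.

(** The centred terms vanish, the term in the squared slope [u ^+ 2] is nonpositive, and [|z - xs|^2
    <= 2 V[z](xs)] turns the square of [q] into the divergence. The factor [3 / 4] is
    [2 (1/8 + 1/4)]. *)
Lemma step_expectation (lam : R) : 0 < lam ->
  C * \int[Pr]_w f (step_y w) + \int[Pr]_w bregman d (step_z w) xs
    - (C - al) * \int[Pr]_w f (y w) - al * f xs - \int[Pr]_w bregman d (z w) xs <=
  al * n%:R * (lam / 2 * noise_level + (n%:R * lam)^-1 * \int[Pr]_w bregman d (z w) xs) +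
  C / L2 * (3 / 4 * (sigma ^+ 2 / (n%:R * m%:R)) + 3 / 4 * noise_level).
Proof.
move=> lam0.
have nR : 0 < n%:R :> R by rewrite ltr0n.
have C0 : 0 <= C := le_trans (ltW al_gt0) alC.
have K0 : 0 <= C / L2 by rewrite divr_ge0 // ltW.
have ify' := intble_objective measurable_step_y intble_step_y.
have ify := intble_objective my iy.
have shift0 v : 0 <= weight_shift 4^-1 v.
  by rewrite addr_ge0 // divr_ge0 ?dual_weight_ge0 // mulr_ge0 // ltW.
have [ierrP errP] := batch_error_second_moment (m_shift 4^-1) (sym_shift 4^-1) (shift_bound 4^-1) shift0.
have [ibiasP biasP] := batch_bias_second_moment (m_shift 4^-1) (shift_bound 4^-1) shift0.
have [iuP uP] := Rint_u2.
have [icross cross] := Rint_cross.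
have idv : intble Pr (fun w => dot (gf (x w)) (z w - xs)).
  exact: (@intble_dotGH _ _ _ _ _ _ Pr (fun w => (x w, z w)) mstate _ _ mfst msnd igrad iz).
pose lhs w := C * f (step_y w) + bregman d (step_z w) xs - (C - al) * f (y w) - al * f xs
  - bregman d (z w) xs.
pose t1 w := al * (dot (gf (x w)) (z w - xs) - n%:R * (dot (gf (x w)) (e w) * dot (e w) (z w - xs))).
pose t2 w := al * n%:R * (batch_error w * dot (e w) (z w - xs)).
pose t3 w := al * n%:R * (lam / 2 * batch_bias w ^+ 2 + (2 * lam)^-1 * dot (e w) (z w - xs) ^+ 2).
pose t4 w := dot (gf (x w)) (e w) ^+ 2 * weight_shift (- 4^-1) (e w)
  + 2 * (batch_error w ^+ 2 * weight_shift 4^-1 (e w)).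
pose t5 w := t4 w + 2 * (batch_bias w ^+ 2 * weight_shift 4^-1 (e w)).
have pw w : lhs w <= t1 w - t2 w + t3 w + C / L2 * t5 w.
  rewrite /lhs /step_y step_gradientE.
  apply: le_trans (@step_pathwise _ _ f gf L2 al C n%:R rho (weight (e w)) (bregman d (z w) xs)
    (bregman d (step_z w) xs) (batch_error w) (batch_bias w) lam (x w) (y w) (z w) (e w) xs
    fsm L2_gt0 rho_gt0 lam0 (ltW nR) (ltW al_gt0) alC (dual_weight_ge0 _ _ _)
    (sphere_dot (e_sphere w)) _ (mirror_step_w w)) _.
    rewrite xE scalerDr !scalerA C_tau; congr (_ + _ *: _).
    by rewrite mulrBr mulr1 C_tau.
  by rewrite /t1 /t2 /t3 /t5 /t4 /weight_shift [_ / (2 * lam)]mulrC.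
have it1 : intble Pr t1 by apply: intbleZ; apply: intbleB => //; exact: intbleZ.
have it2 : intble Pr t2 by exact: intbleZ.
have it3 : intble Pr t3 by apply: intbleZ; apply: intbleD; exact: intbleZ.
have it4 : intble Pr t4 by apply: intbleD => //; exact: intbleZ.
have it5 : intble Pr t5 by apply: intbleD => //; exact: intbleZ.
have iV' := intble_step_z.
have i1 : intble Pr (fun w => C * f (step_y w) + bregman d (step_z w) xs).
  by apply: intbleD => //; exact: intbleZ.
have i2 : intble Pr (fun w => C * f (step_y w) + bregman d (step_z w) xs - (C - al) * f (y w)).
  by apply: intbleB => //; exact: intbleZ.
have i3 : intble Pr (fun w => C * f (step_y w) + bregman d (step_z w) xs - (C - al) * f (y w) - al * f xs).
  by apply: intbleB => //; exact: intble_cst.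
have i12 : intble Pr (fun w => t1 w - t2 w) by exact: intbleB.
have i123 : intble Pr (fun w => t1 w - t2 w + t3 w) by exact: intbleD.
have i5 : intble Pr (fun w => C / L2 * t5 w) by exact: intbleZ.
have lhsE : \int[Pr]_w lhs w = C * \int[Pr]_w f (step_y w) + \int[Pr]_w bregman d (step_z w) xs
    - (C - al) * \int[Pr]_w f (y w) - al * f xs - \int[Pr]_w bregman d (z w) xs.
  rewrite /lhs (RintB i3 iV) (RintB i2 (intble_cst _ _)) (RintB i1 (intbleZ _ ify)).
  by rewrite (RintD (intbleZ _ ify') iV') Rint_cst (RintZ _ ify') (RintZ _ ify).
have t1E : \int[Pr]_w t1 w = 0.
  rewrite /t1 RintZ; last by apply: intbleB => //; exact: intbleZ.
  rewrite (RintB idv (intbleZ _ icross)) (RintZ _ icross) cross mulrA divff ?gt_eqF //.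
  by rewrite mul1r subrr mulr0.
have t2E : \int[Pr]_w t2 w = 0 by rewrite /t2 RintZ // Rint_err_q mulr0.
have t3E : \int[Pr]_w t3 w <=
    al * n%:R * (lam / 2 * noise_level + (n%:R * lam)^-1 * \int[Pr]_w bregman d (z w) xs).
  rewrite /t3 RintZ; last by apply: intbleD; exact: intbleZ.
  rewrite ler_wpM2l ?mulr_ge0 ?(ltW al_gt0) //.
  rewrite (RintD (intbleZ _ ibias2) (intbleZ _ iq2)) (RintZ _ ibias2) (RintZ _ iq2) Rint_q2.
  apply: lerD; first by rewrite ler_wpM2l // divr_ge0 // ltW.
  have vV : \int[Pr]_w dot (z w - xs) (z w - xs) <= 2 * \int[Pr]_w bregman d (z w) xs.
    rewrite -RintZ //; apply: le_Rint => //; first exact: intbleZ.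
    move=> w; have := bregman_ge_dot p_ge1 p_le2 d_prox (z w) xs.
    rewrite (_ : dot (xs - z w) (xs - z w) = dot (z w - xs) (z w - xs)); first lra.
    by rewrite -(opprB (z w)) dotNl dotNr opprK.
  have -> : (n%:R * lam)^-1 * \int[Pr]_w bregman d (z w) xs =
     (2 * lam)^-1 * (n%:R^-1 * (2 * \int[Pr]_w bregman d (z w) xs)).
    by field; rewrite !gt_eqF.
  by rewrite !ler_wpM2l ?invr_ge0 ?mulr_ge0 // ltW.
have Psi8 := Rint_shift 4^-1.
have Psi0 : 0 <= \int[mu]_v weight_shift 4^-1 v by apply: Rintegral_ge0.
have Psi38 : \int[mu]_v weight_shift 4^-1 v <= 3 / 8 by apply: le_trans Psi8 _; lra.
have t5E : \int[Pr]_w t5 w <= 3 / 4 * (sigma ^+ 2 / (n%:R * m%:R)) + 3 / 4 * noise_level.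
  rewrite /t5 (RintD it4 (intbleZ _ ibiasP)) (RintZ _ ibiasP).
  rewrite /t4 (RintD iuP (intbleZ _ ierrP)) (RintZ _ ierrP).
  have h1 : (\int[mu]_v weight_shift 4^-1 v) * (sigma ^+ 2 / (n%:R * m%:R)) <=
      3 / 8 * (sigma ^+ 2 / (n%:R * m%:R)).
    by rewrite ler_wpM2r // divr_ge0 ?sqr_ge0 // mulr_ge0.
  have h2 : noise_level * (\int[mu]_v weight_shift 4^-1 v) <= noise_level * (3 / 8).
    by rewrite ler_wpM2l // noise_level_ge0.
  lra.
rewrite -lhsE; apply: le_trans (_ : \int[Pr]_w (t1 w - t2 w + t3 w + C / L2 * t5 w) <= _).
  apply: le_Rint => //; last exact: intbleD.
  by apply: intbleB.
rewrite (RintD i123 i5) (RintD i12 it3) (RintB it1 it2) t1E t2E subrr add0r (RintZ _ it5).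
by apply: lerD => //; rewrite ler_wpM2l.
Qed.

End step_expectation.

End one_step.

End batch_noise.

(** * Measurability of the iterates, and their independence of later samples *)

Section ardd_measurable.
Context {R : realType} {n m : nat} {dX dT : measure_display} {X : measurableType dX}
  {T : measurableType dT}.
Variables (g : 'rV[R]_n -> X -> 'rV[R]_n) (zeta eta : 'rV[R]_n -> X -> 'rV[R]_n -> R).
Hypothesis g_measurable : measurable_fun setT (fun u : 'rV[R]_n * X => g u.1 u.2).
Hypothesis zeta_measurable : measurable_fun setT
     (fun u : 'rV[R]_n * X * 'rV[R]_n => zeta u.1.1 u.1.2 u.2).
Hypothesis eta_measurable : measurable_fun setT
     (fun u : 'rV[R]_n * X * 'rV[R]_n => eta u.1.1 u.1.2 u.2).
Variables (L2 rho_n p : R) (d : 'rV[R]_n -> R).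
Hypotheses (p_ge1 : 1 <= p) (p_le2 : p <= 2) (d_prox : prox_function p d).

Lemma measurable_batch_gradient (x : T -> 'rV[R]_n) (xi : 'I_m -> T -> X)
    (e : T -> 'rV[R]_n) : measurable_fun setT x ->
  (forall i, measurable_fun setT (xi i)) -> measurable_fun setT e ->
  measurable_fun setT
    (fun w => batch_gradient (oracle g zeta eta) (x w) (xi ^~ w) (e w)).
Proof.
move=> mx mxi me; apply: measurable_rowZ; first exact: measurable_cst.
apply: measurable_row_sum => i; apply: (measurable_rowZ _ me).
have mt : measurable_fun setT (fun w => ((x w, xi i w), e w)).
  exact: (measurable_fun_pair (measurable_fun_pair mx (mxi i)) me).
apply: measurable_funD; last exact: (measurableT_comp eta_measurable mt).
apply: measurable_funD; last exact: (measurableT_comp zeta_measurable mt).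
apply: (measurable_dot _ me).
exact: (measurableT_comp g_measurable (measurable_fun_pair mx (mxi i))).
Qed.

Variables (x0 : 'rV[R]_n) (e : nat -> T -> 'rV[R]_n) (xi : nat -> 'I_m -> T -> X).

(** The sample space [T] is arbitrary because it is taken in two ways: with the ambient
    sigma-algebra, to integrate, and with the one generated by past samples, to apply
    independence. *)
Definition ardd_state (k : nat) (w : T) : 'rV[R]_n * 'rV[R]_n :=
  ardd L2 rho_n d (oracle g zeta eta) x0 (e ^~ w) (fun k i => xi k i w) k.

Definition ardd_query (k : nat) (w : T) : 'rV[R]_n :=
  @ardd_tau R n L2 rho_n k *: (ardd_state k w).2 +
  (1 - @ardd_tau R n L2 rho_n k) *: (ardd_state k w).1.

Lemma ardd_stateS k w :
  let G := batch_gradient (oracle g zeta eta) (ardd_query k w) (xi k.+1 ^~ w) (e k.+1 w) in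
  ardd_state k.+1 w = (ardd_query k w - (2 * L2)^-1 *: G,
    mirror d (grad d (ardd_state k w).2 - (@ardd_alpha R n L2 rho_n k.+1 * n%:R) *: G)).
Proof.
rewrite /= /ardd_query /ardd_state /=.
by case: (ardd _ _ _ _ _ _ _ k) => y z /=; rewrite argmin_mirror.
Qed.

Lemma measurable_ardd_state k :
  (forall j, (j < k)%N -> measurable_fun setT (e j.+1) /\
     forall i, measurable_fun setT (xi j.+1 i)) ->
  measurable_fun setT (fun w => (ardd_state k w).1) /\
  measurable_fun setT (fun w => (ardd_state k w).2).
Proof.
elim: k => [|k IHk] mexi; first by split; exact: measurable_cst.
have [|my mz] := IHk; first by move=> j jk; apply: mexi; rewrite ltnS ltnW.
have [me mxi] := mexi k (ltnSn k).
have mx : measurable_fun setT (ardd_query k).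
  by apply: measurable_rowD; apply: measurable_rowZ => //; exact: measurable_cst.
have mG := measurable_batch_gradient mx mxi me.
split; under eq_fun do rewrite ardd_stateS /=.
  apply: (measurable_rowB mx); apply: measurable_rowZ mG; exact: measurable_cst.
apply: (measurableT_comp (measurable_mirror p_ge1 p_le2 d_prox)).
apply: measurable_rowB; first exact: (measurableT_comp (measurable_grad_prox d_prox) mz).
apply: measurable_rowZ mG; exact: measurable_cst.
Qed.

Lemma measurable_ardd_query k :
  (forall j, (j < k)%N -> measurable_fun setT (e j.+1) /\
     forall i, measurable_fun setT (xi j.+1 i)) ->
  measurable_fun setT (ardd_query k).
Proof.
move=> /measurable_ardd_state[my mz].
by apply: measurable_rowD; apply: measurable_rowZ => //; exact: measurable_cst.
Qed.

End ardd_measurable.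

Section sample_sigma_algebra.
Context {R : realType} {n N m : nat} {dX dO : measure_display} {X : measurableType dX}
  {O : measurableType dO}.
Variable Pr : probability O R.
Variables (e : nat -> O -> 'rV[R]_n) (xi : nat -> 'I_m -> O -> X).
Hypothesis me : forall k : 'I_N, measurable_fun setT (e k.+1).
Hypothesis mxi : forall (k : 'I_N) i, measurable_fun setT (xi k.+1 i).
Hypothesis e_xi_independent : samples_independent Pr N e xi.

Local Notation I := ('I_N + 'I_N * 'I_m)%type.

Let S (j : I) : set_system O :=
  match j with
  | inl k => generated_by (e k.+1)
  | inr (k, i) => generated_by (xi k.+1 i)
  end.

(* The carrier of [O] with the sigma-algebra generated by the samples indexed by [K]; an iterate is measurable for it as soon as [K] contains the samples it depends on. *)
Definition past (K : {set I}) := g_sigma_algebraType (\bigcup_(j in [set` K]) S j).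

Let generated_measurable {d' : measure_display} {T : measurableType d'} (Z : O -> T) :
  measurable_fun setT Z -> generated_by Z `<=` measurable.
Proof. by move=> mZ _ [B mB <-]; exact: mZ. Qed.

Let generated_setT {d' : measure_display} {T : measurableType d'} (Z : O -> T) :
  generated_by Z setT.
Proof. by exists setT; rewrite ?setTI. Qed.

Let generated_setI {d' : measure_display} {T : measurableType d'} (Z : O -> T) :
  setI_closed (generated_by Z).
Proof.
move=> _ _ [A mA <-] [B mB <-]; exists (A `&` B); first exact: measurableI.
by rewrite !setTI preimage_setI.
Qed.

Let S_measurable j : S j `<=` measurable.
Proof. by case: j => [k|[k i]]; apply: generated_measurable; [exact: me|exact: mxi]. Qed.

Let S_setT j : S j setT.
Proof. by case: j => [k|[k i]]; exact: generated_setT. Qed.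

Let S_setI j : setI_closed (S j).
Proof. by case: j => [k|[k i]]; exact: generated_setI. Qed.

Let past_measurable_gen (K : {set I}) j {d' : measure_display} {T : measurableType d'}
  (Z : O -> T) : j \in K -> S j = generated_by Z ->
  measurable_fun (setT : set (past K)) (Z : past K -> T).
Proof.
move=> jK SZ _ B mB; apply: sub_sigma_algebra; exists j => //.
by rewrite SZ; exists B.
Qed.

Lemma past_measurable_e (K : {set I}) (k : 'I_N) : inl k \in K ->
  measurable_fun (setT : set (past K)) (e k.+1 : past K -> _).
Proof. by move=> kK; exact: (past_measurable_gen kK). Qed.

Lemma past_measurable_xi (K : {set I}) (k : 'I_N) i : inr (k, i) \in K ->
  measurable_fun (setT : set (past K)) (xi k.+1 i : past K -> _).
Proof. by move=> kK; exact: (past_measurable_gen kK). Qed.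

(** Preimages under [Y] lie in the sigma-algebra generated by the samples in [K], to which the
    product formula with a sample outside [K] extends. *)
Let indep_past (K : {set I}) j {d1 d2 : measure_display} {T1 : measurableType d1}
    {T2 : measurableType d2} (Y : O -> T1) (Z : O -> T2) (Q : probability T2 R) :
  j \notin K -> S j = generated_by Z ->
  measurable_fun (setT : set (past K)) (Y : past K -> T1) ->
  (forall B, measurable B -> Pr (Z @^-1` B) = Q B) ->
  indep_of_law Pr Q Y Z.
Proof.
move=> jK SZ mY ZQ A B mA mB.
rewrite (indep_generated S_measurable S_setT S_setI e_xi_independent jK).
- by rewrite ZQ.
- by have := mY measurableT A mA; rewrite setTI.
- by rewrite -[X in X _]/(S j) SZ; exists B; rewrite ?setTI.
Qed.

Lemma indep_past_e (K : {set I}) (k : 'I_N) {d1 : measure_display} {T1 : measurableType d1}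
    (Y : O -> T1) (Q : probability 'rV[R]_n R) : inl k \notin K ->
  measurable_fun (setT : set (past K)) (Y : past K -> T1) ->
  (forall B, measurable B -> Pr (e k.+1 @^-1` B) = Q B) ->
  indep_of_law Pr Q Y (e k.+1).
Proof. by move=> kK; exact: (indep_past kK). Qed.

Lemma indep_past_xi (K : {set I}) (k : 'I_N) i {d1 : measure_display}
    {T1 : measurableType d1} (Y : O -> T1) (Q : probability X R) : inr (k, i) \notin K ->
  measurable_fun (setT : set (past K)) (Y : past K -> T1) ->
  (forall B, measurable B -> Pr (xi k.+1 i @^-1` B) = Q B) ->
  indep_of_law Pr Q Y (xi k.+1 i).
Proof. by move=> kK; exact: (indep_past kK). Qed.

End sample_sigma_algebra.

(** * The scalar recursion *)

Section accelerated_recursion.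
Context {R : realType}.
Variables (A nu eps kap : R) (Phi v : nat -> R) (N : nat).
Hypotheses (A_gt0 : 0 < A) (nu_gt0 : 0 < nu) (eps_ge0 : 0 <= eps) (kap_ge0 : 0 <= kap).
Hypotheses (Phi_ge0 : forall k, 0 <= Phi k) (v_ge0 : forall k, 0 <= v k).

Let al (k : nat) : R := k.+1%:R / A.
Let C (k : nat) : R := k.+1%:R ^+ 2 / (2 * A).

Hypothesis step : forall k lam, (k < N)%N -> 0 < lam ->
  C k.+1 * Phi k.+1 + v k.+1 - (C k.+1 - al k.+1) * Phi k - v k <=
  al k.+1 * nu * (lam / 2 * eps + (nu * lam)^-1 * v k) + C k.+1 * kap.

(** The weight of [Phi k] on entering the next step. It is 0 at the start because [C 1 = al 1], that
    is [tau_0 = 1]: the function value at the starting point does not enter. *)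
Let E (k : nat) : R := if k is 0%N then 0 else C k.
(** The sum of [al 1, ..., al k]. *)
Let S (k : nat) : R := k%:R * (k%:R + 3) / (2 * A).

Let C_ge0 k : 0 <= C k.
Proof. by rewrite divr_ge0 ?sqr_ge0 // mulr_ge0 // ltW. Qed.

Let C_le k l : (k <= l)%N -> C k <= C l.
Proof.
move=> kl; rewrite ler_wpM2r ?invr_ge0 ?mulr_ge0 ?(ltW A_gt0) //.
by rewrite lerXn2r ?nnegrE ?ler_nat.
Qed.

(** [C k.+1 - al k.+1] equals [((k + 1)^2 - 1) / (2 A)], just below [C k], so the function terms
    telescope. *)
Let E_ge k : C k.+1 - al k.+1 <= E k.
Proof.
rewrite /C /al -subr_ge0; case: k => [|k] /=.
  by rewrite le_eqVlt; apply/orP; left; apply/eqP; field; rewrite gt_eqF.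
have -> : E k.+1 - (k.+3%:R ^+ 2 / (2 * A) - k.+3%:R / A) = (2 * A)^-1.
  by rewrite /E /C -!natr1; field; rewrite gt_eqF.
by rewrite invr_ge0 mulr_ge0 // ltW.
Qed.

Let S_ge0 k : 0 <= S k.
Proof. by rewrite divr_ge0 ?mulr_ge0 ?addr_ge0 // ltW. Qed.

Let SS k : S k.+1 = S k + al k.+1.
Proof. by rewrite /S /al -!natr1; field; rewrite gt_eqF. Qed.

(* The growth of [v] is absorbed by completing a square: choosing [lam] as the ratio [X / c] makes the right-hand side of [step] the increment of [X ^+ 2], up to a square. Taking [r] and [c] positive keeps [lam] well defined. *)
Let recursion_bound (r c : R) : 0 < r -> 0 < c ->
  v 0%N + N%:R * (C N * kap) <= r ^+ 2 -> nu * eps / 2 <= c ^+ 2 ->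
  forall k, (k <= N)%N ->
    E k * Phi k + v k <= (r + c * S k) ^+ 2 - (N%:R - k%:R) * (C N * kap).
Proof.
move=> r0 c0 rv ce; elim => [_|k IHk kN].
  by rewrite /S /E !mul0r !mulr0 addr0 add0r subr0; lra.
have {}IHk := IHk (ltnW kN); set X := r + c * S k in IHk.
have X0 : 0 < X by rewrite ltr_wpDr // mulr_ge0 // ltW.
have CK0 : 0 <= C N * kap by rewrite mulr_ge0.
have vX : v k <= X ^+ 2.
  have h1 : 0 <= E k * Phi k by rewrite mulr_ge0 //; case: (k) => /=.
  have h2 : 0 <= (N%:R - k%:R) * (C N * kap).
    by rewrite mulr_ge0 // subr_ge0 ler_nat ltnW.
  lra.
have a0 : 0 <= al k.+1 by rewrite divr_ge0 // ltW.
have := step kN (divr_gt0 X0 c0).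
have h1 : al k.+1 * nu * (X / c / 2 * eps + (nu * (X / c))^-1 * v k) <= 2 * al k.+1 * (c * X).
  have -> : al k.+1 * nu * (X / c / 2 * eps + (nu * (X / c))^-1 * v k) =
    al k.+1 * (X / c * (nu * eps / 2) + c / X * v k) by field; rewrite !gt_eqF.
  have -> : 2 * al k.+1 * (c * X) = al k.+1 * (2 * (c * X)) by ring.
  apply: ler_wpM2l => //.
  have h1 : X / c * (nu * eps / 2) <= X / c * c ^+ 2.
    by rewrite ler_wpM2l // ltW // divr_gt0.
  have h2 : c / X * v k <= c / X * X ^+ 2 by rewrite ler_wpM2l // ltW // divr_gt0.
  have -> : 2 * (c * X) = X / c * c ^+ 2 + c / X * X ^+ 2 by field; rewrite !gt_eqF.
  exact: lerD.
(* [N] shares of size [C N * kap] are reserved in [r ^+ 2]; each step spends at most one. *)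
have h2 : C k.+1 * kap <= C N * kap by rewrite ler_wpM2r // C_le.
have h3 : (C k.+1 - al k.+1) * Phi k <= E k * Phi k by rewrite ler_wpM2r.
have h4 : (r + c * S k.+1) ^+ 2 = X ^+ 2 + 2 * al k.+1 * (c * X) + (c * al k.+1) ^+ 2.
  by rewrite SS /X; ring.
have h5 := sqr_ge0 (c * al k.+1).
have h6 : E k.+1 = C k.+1 by [].
have h7 : k.+1%:R = k%:R + 1 :> R by rewrite natr1.
rewrite h4 h6 h7 => hs.
clearbody C E S al X; lra.
Qed.

(** Splitting the square of [r + c * S N] costs a factor 2; division by [C N], of order
    [N^2 / (2 A)], then produces [4 * A]. *)
Lemma accelerated_recursion : (0 < N)%N ->
  Phi N <= 4 * A * v 0%N / N%:R ^+ 2 + 2 * N%:R * kap + 2 * nu * eps * N%:R ^+ 2 / A.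
Proof.
move=> N0; have NR : 0 < N%:R :> R by rewrite ltr0n.
have CN0 : 0 < C N by apply: divr_gt0; [exact: exprn_gt0|exact: mulr_gt0].
have b0 : 0 <= v 0%N + N%:R * (C N * kap) by apply: addr_ge0 => //; apply: mulr_ge0 => //; exact: mulr_ge0.
have c0 : 0 <= nu * eps / 2 by rewrite divr_ge0 ?mulr_ge0 // ltW.
have main : C N * Phi N <= 2 * (v 0%N + N%:R * (C N * kap)) + nu * eps * S N ^+ 2.
  (* [r] and [c] must be positive even if the quantities under the roots vanish. Adding [t] to both
     costs exactly [h], which is arbitrary. *)
  apply/ler_addgt0Pr => h h0; pose t := h / (2 * (1 + S N ^+ 2)).
  have S1 : 0 < 1 + S N ^+ 2 by rewrite ltr_pwDl // sqr_ge0.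
  have t0 : 0 < t by rewrite divr_gt0 // mulr_gt0.
  pose r := Num.sqrt (v 0%N + N%:R * (C N * kap) + t).
  pose c := Num.sqrt (nu * eps / 2 + t).
  have r2 : r ^+ 2 = v 0%N + N%:R * (C N * kap) + t by rewrite sqr_sqrtr // addr_ge0 // ltW.
  have c2 : c ^+ 2 = nu * eps / 2 + t by rewrite sqr_sqrtr // addr_ge0 // ltW.
  have := @recursion_bound r c _ _ _ _ N (leqnn N).
  rewrite !sqrtr_gt0 !ltr_wpDl // r2 c2 !lerDl (ltW t0) => /(_ isT isT isT isT).
  rewrite subrr mul0r subr0 => hb.
  have -> : h = 2 * t + 2 * t * S N ^+ 2 by rewrite /t; field; rewrite gt_eqF.
  have EN : E N = C N by rewrite /E; case: (N) N0.
  have sq : (r + c * S N) ^+ 2 <= 2 * r ^+ 2 + 2 * (c ^+ 2 * S N ^+ 2).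
    by rewrite -exprMn; have := sqr_ge0 (r - c * S N); lra.
  rewrite r2 c2 in sq; rewrite EN in hb; have := v_ge0 N; lra.
rewrite -(ler_pM2l CN0); apply: le_trans main _.
(* Both [v 0%N] and [S N] are bounded so that the factor [(N + 1)^2] of [C N] cancels; for [S N]
   this is [N + 3 <= 2 (N + 1)]. *)
have h1 : v 0%N <= (N.+1%:R / N%:R) ^+ 2 * v 0%N.
  rewrite ler_peMl // exprn_ege1 // ler_pdivlMr // mul1r ler_nat //.
have h2 : S N <= N%:R * N.+1%:R / A.
  rewrite /S invfM mulrA ler_wpM2r ?invr_ge0 ?(ltW A_gt0) //.
  rewrite ler_pdivrMr // -mulrA ler_wpM2l // -natr1.
  have : 1 <= N%:R :> R by rewrite ler1n.
  lra.
have h3 : S N ^+ 2 <= (N%:R * N.+1%:R / A) ^+ 2.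
  rewrite lerXn2r ?nnegrE //; first exact: le_trans (S_ge0 N) h2.
have h4 : nu * eps * S N ^+ 2 <= nu * eps * (N%:R * N.+1%:R / A) ^+ 2.
  by rewrite ler_wpM2l // mulr_ge0 // ltW.
have -> : C N * (4 * A * v 0%N / N%:R ^+ 2 + 2 * N%:R * kap + 2 * nu * eps * N%:R ^+ 2 / A) =
  2 * ((N.+1%:R / N%:R) ^+ 2 * v 0%N + N%:R * (C N * kap)) + nu * eps * (N%:R * N.+1%:R / A) ^+ 2.
  by rewrite /C; field; rewrite !gt_eqF.
lra.
Qed.

End accelerated_recursion.

(** * Convergence when the directions lie on the sphere everywhere *)

Section ardd_convergence.
Context {R : realType} {n m N : nat} {dX dO : measure_display} {X : measurableType dX}
  {O : measurableType dO}.
Variables (P : probability X R) (F : 'rV[R]_n -> X -> R)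
  (g : 'rV[R]_n -> X -> 'rV[R]_n) (L : X -> R) (L2 sigma : R).
Hypotheses (n_ge8 : (8 <= n)%N) (N_gt0 : (0 < N)%N) (m_gt0 : (0 < m)%N).
Hypothesis L2_gt0 : 0 < L2.
Hypothesis F_integrable : forall x, P.-integrable setT (EFin \o F x).
Hypothesis g_measurable : measurable_fun setT (fun u : 'rV[R]_n * X => g u.1 u.2).
Hypothesis L_measurable : measurable_fun setT L.
Hypothesis F_convex_smooth : {ae P, forall xi,
     [/\ closed_function (F ^~ xi),
         convex_function [set: 'rV[R]_n] (F ^~ xi),
         has_gradient (F ^~ xi) (g ^~ xi)
       & lipschitz2 (g ^~ xi) (L xi)]}.
Hypothesis L_moment : ('E_P[fun xi => (L xi ^+ 2)%R] `^ 2^-1 <= L2%:E)%E.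
Hypothesis g_variance : forall x,
     ('E_P[fun xi => (norm2 (g x xi - grad (objective P F) x) ^+ 2)%R]
        <= (sigma ^+ 2)%:E)%E.
Variables (zeta eta : 'rV[R]_n -> X -> 'rV[R]_n -> R) (Delta_zeta Delta_eta : R).
Hypothesis zeta_measurable : measurable_fun setT
     (fun u : 'rV[R]_n * X * 'rV[R]_n => zeta u.1.1 u.1.2 u.2).
Hypothesis eta_measurable : measurable_fun setT
     (fun u : 'rV[R]_n * X * 'rV[R]_n => eta u.1.1 u.1.2 u.2).
Hypothesis zeta_bound : forall x e, sphere2 e ->
     ('E_P[fun xi => (zeta x xi e ^+ 2)%R] <= Delta_zeta%:E)%E.
Hypothesis eta_bound : forall x e, sphere2 e ->
     {ae P, forall xi, `|eta x xi e| <= Delta_eta}.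
Variables (p : R) (d : 'rV[R]_n -> R).
Hypotheses (p_ge1 : 1 <= p) (p_le2 : p <= 2) (d_prox : prox_function p d).
Variables (Pr : probability O R) (mu : 'I_N -> probability 'rV[R]_n R).
Variables (e : nat -> O -> 'rV[R]_n) (xi : nat -> 'I_m -> O -> X).
Hypothesis me : forall k : 'I_N, measurable_fun setT (e k.+1).
Hypothesis mxi : forall (k : 'I_N) i, measurable_fun setT (xi k.+1 i).
Hypothesis e_sphere : forall k w, sphere2 (e k w).
Hypothesis mu_unif : forall k, uniform_on_sphere (mu k).
Hypothesis e_law : forall (k : 'I_N) B, measurable B -> Pr (e k.+1 @^-1` B) = mu k B.
Hypothesis xi_law : forall (k : 'I_N) i B, measurable B -> Pr (xi k.+1 i @^-1` B) = P B.
Hypothesis e_xi_independent : samples_independent Pr N e xi.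
Variables (x0 xs : 'rV[R]_n).
Hypothesis xs_min : minimizer (objective P F) xs.

Local Notation f := (objective P F).
Local Notation q := (hoelder_conjugate p%:E).
Local Notation rho_n := (rho n q).
Local Notation state := (ardd_state g zeta eta L2 rho_n d x0 e xi).
Local Notation query := (ardd_query g zeta eta L2 rho_n d x0 e xi).
Local Notation I := ('I_N + 'I_N * 'I_m)%type.
Local Notation past := (past e xi).
Local Notation A := (96 * n%:R ^+ 2 * rho_n * L2).
Local Notation al := (@ardd_alpha R n L2 rho_n).
Local Notation tau := (@ardd_tau R n L2 rho_n).
Local Notation C k := (k.+1%:R ^+ 2 / (2 * A)).
Local Notation noise := (noise_level Delta_zeta Delta_eta).

Let n_gt0 : (0 < n)%N. Proof. exact: leq_trans n_ge8. Qed.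
Let nR : 0 < n%:R :> R. Proof. by rewrite ltr0n. Qed.
Let rho_gt0 : 0 < rho_n. Proof. by have [] := exists_dual_weight n_ge8 p_ge1 p_le2. Qed.
Let A_gt0 : 0 < A.
Proof. by rewrite mulr_gt0 // mulr_gt0 // mulr_gt0 // exprn_gt0. Qed.

(** Index [j] stands for iteration [j + 1], so these are the samples of the first [k] iterations, on
    which [state k] and [query k] depend. *)
Let history (k : nat) : {set I} :=
  [set j : I | match j with inl j => (j < k)%N | inr (j, _) => (j < k)%N end].

Let measurable_samples (K : {set I}) k : (k <= N)%N -> history k \subset K ->
  forall j, (j < k)%N ->
    measurable_fun (setT : set (past K)) (e j.+1 : past K -> _) /\
    forall i, measurable_fun (setT : set (past K)) (xi j.+1 i : past K -> _).
Proof.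
move=> kN /fintype.subsetP hK j jk; have jN := leq_trans jk kN; split => [|i].
  by apply: (@past_measurable_e _ _ _ _ _ _ _ _ e xi K (Ordinal jN)); apply: hK; rewrite inE.
by apply: (@past_measurable_xi _ _ _ _ _ _ _ _ e xi K (Ordinal jN)); apply: hK; rewrite inE.
Qed.

Let measurable_samplesO k : (k <= N)%N ->
  forall j, (j < k)%N -> measurable_fun setT (e j.+1) /\
    forall i, measurable_fun setT (xi j.+1 i).
Proof.
move=> kN j jk; have jN := leq_trans jk kN.
by split => [|i]; [exact: (me (Ordinal jN))|exact: (mxi (Ordinal jN))].
Qed.

Let measurable_state k : (k <= N)%N ->
  measurable_fun setT (fun w => (state k w).1) /\
  measurable_fun setT (fun w => (state k w).2).
Proof.
move=> kN; exact: (measurable_ardd_state g_measurable zeta_measurable eta_measurable _ _ p_ge1 p_le2 d_prox x0 (measurable_samplesO kN)).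
Qed.

Let measurable_query k : (k <= N)%N -> measurable_fun setT (query k).
Proof.
move=> kN; exact: (measurable_ardd_query g_measurable zeta_measurable eta_measurable _ _ p_ge1 p_le2 d_prox x0 (measurable_samplesO kN)).
Qed.

Let past_query (K : {set I}) k : (k <= N)%N -> history k \subset K ->
  measurable_fun (setT : set (past K))
    ((fun w => (query k w, (state k w).2)) : past K -> _).
Proof.
move=> kN hK; have ms := measurable_samples kN hK; apply: measurable_fun_pair.
  exact: (measurable_ardd_query g_measurable zeta_measurable eta_measurable _ _ p_ge1 p_le2 d_prox x0 ms).
exact: (measurable_ardd_state g_measurable zeta_measurable eta_measurable _ _ p_ge1 p_le2 d_prox x0 ms).2.
Qed.

Section iteration.
Variable k : 'I_N.
Let kN : (k <= N)%N := ltnW (ltn_ord k).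

Let sub_history (j : I) : history k \subset (j |: history k).
Proof. exact: finset.subsetUr. Qed.

Let sub_history2 (i j : I) : history k \subset (i |: (j |: history k)).
Proof. exact: fintype.subset_trans (sub_history j) (finset.subsetUr _ _). Qed.

Let e_new : inl k \notin history k. Proof. by rewrite inE ltnn. Qed.
Let xi_new i : inr (k, i) \notin history k. Proof. by rewrite inE ltnn. Qed.

Lemma indep_e : indep_of_law Pr (mu k) (fun w => (query k w, (state k w).2)) (e k.+1).
Proof. exact: (indep_past_e me mxi e_xi_independent e_new (past_query kN (fintype.subxx _)) (e_law k)). Qed.

Lemma indep_xi_e i : indep_of_law Pr (mu k)
  (fun w => (query k w, (state k w).2, xi k.+1 i w)) (e k.+1).
Proof.
(* [K] is the history enlarged by the sample that joins the conditioning. *)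
apply: (indep_past_e me mxi e_xi_independent (K := inr (k, i) |: history k)).
- by rewrite !inE ltnn.
- apply: measurable_fun_pair; first exact: (past_query kN (sub_history _)).
  by apply: past_measurable_xi; rewrite !inE eqxx.
- exact: e_law.
Qed.

Lemma indep_xi0 i : indep_of_law Pr P
  (fun w => (query k w, (state k w).2)) (xi k.+1 i).
Proof. exact: (indep_past_xi me mxi e_xi_independent (xi_new i) (past_query kN (fintype.subxx _)) (@xi_law k i)). Qed.

Lemma indep_xi i : indep_of_law Pr P
  (fun w => (query k w, (state k w).2, e k.+1 w)) (xi k.+1 i).
Proof.
apply: (indep_past_xi me mxi e_xi_independent (K := inl k |: history k)).
- by rewrite !inE ltnn.
- apply: measurable_fun_pair; first exact: (past_query kN (sub_history _)).
  by apply: past_measurable_e; rewrite !inE eqxx.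
- exact: xi_law.
Qed.

Lemma indep_xi_xi i j : i != j -> indep_of_law Pr P
  (fun w => (query k w, (state k w).2, e k.+1 w, xi k.+1 i w)) (xi k.+1 j).
Proof.
move=> ij.
apply: (indep_past_xi me mxi e_xi_independent (K := inr (k, i) |: (inl k |: history k))).
- rewrite !inE ltnn orbF orbF; apply/eqP => -[ji]; by rewrite ji eqxx in ij.
- apply: measurable_fun_pair.
    apply: measurable_fun_pair; first exact: (past_query kN (sub_history2 _ _)).
    by apply: past_measurable_e; rewrite !inE eqxx orbT.
  by apply: past_measurable_xi; rewrite !inE eqxx.
- exact: xi_law.
Qed.

End iteration.

Let sq_intble (v : O -> 'rV[R]_n) := intble Pr (fun w => dot (v w - xs) (v w - xs)).

Let al_gt0 k : 0 < al k.
Proof. by rewrite divr_gt0. Qed.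

Let tauE k : tau k = 2 / k.+2%:R.
Proof. by rewrite /ardd_tau /ardd_alpha; field; rewrite ?gt_eqF. Qed.

Let alC k : al k.+1 <= C k.+1.
Proof.
rewrite /ardd_alpha -subr_ge0.
have -> : C k.+1 - k.+2%:R / A = k.+2%:R * k%:R / (2 * A).
  by rewrite -!natr1; field; rewrite ?gt_eqF.
by rewrite divr_ge0 ?mulr_ge0 // ltW // mulr_gt0.
Qed.

Let C_tau k : C k.+1 * tau k = al k.+1.
Proof. by rewrite tauE /ardd_alpha; field; rewrite ?gt_eqF. Qed.

(** This relation ties the mirror step size to the weight: the cost [(al n)^2 / 2] of the mirror
    step becomes [C / (96 rho_n L2)]. *)
Let al_C k : (al k.+1 * n%:R) ^+ 2 = C k.+1 / (48 * rho_n * L2).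
Proof. by rewrite /ardd_alpha; field; rewrite ?gt_eqF. Qed.

Let sq_intble_bregman k : (k <= N)%N -> intble Pr (fun w => bregman d (state k w).2 xs) ->
  sq_intble (fun w => (state k w).2).
Proof.
move=> kN iV; have [_ mz] := measurable_state kN.
have mzx := measurable_rowB mz (measurable_cst xs).
apply: (@intble_le _ _ _ _ _ (fun w => 2 * bregman d (state k w).2 xs)).
- exact: (measurable_dot mzx mzx).
- move=> w; rewrite (ger0_norm (dotxx_ge0 _)).
  have := bregman_ge_dot p_ge1 p_le2 d_prox (state k w).2 xs.
  rewrite (_ : dot (xs - _) (xs - _) = dot ((state k w).2 - xs) ((state k w).2 - xs)); first lra.
  by rewrite -(opprB (state k w).2) dotNl dotNr opprK.
- exact: intbleZ.
Qed.

Let sq_intble_query k : (k <= N)%N -> sq_intble (fun w => (state k w).1) ->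
  sq_intble (fun w => (state k w).2) -> sq_intble (query k).
Proof.
move=> kN iy iz; have mx := measurable_rowB (measurable_query kN) (measurable_cst xs).
apply: (@intble_le _ _ _ _ _ (fun w =>
  2 * tau k ^+ 2 * dot ((state k w).2 - xs) ((state k w).2 - xs) +
  2 * (1 - tau k) ^+ 2 * dot ((state k w).1 - xs) ((state k w).1 - xs))).
- exact: (measurable_dot mx mx).
- move=> w; rewrite (ger0_norm (dotxx_ge0 _)).
  have -> : query k w - xs = tau k *: ((state k w).2 - xs) + (1 - tau k) *: ((state k w).1 - xs).
    by rewrite !scalerBr addrACA -opprD -scalerDl [tau k + _]addrC subrK scale1r.
  apply: le_trans (dot_add_self_le _ _) _; rewrite !dotZl !dotZr.
  by rewrite le_eqVlt; apply/orP; left; apply/eqP; ring.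
- by apply: intbleD; exact: intbleZ.
Qed.

Let stateE1 k w : (state k.+1 w).1 =
  step_y g L2 zeta eta (query k) (e k.+1) (xi k.+1) w.
Proof. by rewrite ardd_stateS. Qed.

Let stateE2 k w : (state k.+1 w).2 =
  step_z g zeta eta (query k) (fun w => (state k w).2) (e k.+1) (xi k.+1) (al k.+1) d w.
Proof. by rewrite ardd_stateS. Qed.

(** The invariant carried along the iteration; the squared distance of [z] to [xs] follows from the
    divergence by strong convexity. *)
Let iterate_intble k := sq_intble (fun w => (state k w).1) /\
  intble Pr (fun w => bregman d (state k w).2 xs).

Let iteration_step (k : 'I_N) : iterate_intble k -> iterate_intble k.+1 /\
  forall lam, 0 < lam ->
  C k.+1 * \int[Pr]_w f (state k.+1 w).1 + \int[Pr]_w bregman d (state k.+1 w).2 xs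
    - (C k.+1 - al k.+1) * \int[Pr]_w f (state k w).1 - al k.+1 * f xs
    - \int[Pr]_w bregman d (state k w).2 xs <=
  al k.+1 * n%:R * (lam / 2 * noise + (n%:R * lam)^-1 * \int[Pr]_w bregman d (state k w).2 xs) +
  C k.+1 / L2 * (3 / 4 * (sigma ^+ 2 / (n%:R * m%:R)) + 3 / 4 * noise).
Proof.
move=> [iy iV]; have kN : (k <= N)%N := ltnW (ltn_ord k).
have [my mz] := measurable_state kN; have mx := measurable_query kN.
have iz := sq_intble_bregman kN iV; have ix := sq_intble_query kN iy iz.
have [_ [a [j [j0 wd wm]]]] := exists_dual_weight n_ge8 p_ge1 p_le2.
have n1 : (1 < n)%N by exact: leq_trans n_ge8.
have weight_mean : \int[mu k]_x dual_weight a j x <= 6 * rho_n.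
  exact: le_trans (Rint_dual_weight_le a n1 j0 (mu_unif k)) wm.
have xE w : query k w = tau k *: (state k w).2 + (1 - tau k) *: (state k w).1 by [].
split; first split.
- have := intble_step_y L2_gt0 F_integrable g_measurable L_measurable F_convex_smooth L_moment
    g_variance zeta_measurable eta_measurable zeta_bound eta_bound n_gt0 (mu_unif k) m_gt0
    mx mz (me k) (mxi k) (e_sphere k.+1) (indep_e k) (indep_xi_e k) (indep_xi0 k) (indep_xi k)
    (@indep_xi_xi k) xs_min ix.
  by rewrite -[step_y _ _ _ _ _ _ _](funext (stateE1 k)).
- have := intble_step_z L2_gt0 F_integrable g_measurable L_measurable F_convex_smooth L_moment
    g_variance zeta_measurable eta_measurable zeta_bound eta_bound n_gt0 (mu_unif k) m_gt0
    mx mz (me k) (mxi k) (e_sphere k.+1) (indep_e k) (indep_xi_e k) (indep_xi0 k) (indep_xi k)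
    (@indep_xi_xi k) xs_min ix iz p_ge1 p_le2 d_prox iV rho_gt0 j0 (al_gt0 k.+1) (alC k) wd (al_C k).
  by rewrite -[step_z _ _ _ _ _ _ _ _ _](funext (stateE2 k)).
- move=> lam lam0.
  have := step_expectation L2_gt0 F_integrable g_measurable L_measurable F_convex_smooth L_moment
    g_variance zeta_measurable eta_measurable zeta_bound eta_bound n_gt0 (mu_unif k) m_gt0
    mx mz (me k) (mxi k) (e_sphere k.+1) (indep_e k) (indep_xi_e k) (indep_xi0 k) (indep_xi k)
    (@indep_xi_xi k) xs_min ix iz my iy p_ge1 p_le2 d_prox iV rho_gt0 j0 (al_gt0 k.+1) (alC k) wd
    weight_mean xE (C_tau k) (al_C k) lam0.
  by rewrite -[step_y _ _ _ _ _ _ _](funext (stateE1 k)) -[step_z _ _ _ _ _ _ _ _ _](funext (stateE2 k)).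
Qed.

Let intble_iterates k : (k <= N)%N -> iterate_intble k.
Proof.
elim: k => [_|k IHk kN]; first split.
- exact: (intble_cst Pr (dot (x0 - xs) (x0 - xs))).
- exact: (intble_cst Pr (bregman d x0 xs)).
-
exact: (iteration_step (k := Ordinal kN) (IHk (ltnW kN))).1.
Qed.

Lemma intble_ardd_objective k : (k <= N)%N -> intble Pr (fun w => f (state k w).1).
Proof.
move=> kN; have [iy _] := intble_iterates kN; have [my _] := measurable_state kN.
exact: (intble_objective L2_gt0 F_integrable g_measurable L_measurable F_convex_smooth L_moment xs_min my iy).
Qed.

Lemma ardd_convergence :
  \int[Pr]_w f (state N w).1 - f xs <=
  4 * A * bregman d x0 xs / N%:R ^+ 2
  + 2 * N%:R * ((3 / 4 * (sigma ^+ 2 / (n%:R * m%:R)) + 3 / 4 * noise) / L2)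
  + 2 * n%:R * noise * N%:R ^+ 2 / A.
Proof.
have noise0 : 0 <= noise := noise_level_ge0 zeta_bound eta_bound n_gt0.
have s0 : 0 <= sigma ^+ 2 / (n%:R * m%:R) by rewrite divr_ge0 ?sqr_ge0 // mulr_ge0.
have kap0 : 0 <= (3 / 4 * (sigma ^+ 2 / (n%:R * m%:R)) + 3 / 4 * noise) / L2.
  by rewrite divr_ge0 ?(ltW L2_gt0) // addr_ge0 // mulr_ge0.
pose Phi k := \int[Pr]_w f (state k w).1 - f xs.
pose v k := \int[Pr]_w bregman d (state k w).2 xs.
have -> : bregman d x0 xs = v 0%N by exact: esym (Rint_cst Pr (bregman d x0 xs)).
(* The recursion asks for nonnegativity at every index, whereas integrability is known up to [N];
   beyond it the sequence is set to 0. *)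
pose Phi' k := if (k <= N)%N then Phi k else 0.
have -> : \int[Pr]_w f (state N w).1 - f xs = Phi' N by rewrite /Phi' leqnn.
apply: (accelerated_recursion (v := v) A_gt0 nR noise0 kap0) => //.
- move=> k; rewrite /Phi'; case: ifP => // kN; rewrite /Phi subr_ge0.
  rewrite -(Rint_cst Pr (f xs)); apply: le_Rint; first exact: intble_cst.
    exact: intble_ardd_objective.
  by move=> w; exact: xs_min.
- by move=> k; apply: Rintegral_ge0 => w _; exact: (bregman_ge0 p_ge1 p_le2 d_prox).
- move=> k lam kN lam0; rewrite /Phi' kN (ltnW kN).
  have [_ /(_ lam lam0)] := iteration_step (k := Ordinal kN) (intble_iterates (ltnW kN)).
  rewrite -/(v k) -/(v k.+1) /Phi /= /ardd_alpha; lra.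
Qed.

End ardd_convergence.

(** * Reduction to directions on the sphere, and the final constants *)

Lemma ardd_state_ext {R : realType} {n m : nat} {X : Type}
    (g : 'rV[R]_n -> X -> 'rV[R]_n) (zeta eta : 'rV[R]_n -> X -> 'rV[R]_n -> R)
    (L2 rho_n : R) d x0 (e e' : nat -> 'rV[R]_n) (xi : nat -> 'I_m -> X) k :
  (forall j, (j < k)%N -> e j.+1 = e' j.+1) ->
  ardd L2 rho_n d (oracle g zeta eta) x0 e xi k = ardd L2 rho_n d (oracle g zeta eta) x0 e' xi k.
Proof.
elim: k => //= k IHk ee'; rewrite IHk; last by move=> j jk; apply: ee'; rewrite ltnS ltnW.
by rewrite ee'.
Qed.

Section sphere_retraction.
Context {R : realType} {n : nat}.
Variable e0 : 'rV[R]_n.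
Hypothesis e0_sphere : sphere2 e0.

(* The directions lie on the sphere only almost surely, while the bounds on [zeta] and [eta] hold on the sphere only: composing with this map makes the directions unit vectors everywhere, without changing the law or the independence. *)
Definition sphere_retraction (v : 'rV[R]_n) : 'rV[R]_n := if v \in sphere2 then v else e0.

Lemma sphere_retraction_in v : sphere2 (sphere_retraction v).
Proof. by rewrite /sphere_retraction; case: ifPn => // /set_mem. Qed.

Lemma sphere_retraction_id v : sphere2 v -> sphere_retraction v = v.
Proof. by rewrite /sphere_retraction => sv; rewrite mem_set. Qed.

Lemma measurable_sphere_retraction : measurable_fun setT sphere_retraction.
Proof.
apply: (@measurable_fun_ifT _ _ _ _ id (cst e0)).
- apply: (measurable_fun_bool true); rewrite setTI.
  rewrite (_ : _ @^-1` _ = sphere2); first exact: measurable_sphere2.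
  by apply/seteqP; split => v /=; [move=> /set_mem|move=> /mem_set].
- exact: measurable_id.
- exact: measurable_cst.
Qed.

Lemma uniform_sphere_retraction (mu : probability 'rV[R]_n R) B : uniform_on_sphere mu ->
  measurable B -> mu (sphere_retraction @^-1` B) = mu B.
Proof.
move=> mu_unif mB; have sphereC : mu (~` sphere2) = 0%E.
  rewrite probability_setC; last exact: measurable_sphere2.
  by have [-> _] := mu_unif; rewrite subee.
have nul A : measurable A -> mu (A `\` sphere2) = 0%E.
  move=> mA; apply: (@subset_measure0 _ _ _ _ _ (~` sphere2)).
  - exact: measurableD mA measurable_sphere2.
  - exact: measurableC measurable_sphere2.
  - by move=> v [].
  - exact: sphereC.
have mpB : measurable (sphere_retraction @^-1` B).
  by rewrite -[X in measurable X]setTI; exact: measurable_sphere_retraction.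
have muI A : measurable A -> mu A = mu (A `&` sphere2).
  move=> mA; rewrite [LHS](measureDI mu mA measurable_sphere2) -[RHS]add0e.
  by congr (_ + _)%E; exact: nul.
rewrite muI // [RHS]muI //; congr (mu _); apply/seteqP; split => v [] /= Bv sv; split => //.
  by rewrite -(sphere_retraction_id sv).
by rewrite sphere_retraction_id.
Qed.

End sphere_retraction.

(** Here [s] is [sqrt Delta_zeta], [De] is [Delta_eta] and [nu] is [n]. By [4 s De <= s^2 + 4 De^2],
    [3/2 * noise] is at most [9/4 s^2 + 6 De^2], within 61/24 and 122/3. In the last term [s^2] has
    the coefficient 1/4 on both sides, without slack. *)
Lemma ardd_bound_le {R : realFieldType} (Theta nu rho L N m s2 s De noise : R) :
  0 < nu -> 0 < rho -> 0 < L -> 0 < N -> 0 < m -> 0 <= s2 -> 0 <= s -> 0 <= De ->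
  noise = s ^+ 2 + 2 * s * De + 2 * De ^+ 2 ->
  4 * (96 * nu ^+ 2 * rho * L) * Theta / N ^+ 2
  + 2 * N * ((3 / 4 * (s2 / (nu * m)) + 3 / 4 * noise) / L)
  + 2 * nu * noise * N ^+ 2 / (96 * nu ^+ 2 * rho * L) <=
  384 * Theta * nu ^+ 2 * rho * L / N ^+ 2 + 4 * N / (nu * L) * (s2 / m)
  + 61 * N / (24 * L) * s ^+ 2 + 122 * N / (3 * L) * De ^+ 2
  + N ^+ 2 / (12 * nu * rho * L) * (s / 2 + 2 * De) ^+ 2.
Proof.
move=> nu0 r0 L0 N0 m0 s20 s0 De0 noiseE.
have h1 : 2 * N * ((3 / 4 * (s2 / (nu * m)) + 3 / 4 * noise) / L) =
  3 / 2 * (N / (nu * L) * (s2 / m)) + N / L * (3 / 2 * noise).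
  by field; rewrite !gt_eqF.
have h2 : 2 * nu * noise * N ^+ 2 / (96 * nu ^+ 2 * rho * L) =
  N ^+ 2 / (12 * nu * rho * L) * (noise / 4).
  by field; rewrite !gt_eqF.
have h3 : 0 <= N / (nu * L) * (s2 / m).
  by apply: mulr_ge0; apply: divr_ge0 => //; apply: ltW => //; exact: mulr_gt0.
have NL : 0 <= N / L by rewrite divr_ge0 ?ltW.
have h4 : N / L * (3 / 2 * noise) <= N / L * (61 / 24 * s ^+ 2 + 122 / 3 * De ^+ 2).
  apply: ler_wpM2l => //.
  have := sqr_ge0 (s - 2 * De); have := sqr_ge0 De; have := sqr_ge0 s; rewrite noiseE; lra.
have c0 : 0 <= N ^+ 2 / (12 * nu * rho * L).
  apply: divr_ge0; first exact: sqr_ge0.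
  by apply: ltW; apply: mulr_gt0 => //; apply: mulr_gt0 => //; apply: mulr_gt0.
have h5 : N ^+ 2 / (12 * nu * rho * L) * (noise / 4) <=
   N ^+ 2 / (12 * nu * rho * L) * (s / 2 + 2 * De) ^+ 2.
  apply: ler_wpM2l => //; rewrite noiseE.
  have := mulr_ge0 s0 De0; have := sqr_ge0 De; lra.
have -> : 61 * N / (24 * L) * s ^+ 2 = N / L * (61 / 24 * s ^+ 2) by field; rewrite gt_eqF.
have -> : 122 * N / (3 * L) * De ^+ 2 = N / L * (122 / 3 * De ^+ 2) by field; rewrite gt_eqF.
have -> : 4 * N / (nu * L) * (s2 / m) = 4 * (N / (nu * L) * (s2 / m)) by field; rewrite !gt_eqF.
have -> : 384 * Theta * nu ^+ 2 * rho * L / N ^+ 2 = 4 * (96 * nu ^+ 2 * rho * L) * Theta / N ^+ 2.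
  by field; rewrite gt_eqF.
rewrite h1 h2; lra.
Qed.

Unset Implicit Arguments.

Theorem theorem2p2 (R : realType) (n : nat) (hn : (8 <= n)%N)
  (dX : measure_display) (X : measurableType dX) (P : probability X R)
  (F : 'rV[R]_n -> X -> R) (g : 'rV[R]_n -> X -> 'rV[R]_n) (L : X -> R)
  (L2 sigma : R) (L2_gt0 : 0 < L2)
  (F_integrable : forall x, P.-integrable setT (EFin \o F x))
  (g_measurable : measurable_fun setT (fun u : 'rV[R]_n * X => g u.1 u.2))
  (L_measurable : measurable_fun setT L)
  (F_convex_smooth : {ae P, forall xi,
     [/\ closed_function (F ^~ xi),
         convex_function [set: 'rV[R]_n] (F ^~ xi),
         has_gradient (F ^~ xi) (g ^~ xi)
       & lipschitz2 (g ^~ xi) (L xi)]})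
  (L_moment : ('E_P[fun xi => (L xi ^+ 2)%R] `^ 2^-1 <= L2%:E)%E)
  (g_variance : forall x,
     ('E_P[fun xi => (norm2 (g x xi - grad (objective P F) x) ^+ 2)%R]
        <= (sigma ^+ 2)%:E)%E)
  (xstar : 'rV[R]_n) (xstar_min : minimizer (objective P F) xstar)
  (zeta eta : 'rV[R]_n -> X -> 'rV[R]_n -> R) (Delta_zeta Delta_eta : R)
  (zeta_measurable : measurable_fun setT
     (fun u : 'rV[R]_n * X * 'rV[R]_n => zeta u.1.1 u.1.2 u.2))
  (eta_measurable : measurable_fun setT
     (fun u : 'rV[R]_n * X * 'rV[R]_n => eta u.1.1 u.1.2 u.2))
  (zeta_bound : forall x e, sphere2 e ->
     ('E_P[fun xi => (zeta x xi e ^+ 2)%R] <= Delta_zeta%:E)%E)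
  (eta_bound : forall x e, sphere2 e ->
     {ae P, forall xi, `|eta x xi e| <= Delta_eta})
  (p : R) (p_ge1 : 1 <= p) (p_le2 : p <= 2) (d : 'rV[R]_n -> R)
  (d_prox : prox_function p d)
  (d_p1 : p = 1 -> d = prox_l1) (d_p2 : p = 2 -> d = prox_l2)
  (dO : measure_display) (Omega : measurableType dO) (Pr : probability Omega R)
  (N m : nat) (N_gt0 : (0 < N)%N) (m_gt0 : (0 < m)%N)
  (e : nat -> {RV Pr >-> 'rV[R]_n}) (xi : nat -> 'I_m -> {RV Pr >-> X})
  (e_uniform : forall k : 'I_N, uniform_on_sphere (distribution Pr (e k.+1)))
  (xi_law : forall (k : 'I_N) (i : 'I_m) (A : set X), measurable A ->
     distribution Pr (xi k.+1 i) A = P A)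
  (e_xi_independent : samples_independent Pr N (fun k => e k) (fun k i => xi k i))
  (x0 : 'rV[R]_n) :
  let f := objective P F in
  let rho_n := rho n (hoelder_conjugate p%:E) in
  let y_N := fun w : Omega =>
    ardd_output L2 rho_n d (oracle g zeta eta) x0 (fun k => e k w)
      (fun k i => xi k i w) N in
  let Theta_p := bregman d x0 xstar in
  let delta := Num.sqrt Delta_zeta / 2 + 2 * Delta_eta in
  ('E_Pr[f \o y_N] - (f xstar)%:E <=
    (384 * Theta_p * n%:R ^+ 2 * rho_n * L2 / N%:R ^+ 2
     + 4 * N%:R / (n%:R * L2) * (sigma ^+ 2 / m%:R)
     + 61 * N%:R / (24 * L2) * Delta_zeta
     + 122 * N%:R / (3 * L2) * Delta_eta ^+ 2
     + 12 * Num.sqrt (2 * n%:R * Theta_p) / N%:R ^+ 2 * delta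
     + N%:R ^+ 2 / (12 * n%:R * rho_n * L2) * delta ^+ 2)%R%:E)%E.

Proof.
cbv zeta; set f := objective P F; set rho_n := rho n _; set y_N := (fun w : Omega => _).
set Theta_p := bregman d x0 xstar; set delta := _ / 2 + 2 * Delta_eta.
have n0 : (0 < n)%N := leq_trans (isT : 0 < 8)%N hn.
have [v0 sv0] := @sphere2_inhabited R n n0.
pose e' k w := sphere_retraction v0 (e k w).
have mpsi := measurable_sphere_retraction v0.
have me' k : measurable_fun setT (e' k).
  exact: (measurableT_comp mpsi (measurable_funPT (e k))).
have me (k : 'I_N) := me' k.+1.
have mxi (k : 'I_N) i : measurable_fun setT (xi k.+1 i : Omega -> X) := measurable_funPT _.
have e'_sphere k w : sphere2 (e' k w) by exact: sphere_retraction_in.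
have e'_law (k : 'I_N) B : measurable B -> Pr (e' k.+1 @^-1` B) = distribution Pr (e k.+1) B.
  by move=> mB; rewrite -(uniform_sphere_retraction v0 (e_uniform k) mB).
(* Events generated by the retracted direction are generated by the direction itself. *)
have e'_independent : samples_independent Pr N e' (fun k i => xi k i : Omega -> X).
  move=> J B JB; apply: e_xi_independent => j jJ; have := JB j jJ.
  case: j jJ => [k|[k i]] jJ //= [D mD <-]; exists (sphere_retraction v0 @^-1` D) => //.
  by rewrite -[X in measurable X]setTI; exact: mpsi.
have bound := ardd_convergence hn N_gt0 m_gt0 L2_gt0 F_integrable g_measurable L_measurable
  F_convex_smooth L_moment g_variance zeta_measurable eta_measurable zeta_bound eta_bound
  p_ge1 p_le2 d_prox me mxi e'_sphere e_uniform e'_law xi_law e'_independent x0 xstar_min.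
have iN := intble_ardd_objective hn m_gt0 L2_gt0 F_integrable g_measurable L_measurable
  F_convex_smooth L_moment g_variance zeta_measurable eta_measurable zeta_bound eta_bound
  p_ge1 p_le2 d_prox me mxi e'_sphere e_uniform e'_law xi_law e'_independent x0 xstar_min (leqnn N).
(* Almost surely the first [N] directions lie on the sphere, where the retraction is the identity,
   so the two runs coincide up to [N]. *)
have ae_eN : {ae Pr, forall w, f (y_N w) = f (ardd_state g zeta eta L2 rho_n d x0 e' xi N w).1}.
  have : {ae Pr, forall w, forall k : 'I_N, sphere2 (e k.+1 w)}.
    apply: filter_forall => k; have [A [mA A0 sA]] := sphere_ae (e_uniform k).
    exists (e k.+1 @^-1` A); split => //; last by move=> w /= /sA.
    by rewrite -[X in measurable X]setTI; exact: (measurable_funPT (e k.+1)).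
  apply: filterS => w ew; congr (f (fst _)); rewrite /ardd_state.
  apply: ardd_state_ext => j jN.
  by rewrite /e' sphere_retraction_id //; exact: (ew (Ordinal jN)).
have -> : ('E_Pr[f \o y_N] =
    (\int[Pr]_w f (ardd_state g zeta eta L2 rho_n d x0 e' xi N w).1)%R%:E)%E.
  rewrite unlock -integral_Rint //; apply: ae_eq_integral => //.
  - apply/measurable_EFinP; apply: measurableT_comp.
    + exact: (measurable_objective L2_gt0 F_integrable g_measurable L_measurable F_convex_smooth L_moment).
    + exact: (measurable_ardd_state g_measurable zeta_measurable eta_measurable _ _ p_ge1 p_le2 d_prox x0
        (fun j _ => conj (measurable_funPT (e j.+1)) (fun i => measurable_funPT (xi j.+1 i)))).1.
  - exact/measurable_EFinP/(intble_measurable iN).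
  - by apply: filterS ae_eN => w /= ->.
rewrite -EFinB lee_fin; apply: le_trans bound _.
have rho0 : 0 < rho_n by have [] := exists_dual_weight hn p_ge1 p_le2.
have Dz0 := Delta_zeta_ge0 zeta_bound n0; have De0 := Delta_eta_ge0 eta_bound n0.
have sq := sqr_sqrtr Dz0.
apply: le_trans (ardd_bound_le (s := Num.sqrt Delta_zeta) (De := Delta_eta) Theta_p _ rho0 L2_gt0 _ _ (sqr_ge0 sigma) (sqrtr_ge0 _) De0 _) _;
  rewrite ?ltr0n ?sq //.
(* What is left is the term with [Theta_p] under the root; it is nonnegative, so it only enlarges
   the bound. *)
rewrite lerD2r lerDl mulr_ge0 ?mulr_ge0 ?invr_ge0 ?sqrtr_ge0 // ?sqr_ge0 //.
by rewrite addr_ge0 ?mulr_ge0 ?invr_ge0 ?sqrtr_ge0.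
Qed.
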